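(* Let $(X_t)_{t\in\mathbb Z}$ be a real-valued stationary time series with extremal index $\theta>0$, let $(u_n)$ be a sequence of (deterministic) thresholds and $(s_n)$ a sequence of natural numbers, and put $v_n:=P\{X_1>u_n\}$. Suppose: (1) $v_n\to0$, $nv_n\to\infty$, $s_n\to\infty$, and $(r_n)_{n\in\mathbb N}$ is a sequence of natural numbers such that $s_n=o(r_n)$, $r_nv_n\to0$, $r_n=o(\sqrt{nv_n})$ and $(n/r_n)\beta^X_{n,s_n-1}\to0$. (2) The limit $\displaystyle c:=\lim_{n\to\infty}\frac1{r_nv_n}E\Big[\Big(\sum_{j=1}^{r_n}\mathbf 1_{\{X_j>u_n\}}\Big)^2\Big]$ exists in $[0,\infty)$. (3) For all $n,k\in\mathbb N$ there exists $e_n(k)\ge P(X_k>u_n\mid X_0>u_n)$ such that $\displaystyle\lim_{n\to\infty}\sum_{k=1}^{r_n}e_n(k)=\sum_{k=1}^\infty\lim_{n\to\infty}e_n(k)<\infty$. Then: (a) if $\displaystyle\frac{P\{M_{1,s_n}>u_n\}}{s_nv_n}-\theta=o\big((nv_n)^{-1/2}\big)$, then for $\sharp\in\{d,s\}$, $\sqrt{nv_n}\,(\hat\theta_n^\sharp-\theta)$ converges weakly to $\mathcal N\big(0,\theta(\theta c-1)\big)$; (b) if $P(M_{2,s_n}\le u_n\mid X_1>u_n)-\theta=o\big((nv_n)^{-1/2}\big)$, then $\sqrt{nv_n}\,(\hat\theta_n^r-\theta)$ converges weakly to $\mathcal N\big(0,\theta(\theta c-1)\big)$.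
   Context: The stationary time series $(X_t)_{t\in\mathbb Z}$ has extremal index $\theta$ if for all thresholds $u_n(\tau)$ such that $nP\{X_0>u_n(\tau)\}\to\tau$ for some $\tau>0$ one has $\lim_{n\to\infty}P\{\max_{1\le i\le n}X_i\le u_n(\tau)\}=e^{-\theta\tau}$; always $\theta\in[0,1]$, and $\theta>0$ is assumed throughout. Notation: $M_{i,j}:=\max(X_i,\dots,X_j)$. The estimators of $\theta$ are: the disjoint blocks estimator $$\hat\theta_n^d:=\frac{\sum_{i=1}^{\lfloor n/s_n\rfloor}\mathbf 1_{\{M_{(i-1)s_n+1,is_n}>u_n\}}}{\sum_{i=1}^{n-s_n+1}\mathbf 1_{\{X_i>u_n\}}},$$ the sliding blocks estimator $$\hat\theta_n^s:=\frac{\frac1{s_n}\sum_{i=1}^{n-s_n+1}\mathbf 1_{\{M_{i,i+s_n-1}>u_n\}}}{\sum_{i=1}^{n-s_n+1}\mathbf 1_{\{X_i>u_n\}}},$$ and the runs estimator $$\hat\theta_n^r:=\frac{\sum_{i=1}^{n-s_n+1}\mathbf 1_{\{X_i>u_n,\,M_{i+1,i+s_n-1}\le u_n\}}}{\sum_{i=1}^{n-s_n+1}\mathbf 1_{\{X_i>u_n\}}}.$$ Mixing coefficients: $\beta^X_{n,k}:=\sup_{1\le l\le n-k-1}E\big[\sup_{B\in\mathcal B_{l+k+1}^n}|P(B\mid\mathcal B_{1}^l)-P(B)|\big]$, where $\mathcal B_{i}^j$ is the $\sigma$-field generated by $X_i,\dots,X_j$. *)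

(* Defs.v *)
From HB Require Import structures.
From mathcomp Require Import all_boot all_order all_algebra.
From mathcomp Require Import all_classical all_reals all_analysis.
Set Implicit Arguments.
Unset Strict Implicit.
Unset Printing Implicit Defensive.
Import Order.TTheory GRing.Theory Num.Theory.
Import numFieldNormedType.Exports.
Local Open Scope classical_set_scope.
Local Open Scope ring_scope.

Section time_series.
Context {d : measure_display} {T : measurableType d} {R : realType}.
Variables (P : probability T R) (X : int -> {RV P >-> R}).

Definition stationary : Prop :=
  forall (m : nat) (t : m.-tuple int) (h : int) (A : set (m.-tuple R)),
    measurable A ->
    P [set w | A [tuple X (tnth t i + h) w | i < m]] =
    P [set w | A [tuple X (tnth t i) w | i < m]].

Definition prob (A : set T) : R := fine (P A).

(* Equal to 0 when P B = 0 (division by zero). *)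
Definition cond_prob (A B : set T) : R := prob (A `&` B) / prob B.

(* max (X_i, ..., X_j), for i <= j. *)
Definition block_max (i j : nat) (w : T) : R :=
  \big[Num.max/X i w]_(i <= t < j.+1) X t w.

Definition exceeds (i : int) (x : R) : set T := [set w | x < X i w].

Definition block_exceeds (i j : nat) (x : R) : set T :=
  [set w | x < block_max i j w].

Definition block_below (i j : nat) (x : R) : set T :=
  [set w | block_max i j w <= x].

Definition has_extremal_index (theta : R) : Prop :=
  forall (tau : R) (u : nat -> R), 0 < tau ->
    n%:R * prob (exceeds 0 (u n)) @[n --> \oo] --> tau ->
    prob (block_below 1 n (u n)) @[n --> \oo] --> expR (- (theta * tau)).

(* The sums run over 1 <= i <= n - s + 1, and are empty when s > n. *)
Definition nb_exceed (n s : nat) (x : R) (w : T) : R :=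
  \sum_(1 <= i < (n.+1 - s).+1) \1_(exceeds i x) w.

Definition disjoint_blocks_estimator (n s : nat) (x : R) (w : T) : R :=
  (\sum_(1 <= i < (n %/ s).+1)
     \1_(block_exceeds (i.-1 * s + 1) (i * s) x) w) / nb_exceed n s x w.

Definition sliding_blocks_estimator (n s : nat) (x : R) (w : T) : R :=
  (s%:R^-1 * \sum_(1 <= i < (n.+1 - s).+1)
     \1_(block_exceeds i (i + s - 1) x) w) / nb_exceed n s x w.

Definition runs_estimator (n s : nat) (x : R) (w : T) : R :=
  (\sum_(1 <= i < (n.+1 - s).+1)
     \1_(exceeds i x `&` block_below (i + 1) (i + s - 1) x) w)
  / nb_exceed n s x w.

(* Generators of the sigma-field B_i^j of X_i, ..., X_j, which is
   <<s sigma_gen i j >>. *)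
Definition sigma_gen (i j : nat) : set_system T :=
  \bigcup_(t in [set t : nat | (i <= t <= j)%N])
    preimage_set_system setT (X t) measurable.

(* kappa is a regular version of the conditional distribution of Y given the
   sigma-field <<s F >>, i.e. kappa w B = P(Y \in B | <<s F >>)(w). *)
Definition regular_cond_dist (F : set_system T) (m : nat)
    (Y : T -> m.-tuple R)
    (kappa : R.-pker (g_sigma_algebraType F) ~> (m.-tuple R)) : Prop :=
  forall (A : set T) (B : set (m.-tuple R)), <<s F >> A -> measurable B ->
    (\int[P]_(w in A) kappa w B = P (A `&` Y @^-1` B))%E.

(* The vector (X_i, ..., X_{i+m-1}). *)
Definition segment (i m : nat) (w : T) : m.-tuple R :=
  [tuple X (Posz (i + j)) w | j < m].

(* E[sup_B |P(B | B_1^l) - P(B)|], B ranging over B_{l+k+1}^n, that is over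
   the events {segment \in B} with B a Borel set of R^(n-l-k). The conditional
   probability is defined up to null sets depending on B, so the uncountable
   supremum is taken along a regular version. Such a version always exists,
   because segment is a random vector of a Euclidean space, and all versions
   have the same expectation: the infimum is over a nonempty set of equal
   values. (A regular version on the sigma-field B_{l+k+1}^n of T itself need
   not exist for an arbitrary T.) *)
Definition mixing_gap (n k l : nat) : \bar R :=
  let Y := segment (l + k + 1) (n - (l + k)) in
  ereal_inf
    [set (\int[P]_w ereal_sup
            [set `|kappa w B - P (Y @^-1` B)| | B in measurable])%E
    | kappa in regular_cond_dist (F := sigma_gen 1 l) Y].

Definition beta_mixing (n k : nat) : \bar R :=
  ereal_sup [set mixing_gap n k l | l in [set l | (1 <= l <= n - k - 1)%N]].

Definition weak_cvg (Y : nat -> T -> R) (mu : probability (measurableTypeR R) R) : Prop :=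
  forall f : R -> R, continuous f -> bounded_fun f ->
    ('E_P[f \o Y n] @[n --> \oo] --> \int[mu]_x (f x)%:E)%E.

End time_series.

(* The normal law with variance s2 >= 0. It is degenerate when s2 = 0, where
   the library's normal_prob is by convention uniform on [0, 1]. *)
Definition normal_law {R : realType} (m s2 : R) :
    probability (measurableTypeR R) R :=
  if s2 == 0 then (\d_(m : measurableTypeR R) : probability _ _)
  else (normal_prob m (Num.sqrt s2) : probability _ _).

(* Weak convergence to N(m, s2); that s2 is a variance is part of it. *)
Definition weak_cvg_normal {d : measure_display} {T : measurableType d}
    {R : realType} (P : probability T R) (Y : nat -> T -> R) (m s2 : R) :=
  0 <= s2 /\ weak_cvg P Y (normal_law m s2).

(* Main.v *)
(** Only the pattern of exceedances over [u_n] matters, a random element of a finite set of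
    bit strings. Cut it into blocks of length [s_n], and let [eta_b] be the contribution of the
    b-th block to the numerator of the estimator minus [theta] times its number of
    exceedances. Grouping about [r_n / s_n] consecutive blocks and leaving out the last two of
    each group, beta-mixing makes the groups independent at a cost of order
    [(n / r_n) beta_n]; Lindeberg's replacement of the groups by Gaussian increments (tested on
    smooth functions) then gives a central limit theorem, and the blocks left out are
    negligible since [s_n = o(r_n)]. For the variance, condition (3) says that two clusters of
    exceedances rarely occur in the same group, so the contribution of a group to the numerator
    is L2-close to the indicator [U] of at least one exceedance; as [U A = A] for the number
    [A] of exceedances, E(U - theta A)^2 = EU - 2 theta EA + theta^2 EA^2, which is equivalent
    to [r_n v_n (theta - 2 theta + theta^2 c)]. Finally the denominator is equivalent in
    probability to [n v_n]. *)

(* Blocks are left out in pairs because the contribution of a block may read the next block as well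
   (sliding blocks and runs look ahead) and so depends on [2 s_n] bits. The last retained
   contribution of a group spills over into the first omitted block; the second omitted block is the
   gap that matches the lag [s_n - 1] of the mixing coefficient. Mixing is used only through the L1
   distance, on finite sets, between a joint law and the product of its marginals; twice the
   coefficient bounds it, whichever regular version of the conditional law is taken. Gaussian
   increments never appear as random variables: the test function is averaged against a normal law
   instead, so the argument stays on the space of bit strings. Closeness to the indicator U rests on
   counting pairs of exceedances. Those at lag above K cost the tail of the series in (3), with K
   fixed before n; this is where the interchange of limit and sum enters. For disjoint blocks and
   runs the deviation from U is an integer, so its square bounds its absolute value and one estimate
   serves in L1 and L2; sliding blocks are averages of shifted disjoint blocks. *)
Require Import Defs.
From HB Require Import structures.
From mathcomp Require Import all_boot all_order all_algebra.
From mathcomp Require Import all_classical all_reals all_analysis.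
From mathcomp Require Import measurable_realfun normal_distribution.
From mathcomp Require Import ring lra zify.
Set Implicit Arguments.
Unset Strict Implicit.
Unset Printing Implicit Defensive.
Import Order.TTheory GRing.Theory Num.Theory.
Import numFieldNormedType.Exports.
Local Open Scope classical_set_scope.
Local Open Scope ring_scope.

(** * Taylor bounds *)

Section taylor.
Context {R : realType}.
Implicit Types g h : R -> R.

(** The derivative is bounded only at points no farther from [a] than [y] is: for the exponential
    there is no global bound. *)
Lemma mean_value_bound h h1 (a y K : R) :
  (forall x : R, is_derive x 1 h (h1 x)) ->
  (forall x, `|x - a| <= `|y - a| -> `|h1 x| <= K) ->
  `|h y - h a| <= K * `|y - a|.
Proof.
move=> dh hK.
have ch (b c : R) : {within `[b, c], continuous h}.
  apply: continuous_subspaceT => z.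
  exact/differentiable_continuous/derivable1_diffP/ex_derive.
have [ay|ya] := leP a y.
- have [x /[!in_itv]/= /andP[ax xy] ->] := MVT_segment ay (fun x _ => dh x) (ch a y).
  rewrite normrM ler_wpM2r// hK// !ger0_norm ?subr_ge0//; lra.
- have [x /[!in_itv]/= /andP[yx xa]] := MVT_segment (ltW ya) (fun x _ => dh x) (ch y a).
  rewrite distrC => ->; rewrite normrM (distrC a y) ler_wpM2r// hK//.
  rewrite !ler0_norm; lra.
Qed.

(** The mean value bound is applied to [g1] and then to [g], each minus its Taylor polynomial. The
    factor 1/6 is lost this way; only the cubic order matters later. *)
Lemma taylor2_lipschitz g g1 g2 (y L : R) : 
  (forall x : R, is_derive x 1 g (g1 x)) -> (forall x : R, is_derive x 1 g1 (g2 x)) ->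
  (forall x, `|x| <= `|y| -> `|g2 x - g2 0| <= L * `|x|) ->
  `|g y - g 0 - y * g1 0 - y ^+ 2 / 2 * g2 0| <= L * `|y| ^+ 3.
Proof.
move=> dg dg1 gL.
have [->|y0] := eqVneq y 0.
  by rewrite expr0n/= !mul0r !subr0 subrr normr0 expr0n/= mulr0.
have L0 : 0 <= L.
  have := gL y (lexx _); rewrite -(pmulr_lge0 _ (_ : 0 < `|y|)) ?normr_gt0//.
  by apply: le_trans.
have h1 x : `|x| <= `|y| -> `|g1 x - g1 0 - x * g2 0| <= L * `|x| ^+ 2.
  move=> xy; pose h z := g1 z - z * g2 0.
  have dh (z : R) : is_derive z 1 h (g2 z - g2 0).
    by apply: is_derive_eq; rewrite /GRing.scale/=; ring.
  have := @mean_value_bound h _ 0 x (L * `|x|) dh.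
  rewrite subr0 /h mul0r subr0 -addrA [X in _ + X]addrC addrA expr2 mulrA; apply=> z.
  rewrite subr0 => zx; apply: le_trans (gL _ (le_trans zx xy)) _.
  by rewrite ler_wpM2l.
pose h z := g z - z * g1 0 - z * z * (g2 0 / 2).
have dh (z : R) : is_derive z 1 h (g1 z - g1 0 - z * g2 0).
  by apply: is_derive_eq; rewrite /GRing.scale/=; field.
have := @mean_value_bound h _ 0 y (L * `|y| ^+ 2) dh.
rewrite subr0 /h !mul0r !subr0.
have -> : g y - y * g1 0 - y * y * (g2 0 / 2) - g 0 =
          g y - g 0 - y * g1 0 - y ^+ 2 / 2 * g2 0 by field.
rewrite -(mulrA L) -exprSr; apply=> z; rewrite subr0 => zy; apply: le_trans (h1 _ zy) _.
by rewrite ler_wpM2l// lerXn2r// nnegrE.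
Qed.

End taylor.

(** * Gaussian averages *)

Section normal_density_integral.
Context {R : realType}.
Local Notation mu := (@lebesgue_measure R).
Import HBNNSimple.

(** The density defines [normal_prob] on sets; simple functions here, and monotone convergence in
    the next lemma, turn integrals against it into Lebesgue integrals. *)
Let normal_prob_nnsfun (m s : R) (f : {nnsfun measurableTypeR R >-> R}) :
  (\int[normal_prob m s]_x (f x)%:E =
   \int[mu]_x ((f x)%:E * (normal_pdf m s x)%:E))%E.
Proof.
have mpdf : measurable_fun setT (EFin \o normal_pdf m s).
  by apply/measurable_EFinP; exact: measurable_normal_pdf.
have pdf0 x : (0 <= (normal_pdf m s x)%:E)%E by rewrite lee_fin normal_pdf_ge0.
under [LHS]eq_integral do rewrite fimfunE -fsumEFin//.
rewrite [LHS]ge0_integral_fsum//; last 2 first.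
  - by move=> r; exact/measurable_EFinP/measurableT_comp.
  - by move=> n x _; rewrite EFinM nnfun_muleindic_ge0.
under [RHS]eq_integral.
  move=> x xD; rewrite fimfunE -fsumEFin// muleC ge0_mule_fsumr; last first.
    by move=> r; rewrite EFinM nnfun_muleindic_ge0.
  over.
rewrite [RHS]ge0_integral_fsum//; last 2 first.
  - move=> r; apply: emeasurable_funM => //.
    by apply/measurable_EFinP; do 2 apply/measurableT_comp => //.
  - move=> n x _; rewrite EFinM mule_ge0//; last by rewrite nnfun_muleindic_ge0.
apply: eq_fsbigr => r _.
rewrite integralZl_indic_nnsfun//= integral_indic//= setIT.
under [RHS]eq_integral do rewrite EFinM muleCA.
rewrite [LHS](_ : _ = (r%:E * \int[mu]_(x in f @^-1` [set r]) (normal_pdf m s x)%:E)%E)//.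
have [r0|r0] := leP 0%R r; last first.
  rewrite preimage_nnfun0// integral_set0 mule0 integral0_eq// => x _.
  by rewrite indicE in_set0/= mule0 mule0.
rewrite ge0_integralZl//.
- congr (_ * _)%E; rewrite [LHS]integral_mkcond; apply: eq_integral => x _.
  by rewrite patchE indicE; case: (x \in _); rewrite ?mule1 ?mule0.
- apply: emeasurable_funM => //.
  by apply/measurable_EFinP; exact: measurable_indic.
- by move=> x _; rewrite mule_ge0// lee_fin.
Qed.

Lemma ge0_integral_normal_prob (m s : R) (f : R -> \bar R) :
  measurable_fun setT f -> (forall x, 0 <= f x)%E ->
  (\int[normal_prob m s]_x f x = \int[mu]_x (f x * (normal_pdf m s x)%:E))%E.
Proof.
move=> mf f0.
have mpdf : measurable_fun setT (EFin \o normal_pdf m s).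
  by apply/measurable_EFinP; exact: measurable_normal_pdf.
have pdf0 x : (0 <= (normal_pdf m s x)%:E)%E by rewrite lee_fin normal_pdf_ge0.
pose f_ := nnsfun_approx (@measurableT _ (measurableTypeR R)) (mf : measurable_fun [set: measurableTypeR R] f).
have f_cvg x : (f_ n x)%:E @[n --> \oo] --> f x by exact: cvg_nnsfun_approx.
have f_nd x : {homo (fun n => (f_ n x)%:E) : a b / (a <= b)%N >-> (a <= b)%E}.
  by move=> a b ab; rewrite lee_fin; exact/lefP/nd_nnsfun_approx.
transitivity (lim (\int[normal_prob m s]_x (f_ n x)%:E @[n --> \oo])%E).
  rewrite -monotone_convergence//=.
  - by apply: eq_integral => x _; apply/esym/cvg_lim => //; exact: f_cvg.
  - by move=> n; have := @measurable_funPT _ _ _ _ (f_ n); by move=> /measurable_EFinP.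
  - by move=> n ? _; rewrite lee_fin.
transitivity (lim (\int[mu]_x ((f_ n x)%:E * (normal_pdf m s x)%:E) @[n --> \oo])%E).
  apply: congr_lim; apply/funext => n; exact: normal_prob_nnsfun.
rewrite -monotone_convergence//=.
- apply: eq_integral => x _; apply/cvg_lim => //.
  by apply: cvgeZr => //; exact: f_cvg.
- move=> n; apply: emeasurable_funM => //.
  have := @measurable_funPT _ _ _ _ (f_ n); by move=> /measurable_EFinP.
- by move=> n x _; rewrite mule_ge0// lee_fin.
- by move=> x _ a b ab; rewrite lee_wpmul2r// f_nd.
Qed.

End normal_density_integral.

Section gaussian_expectation.
Context {R : realType}.
Local Notation mu := (@lebesgue_measure R).
Local Notation gauss := (normal_prob (0:R) 1).

Lemma normal_pdf_expR (m s y : R) : 0 < s ->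
  normal_pdf m s y =
    (s * Num.sqrt (pi *+ 2))^-1 * expR (- ((y - m) ^+ 2 / (s ^+ 2 *+ 2))).
Proof.
move=> s0; rewrite normal_pdfE ?gt_eqF// /normal_peak /normal_fun mulNr.
by rewrite -mulrnAr sqrtrM ?sqr_ge0// sqrtr_sqr gtr0_norm.
Qed.

Lemma normal_pdf_affine (x a z : R) : 0 < a ->
  normal_pdf x a (x + a * z) * a = normal_pdf 0 1 z.
Proof.
move=> a0; rewrite !normal_pdf_expR//.
have -> : (x + a * z - x) ^+ 2 / (a ^+ 2 *+ 2) = (z - 0) ^+ 2 / (1 ^+ 2 *+ 2).
  by field; rewrite gt_eqF.
rewrite mul1r invfM mulrAC; congr (_ * _).
by rewrite -mulrA mulrC -mulrA mulfV ?mulr1// gt_eqF.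
Qed.

(** Completing the square. The joint density of [w] and [y = x + b w + a z] splits into the density
    of [y] and the conditional density of [w] given [y], whose mean and deviation are the parameters
    of the last factor. *)
Lemma normal_pdf_convolution (x a b y w : R) : 0 < a -> 0 < b ->
  normal_pdf (x + b * w) a y * normal_pdf 0 1 w =
  normal_pdf x (Num.sqrt (a ^+ 2 + b ^+ 2)) y *
  normal_pdf (b * (y - x) / (a ^+ 2 + b ^+ 2)) (a / Num.sqrt (a ^+ 2 + b ^+ 2)) w.
Proof.
move=> a0 b0; set c := Num.sqrt _.
have c0 : 0 < c by rewrite sqrtr_gt0 addr_gt0// exprn_gt0.
have c2 : a ^+ 2 + b ^+ 2 = c ^+ 2 by rewrite sqr_sqrtr// addr_ge0// sqr_ge0.
rewrite !normal_pdf_expR ?divr_gt0// mulrACA [RHS]mulrACA -!expRD -!invfM.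
congr (_^-1 * expR _).
  by field; rewrite gt_eqF.
have h : a ^+ 2 + b ^+ 2 != 0 by rewrite c2 expf_neq0// gt_eqF.
have h1 : (a / c) ^+ 2 = a ^+ 2 / (a ^+ 2 + b ^+ 2) by rewrite expr_div_n c2.
rewrite h1 -c2; field; rewrite h gt_eqF//=.
Qed.

Lemma integral_normal_affine (x a : R) (f : R -> R) : 0 < a ->
  continuous f -> (forall y, 0 <= f y) ->
  (\int[normal_prob x a]_y (f y)%:E = \int[gauss]_z (f (x + a * z))%:E)%E.
Proof.
move=> a0 cf f0.
have cF : continuous (fun z : R => x + a * z).
  by move=> z; apply: cvgD; [exact: cvg_cst|apply: cvgMr; exact: cvg_id].
have dF (z : R) : is_derive z 1 (fun z : R => x + a * z) a.
  by apply: is_derive_eq; rewrite /GRing.scale/=; ring.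
have F' : ((fun z : R => x + a * z)^`())%classic = cst a.
  by apply/funext => z; rewrite derive1E; exact: derive_val.
have cp : continuous (normal_pdf x a) by apply: continuous_normal_pdf; rewrite gt_eqF.
rewrite ge0_integral_normal_prob//; last first.
  by apply/measurable_EFinP; exact: continuous_measurable_fun.
under eq_integral do rewrite -EFinM.
rewrite (@increasing_ge0_integration_by_substitutionT _ (fun z => x + a * z)
  (fun y => f y * normal_pdf x a y)).
- rewrite ge0_integral_normal_prob.
  + apply: eq_integral => z _; rewrite -EFinM F' !fctE/= -mulrA.
    by rewrite normal_pdf_affine.
  + apply/measurable_EFinP; apply: continuous_measurable_fun => z.
    by apply: continuous_comp; [exact: cF|exact: cf].
  + by move=> z; rewrite lee_fin.
- by move=> y z yz; rewrite ltrD2l ltr_pM2l.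
- by rewrite F'; exact: cst_continuous.
- by rewrite F'; exact: is_cvg_cst.
- by rewrite F'; exact: is_cvg_cst.
- by move=> z; exact: ex_derive.
- under eq_fun do rewrite addrC mulrC.
  apply/cvgrNyPle => A; near=> z.
  by rewrite -lerBrDr -ler_pdivlMr//; near: z; apply: nbhs_ninfty_le; rewrite num_real.
- under eq_fun do rewrite addrC mulrC.
  apply/cvgryPge => A; near=> z.
  by rewrite -lerBlDr -ler_pdivrMr//; near: z; apply: nbhs_pinfty_ge; rewrite num_real.
- by move=> z; apply: cvgM; [exact: cf|exact: cp].
- by move=> z; rewrite mulr_ge0// normal_pdf_ge0.
Unshelve. all: by end_near. Qed.

Lemma ge0_gauss_convolution (x a b : R) (f : R -> R) : 0 < a -> 0 < b ->
  continuous f -> (forall y, 0 <= f y) ->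
  (\int[gauss]_w \int[gauss]_z (f (x + b * w + a * z))%:E =
   \int[gauss]_z (f (x + Num.sqrt (a ^+ 2 + b ^+ 2) * z))%:E)%E.
Proof.
move=> a0 b0 cf f0; set c := Num.sqrt _.
have c0 : 0 < c by rewrite sqrtr_gt0 addr_gt0// exprn_gt0.
have mf : measurable_fun [set: R] (EFin \o f).
  by apply/measurable_EFinP; exact: continuous_measurable_fun.
rewrite -(integral_normal_affine x c0 cf f0) [RHS]ge0_integral_normal_prob//.
under eq_integral => w _ do rewrite -(integral_normal_affine (x + b * w) a0 cf f0).
pose h1 (p : R * R) := (f p.2 * normal_pdf (x + b * p.1) a p.2)%:E.
pose h (p : R * R) := (h1 p * (normal_pdf 0 1 p.1)%:E)%E.
have mh1 : measurable_fun setT h1.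
  apply/measurable_EFinP; apply: measurable_funM.
    by apply: measurableT_comp => //; exact: continuous_measurable_fun.
  rewrite [X in measurable_fun _ X](_ : _ = fun p : R * R =>
    normal_pdf 0 a (p.2 - (x + b * p.1))).
    apply: measurableT_comp; first exact: measurable_normal_pdf.
    apply: measurable_funB => //; apply: measurable_funD => //.
    exact: measurable_funM.
  by apply/funext => p; rewrite !normal_pdf_expR// subr0.
have mh : measurable_fun setT h.
  apply: emeasurable_funM => //; apply/measurable_EFinP.
  by apply: measurableT_comp => //; exact: measurable_normal_pdf.
have h10 p : (0 <= h1 p)%E by rewrite lee_fin mulr_ge0// normal_pdf_ge0.
have F1 w : (\int[normal_prob (x + b * w) a]_y (f y)%:E = \int[mu]_y h1 (w, y))%E.
  by rewrite ge0_integral_normal_prob.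
have h0 p : (0 <= h p)%E by rewrite mule_ge0// lee_fin normal_pdf_ge0.
transitivity (\int[mu]_w \int[mu]_y h (w, y))%E.
  under eq_integral do rewrite F1.
  rewrite ge0_integral_normal_prob.
  - apply: eq_integral => w _; rewrite -ge0_integralZr//=.
    + by apply: measurableT_comp => //; exact: measurable_pair1.
    + by rewrite lee_fin normal_pdf_ge0.
  - exact: measurable_fun_fubini_tonelli_F.
  - by move=> w; apply: integral_ge0 => y _.
(* With [w] integrated first, only its conditional density depends on it, and that integrates to
   1. *)
rewrite fubini_tonelli//; apply: eq_integral => y _.
transitivity (\int[mu]_w ((f y * normal_pdf x c y)%:E *
   (normal_pdf (b * (y - x) / (a ^+ 2 + b ^+ 2)) (a / c) w)%:E))%E.
  apply: eq_integral => w _; rewrite /h/= /h1/= -!EFinM -!mulrA; congr (_ * _)%:E.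
  by rewrite normal_pdf_convolution// mulrA.
rewrite ge0_integralZl//.
- by rewrite integral_normal_pdf mule1 EFinM.
- by apply/measurable_EFinP; exact: measurable_normal_pdf.
- by move=> w _; rewrite lee_fin normal_pdf_ge0.
- by rewrite lee_fin mulr_ge0// normal_pdf_ge0.
Qed.

(** The only moment computed from the density, by translating it: integrability, mean and variance
    below all come out of this moment generating function. *)
Lemma integral_gauss_expR (t : R) :
  (\int[gauss]_z (expR (t * z))%:E = (expR (t ^+ 2 / 2))%:E)%E.
Proof.
have cexp : continuous (fun z : R => expR (t * z)).
  move=> z; apply: continuous_comp; last exact: continuous_expR.
  by apply: cvgMr; exact: cvg_id.
rewrite ge0_integral_normal_prob; last 2 first.
  by apply/measurable_EFinP; exact: continuous_measurable_fun.
  by move=> z; rewrite lee_fin expR_ge0.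
transitivity (\int[mu]_z ((expR (t ^+ 2 / 2))%:E * (normal_pdf t 1 z)%:E))%E.
  apply: eq_integral => z _; rewrite -!EFinM; congr _%:E.
  rewrite !normal_pdf_expR// mulrCA [RHS]mulrCA -!expRD; congr (_ * expR _); by field.
rewrite ge0_integralZl ?integral_normal_pdf ?mule1 ?lee_fin ?expR_ge0//.
  by apply/measurable_EFinP; exact: measurable_normal_pdf.
by move=> z _; rewrite lee_fin normal_pdf_ge0.
Qed.

(** A common dominating function: integrable by the moment generating function at [2] and [-2], and
    above [exp (2 |z|)], hence, up to a factor, above cubic growth even when multiplied by
    [exp |z|]. *)
Let e2 (z : R) : R := expR (2 * z) + expR (-2 * z).

Let continuous_e2 : continuous e2.
Proof.
move=> z; apply: cvgD; apply: continuous_comp; try exact: continuous_expR;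
  by apply: cvgMr; exact: cvg_id.
Qed.

Let integrable_e2 : gauss.-integrable setT (EFin \o e2).
Proof.
apply/integrableP; split.
  by apply/measurable_EFinP; exact: continuous_measurable_fun continuous_e2.
under eq_integral => z _ do
  rewrite /= ger0_norm ?addr_ge0 ?expR_ge0// EFinD.
have mexp t : measurable_fun [set: R] (fun z : R => (expR (t * z))%:E).
  by apply/measurable_EFinP; apply: measurableT_comp => //; exact: measurable_funM.
rewrite ge0_integralD ?integral_gauss_expR//=.
- by rewrite ltry.
- exact: mexp.
- exact: mexp.
Qed.

Lemma integrable_gauss (f : R -> R) (C : R) : continuous f ->
  (forall z, `|f z| <= C * e2 z) -> gauss.-integrable setT (EFin \o f).
Proof.
move=> cf fC.
apply: (@le_integrable _ _ _ gauss setT measurableT _ (EFin \o (fun z => C * e2 z))).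
- by apply/measurable_EFinP; exact: continuous_measurable_fun.
- move=> z _; rewrite !abse_EFin lee_fin; apply: le_trans (fC z) _.
  exact: ler_norm.
- under [X in _.-integrable _ X]eq_fun do rewrite /= EFinM.
  exact: integrableZl.
Qed.

Let expR_normr_le (z : R) : expR (2 * `|z|) <= e2 z.
Proof.
rewrite /e2; have [z0|z0] := ger0P z; first by rewrite lerDl expR_ge0.
by rewrite mulrN -mulNr lerDr expR_ge0.
Qed.

Let expR_normr_ge1 (z : R) : 1 <= expR `|z|.
Proof. by rewrite -[leLHS]expR0 ler_expR. Qed.

Let cube_expR (z : R) : `|z| ^+ 3 <= 6 * expR `|z|.
Proof.
have := expR_ge1Dxn 2 (normr_ge0 z); rewrite (_ : (3`!)%:R = 6 :> R)// => h.
rewrite -ler_pdivrMl// mulrC; apply: le_trans h; by rewrite lerDr.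
Qed.

Let cube_e2 (z : R) : `|z| ^+ 3 * expR `|z| <= 6 * e2 z.
Proof.
apply: le_trans (_ : 6 * expR `|z| * expR `|z| <= _).
  by rewrite ler_wpM2r// expR_ge0.
by rewrite -mulrA ler_pM2l// -expRD -mulr2n -mulr_natl.
Qed.

Lemma cube_le_e2 (z : R) : `|z| ^+ 3 <= 6 * e2 z.
Proof.
apply: le_trans (cube_e2 z); rewrite ler_peMr// exprn_ge0//.
Qed.

Lemma one_le_e2 (z : R) : 1 <= e2 z.
Proof.
apply: le_trans (expR_normr_le z); by rewrite -[leLHS]expR0 ler_expR mulr_ge0.
Qed.

(** The remainder is cubic in [t] with a factor integrable in [z], so the expansion can be
    integrated term by term. *)
Let expR_taylor (t z : R) : `|t| <= 1 ->
  `|expR (t * z) - 1 - t * z - t ^+ 2 / 2 * z ^+ 2| <= `|t| ^+ 3 * (6 * e2 z).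
Proof.
move=> t1.
have tz : `|t * z| <= `|z| by rewrite normrM ler_piMl.
have /(_ (t * z) (expR `|z|)) := taylor2_lipschitz (@is_derive_expR R) (@is_derive_expR R).
rewrite expR0 !mulr1 [(t * z) ^+ 2]exprMn mulrAC => h.
apply: le_trans (h _) _; last first.
  rewrite normrM exprMn mulrCA ler_wpM2l ?exprn_ge0// mulrC; exact: cube_e2.
move=> x xtz; have /(_ 0 x (expR `|z|)) := mean_value_bound (@is_derive_expR R).
rewrite !subr0 expR0; apply=> y; rewrite subr0 => yx.
rewrite ger0_norm ?expR_ge0// ler_expR; apply: le_trans (ler_norm _) _.
exact: le_trans yx (le_trans xtz tz).
Qed.

Lemma integrable_gauss_cubic (f : R -> R) (A B : R) : 0 <= A -> 0 <= B ->
  continuous f -> (forall z, `|f z| <= A + B * `|z| ^+ 3) ->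
  gauss.-integrable setT (EFin \o f).
Proof.
move=> A0 B0 cf fAB; apply: (@integrable_gauss f (A + B * 6)) => // z.
apply: le_trans (fAB z) _; rewrite mulrDl lerD//.
  by rewrite ler_peMr// one_le_e2.
by rewrite -mulrA ler_wpM2l// cube_le_e2.
Qed.

Lemma norm_le_cube (z : R) : `|z| <= 1 + `|z| ^+ 3.
Proof.
have [z1|z1] := leP `|z| 1; first by rewrite (le_trans z1)// lerDl exprn_ge0.
rewrite (@le_trans _ _ (`|z| ^+ 3))// ?lerDr//.
by rewrite -[leLHS]expr1 ler_weXn2l// ltW.
Qed.

Lemma sqr_le_cube (z : R) : z ^+ 2 <= 1 + `|z| ^+ 3.
Proof.
rewrite -real_normK ?num_real//.
have [z1|z1] := leP `|z| 1.
  by rewrite (@le_trans _ _ 1)// ?lerDl ?exprn_ge0// exprn_ile1.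
rewrite (@le_trans _ _ (`|z| ^+ 3))// ?lerDr//.
by rewrite ler_weXn2l// ltW.
Qed.

Lemma eq0_of_le_linear (a K : R) :
  (forall t, 0 < t -> t <= 1 -> `|a| <= K * t) -> a = 0.
Proof.
move=> h; apply/eqP; rewrite -normr_le0; apply/ler_addgt0Pr => e e0; rewrite add0r.
have K0 : 0 <= K by have := h 1 ltr01 (lexx _); rewrite mulr1; exact: le_trans.
pose t := Num.min 1 (e / (K + 1)).
have t0 : 0 < t by rewrite lt_min ltr01 divr_gt0// ltr_pwDr.
apply: le_trans (h t t0 _) _; first by rewrite ge_min lexx.
apply: (@le_trans _ _ (K * (e / (K + 1)))).
  by rewrite ler_wpM2l// ge_min lexx orbT.
by rewrite mulrA ler_pdivrMr ?ltr_pwDr// mulrDr mulr1 mulrC lerDl ltW.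
Qed.

Let integrable_id : gauss.-integrable setT (EFin \o id).
Proof.
apply: (@integrable_gauss_cubic _ 1 1) => //; first by move=> z; exact: cvg_id.
by move=> z; rewrite mul1r; exact: norm_le_cube.
Qed.

Let integrable_sqr : gauss.-integrable setT (EFin \o (fun z : R => z ^+ 2)).
Proof.
apply: (@integrable_gauss_cubic _ 1 1) => // [|z]; first exact: exprn_continuous.
by rewrite mul1r ger0_norm ?sqr_ge0// sqr_le_cube.
Qed.

Lemma Rintegral_gauss_cst (r : R) : \int[gauss]_z r = r.
Proof. by rewrite Rintegral_cst//= [normal_prob _ _ _]integral_normal_pdf/= mulr1. Qed.

(** The integrated expansion of [expR (t * z)] is compared with that of its integral
    [expR (t ^+ 2 / 2)]. *)
Let gauss_moments (t : R) : `|t| <= 1 ->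
  `|t * (\int[gauss]_z z) + t ^+ 2 / 2 * (\int[gauss]_z z ^+ 2 - 1)|
    <= (1 + 6 * \int[gauss]_z e2 z) * `|t| ^+ 3.
Proof.
move=> t1.
have iexp : gauss.-integrable setT (EFin \o (fun z : R => expR (t * z))).
  apply: (@integrable_gauss _ 1).
    move=> z; apply: continuous_comp; last exact: continuous_expR.
    by apply: cvgMr; exact: cvg_id.
  move=> z; rewrite mul1r; apply: le_trans (expR_normr_le z).
  rewrite ger0_norm ?expR_ge0// ler_expR (le_trans (ler_norm _))// normrM.
  by rewrite (@le_trans _ _ `|z|)// ?ler_piMl// ler_peMl// ler1n.
have ilin : gauss.-integrable setT (EFin \o (fun z : R => t * z)).
  by under [X in _.-integrable _ X]eq_fun do rewrite /= EFinM; exact: integrableZl.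
have isq : gauss.-integrable setT (EFin \o (fun z : R => t ^+ 2 / 2 * z ^+ 2)).
  by under [X in _.-integrable _ X]eq_fun do rewrite /= EFinM; exact: integrableZl.
have icst : gauss.-integrable setT (EFin \o (fun z : R => 1)).
  apply: (@integrable_gauss_cubic _ 1 0) => //; first exact: cst_continuous.
  by move=> z; rewrite mul0r addr0 normr1.
have i1 : gauss.-integrable setT (EFin \o (fun z : R => expR (t * z) - 1)).
  by under [X in _.-integrable _ X]eq_fun do rewrite /= EFinB; exact: integrableB.
have i2 : gauss.-integrable setT (EFin \o (fun z : R => expR (t * z) - 1 - t * z)).
  by under [X in _.-integrable _ X]eq_fun do rewrite /= EFinB; exact: integrableB.
have i3 : gauss.-integrable setT (EFin \o (fun z : R => expR (t * z) - 1 - t * z - t ^+ 2 / 2 * z ^+ 2)).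
  by under [X in _.-integrable _ X]eq_fun do rewrite /= EFinB; exact: integrableB.
have i4 : gauss.-integrable setT (EFin \o (fun z : R => `|t| ^+ 3 * 6 * e2 z)).
  by under [X in _.-integrable _ X]eq_fun do rewrite /= EFinM; exact: integrableZl.
have h : `|\int[gauss]_z (expR (t * z) - 1 - t * z - t ^+ 2 / 2 * z ^+ 2)|
    <= \int[gauss]_z (`|t| ^+ 3 * 6 * e2 z).
  apply: le_trans (le_normr_Rintegral measurableT i3) _.
  apply: le_Rintegral => //; first exact: (integrable_norm i3).
  by move=> z _; rewrite -(mulrA (`|t| ^+ 3)); exact: expR_taylor.
rewrite !RintegralB// !RintegralZl// Rintegral_gauss_cst in h.
rewrite {1}/Rintegral integral_gauss_expR/= in h.
pose E := expR (t ^+ 2 / 2).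
have hE : `|E - 1 - t ^+ 2 / 2| <= `|t| ^+ 3.
  have t2 : t ^+ 2 <= 1 by rewrite -real_normK ?num_real// exprn_ile1.
  have E1 : 0 <= E - 1 - t ^+ 2 / 2.
    by rewrite -addrA -opprD subr_ge0 expR_ge1Dx.
  rewrite ger0_norm//; apply: (@le_trans _ _ (t ^+ 2 ^+ 2)); last first.
    rewrite -(real_normK (num_real t)) -exprM.
    by rewrite (_ : 2 * 2 = 3.+1)%N// exprS ler_piMl// exprn_ge0.
  (* A lower bound on [1 / E]: multiplied by [E], it bounds [E] from above, whereas convexity at
     [t ^+ 2 / 2] itself gives a lower bound. *)
  have := expR_ge1Dx (- (t ^+ 2 / 2)); rewrite expRN -/E => E2.
  have E0 : 0 < E by exact: expR_gt0.
  have := ler_wpM2r (ltW E0) E2; rewrite mulVf ?gt_eqF//.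
  have := sqr_ge0 t; nra.
have -> : t * \int[gauss]_z z + t ^+ 2 / 2 * (\int[gauss]_z z ^+ 2 - 1) =
  (E - 1 - t ^+ 2 / 2) -
   (E - 1 - t * \int[gauss]_z z - t ^+ 2 / 2 * \int[gauss]_z z ^+ 2) by ring.
apply: le_trans (ler_normB _ _) _.
by rewrite mulrDl mul1r lerD// (mulrC _ (`|t| ^+ 3)) mulrA.
Qed.

(** Odd and even parts in [t]: the bounds at [t] and [- t] are subtracted to isolate the mean and
    added to isolate the variance. *)
Lemma gauss_mean0_var1 : \int[gauss]_z z = 0 /\ \int[gauss]_z z ^+ 2 = 1.
Proof.
set m1 := \int[gauss]_z z; set m2 := \int[gauss]_z z ^+ 2.
set K := 1 + 6 * \int[gauss]_z e2 z.
have K0 : 0 <= K.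
  rewrite addr_ge0// mulr_ge0// Rintegral_ge0// => z _.
  by rewrite (le_trans _ (one_le_e2 z)).
have hp t : 0 < t -> t <= 1 -> `|t * m1 + t ^+ 2 / 2 * (m2 - 1)| <= K * t ^+ 3 /\
    `|- t * m1 + t ^+ 2 / 2 * (m2 - 1)| <= K * t ^+ 3.
  move=> t0 t1; have := @gauss_moments t; have := @gauss_moments (- t).
  by rewrite normrN sqrrN (gtr0_norm t0) => /(_ t1) ? /(_ t1).
split.
  apply: (@eq0_of_le_linear _ K) => t t0 t1; have [h1 h2] := hp t t0 t1.
  rewrite -(ler_pM2l t0) -{1}(gtr0_norm t0) -normrM.
  have : `|t * m1| <= K * t ^+ 3 by move: h1 h2; rewrite !ler_norml; lra.
  move=> /le_trans; apply; have := mulr_ge0 K0 (sqr_ge0 t).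
  rewrite exprSr; nra.
apply/eqP; rewrite -subr_eq0; apply/eqP.
apply: (@eq0_of_le_linear _ (2 * K)) => t t0 t1; have [h1 h2] := hp t t0 t1.
have t20 : 0 < t ^+ 2 by rewrite exprn_gt0.
rewrite -(ler_pM2l t20) -{1}(gtr0_norm t20) -normrM.
have : `|t ^+ 2 * (m2 - 1)| <= 2 * (K * t ^+ 3).
  by move: h1 h2; rewrite !ler_norml; lra.
by move=> /le_trans; apply; rewrite mulrA (exprSr t 2) mulrCA.
Qed.

(** [E f(x + a N)] with [N] standard normal: [a] is a deviation, not a variance, and may be 0. It
    stands for adding an independent Gaussian variable without enlarging the probability space. *)
Definition gauss_avg (a : R) (f : R -> R) (x : R) : R := \int[gauss]_z f (x + a * z).

Lemma continuous_affine (f : R -> R) (x a : R) : continuous f ->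
  continuous (fun z => f (x + a * z)).
Proof.
move=> cf z; apply: continuous_comp; last exact: cf.
by apply: cvgD; [exact: cvg_cst|apply: cvgMr; exact: cvg_id].
Qed.

Lemma integrable_gauss_bounded (f : R -> R) (M : R) : continuous f ->
  (forall x, `|f x| <= M) -> gauss.-integrable setT (EFin \o f).
Proof.
move=> cf fM; apply: (@integrable_gauss_cubic f M 0) => //.
  exact: le_trans (fM 0).
by move=> z; rewrite mul0r addr0.
Qed.

Lemma integrable_gauss_avg (f : R -> R) (M x a : R) : continuous f ->
  (forall x, `|f x| <= M) -> gauss.-integrable setT (EFin \o (fun z => f (x + a * z))).
Proof.
by move=> cf fM; apply: (@integrable_gauss_bounded _ M) => //; exact: continuous_affine.
Qed.

Lemma gauss_avg_bound (f : R -> R) (M x a : R) : continuous f ->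
  (forall x, `|f x| <= M) -> `|gauss_avg a f x| <= M.
Proof.
move=> cf fM; have i := integrable_gauss_avg x a cf fM.
apply: le_trans (le_normr_Rintegral measurableT i) _.
rewrite -[leRHS]Rintegral_gauss_cst; apply: le_Rintegral => //.
  exact: (integrable_norm i).
apply: (@integrable_gauss_bounded _ M); first exact: cst_continuous.
by move=> _; rewrite ger0_norm// (le_trans _ (fM 0)).
Qed.

Lemma gauss_avg0 (f : R -> R) (x : R) : gauss_avg 0 f x = f x.
Proof.
rewrite /gauss_avg; under eq_Rintegral do rewrite mul0r addr0.
exact: Rintegral_gauss_cst.
Qed.

Lemma gauss_avg_lipschitz (f : R -> R) (M C a x y : R) : continuous f ->
  (forall x, `|f x| <= M) -> (forall x y, `|f x - f y| <= C * `|x - y|) ->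
  `|gauss_avg a f x - gauss_avg a f y| <= C * `|x - y|.
Proof.
move=> cf fM fC.
have ix := integrable_gauss_avg x a cf fM; have iy := integrable_gauss_avg y a cf fM.
have ixy : gauss.-integrable setT (EFin \o (fun z => f (x + a * z) - f (y + a * z))).
  by under [X in _.-integrable _ X]eq_fun do rewrite /= EFinB; exact: integrableB.
rewrite -RintegralB//; apply: le_trans (le_normr_Rintegral measurableT ixy) _.
rewrite -[leRHS]Rintegral_gauss_cst; apply: le_Rintegral => //.
- exact: (integrable_norm ixy).
- apply: (@integrable_gauss_bounded _ (C * `|x - y|)); first exact: cst_continuous.
  by move=> _; rewrite ger0_norm// (le_trans _ (fC x y)).
- move=> z _; apply: le_trans (fC _ _) _.
  by rewrite (_ : x + a * z - (y + a * z) = x - y)//; ring.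
Qed.

Lemma continuous_lipschitz (f : R -> R) (C : R) :
  (forall x y, `|f x - f y| <= C * `|x - y|) -> continuous f.
Proof.
move=> fC x; apply/cvgrPdist_le => e e0.
have C0 : 0 <= C by have := fC 0 1; rewrite sub0r normrN1 mulr1; exact: le_trans.
near=> y.
apply: le_trans (fC _ _) _.
apply: (@le_trans _ _ ((C + 1) * `|x - y|)); first by rewrite ler_wpM2r// lerDl.
rewrite -ler_pdivlMl ?ltr_pwDr//; near: y.
apply: cvgr_dist_le; first exact: cvg_id.
by rewrite mulr_gt0// invr_gt0 ltr_pwDr.
Unshelve. all: by end_near. Qed.

(** Continuity in the deviation, by coupling the two normal laws through the same [z]. *)
Lemma gauss_avg_dist (f : R -> R) (M C a b x : R) : continuous f ->
  (forall x, `|f x| <= M) -> (forall x y, `|f x - f y| <= C * `|x - y|) ->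
  `|gauss_avg a f x - gauss_avg b f x| <= C * (\int[gauss]_z `|z|) * `|a - b|.
Proof.
move=> cf fM fC.
have ix := integrable_gauss_avg x a cf fM; have iy := integrable_gauss_avg x b cf fM.
have ixy : gauss.-integrable setT (EFin \o (fun z => f (x + a * z) - f (x + b * z))).
  by under [X in _.-integrable _ X]eq_fun do rewrite /= EFinB; exact: integrableB.
rewrite -RintegralB//; apply: le_trans (le_normr_Rintegral measurableT ixy) _.
have iC : gauss.-integrable setT (EFin \o (fun z => C * `|a - b| * `|z|)).
  by under [X in _.-integrable _ X]eq_fun do rewrite /= EFinM;
     apply: integrableZl => //; exact: (integrable_norm integrable_id).
rewrite mulrAC -RintegralZl//; last exact: (integrable_norm integrable_id).
apply: le_Rintegral => //; first exact: (integrable_norm ixy).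
move=> z _; apply: le_trans (fC _ _) _.
by rewrite (_ : x + a * z - (x + b * z) = (a - b) * z) ?normrM ?mulrA//; ring.
Qed.

Lemma EFin_gauss_avg (f : R -> R) (M x a : R) : continuous f ->
  (forall x, `|f x| <= M) ->
  (\int[gauss]_z (f (x + a * z))%:E = (gauss_avg a f x)%:E)%E.
Proof.
move=> cf fM; rewrite /gauss_avg /Rintegral fineK//.
exact: integrable_fin_num (integrable_gauss_avg x a cf fM).
Qed.

Lemma gauss_avgD_cst (f : R -> R) (M x a r : R) : continuous f ->
  (forall x, `|f x| <= M) -> gauss_avg a (fun y => f y + r) x = gauss_avg a f x + r.
Proof.
move=> cf fM; rewrite /gauss_avg RintegralD ?Rintegral_gauss_cst//.
  exact: integrable_gauss_avg fM.
by apply: (@integrable_gauss_bounded _ `|r|) => //; exact: cst_continuous.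
Qed.

(** Normal laws convolve. The cases [a = 0] and [b = 0] are split off since they have no density;
    adding the bound [M] makes [f] nonnegative, as Tonelli requires. *)
Lemma gauss_avg_conv (f : R -> R) (M C x a b : R) : continuous f ->
  (forall x, `|f x| <= M) -> (forall x y, `|f x - f y| <= C * `|x - y|) ->
  0 <= a -> 0 <= b ->
  gauss_avg b (gauss_avg a f) x = gauss_avg (Num.sqrt (a ^+ 2 + b ^+ 2)) f x.
Proof.
move=> cf fM fC; rewrite !le_eqVlt => /predU1P[<-|a0].
  move=> b0; rewrite expr0n add0r sqrtr_sqr ger0_norm; last by rewrite le_eqVlt.
  by apply: eq_Rintegral => z _; rewrite gauss_avg0.
move=> /predU1P[<-|b0].
  by rewrite gauss_avg0 expr0n addr0 sqrtr_sqr gtr0_norm.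
set c := Num.sqrt _.
have M0 : 0 <= M by rewrite (le_trans _ (fM 0)).
pose h y := f y + M.
have ch : continuous h by move=> y; apply: cvgD; [exact: cf|exact: cvg_cst].
have h0 y : 0 <= h y by have := fM y; rewrite ler_norml => /andP[+ _]; rewrite /h; lra.
have hM y : `|h y| <= M + M by rewrite (le_trans (ler_normD _ _))// lerD// ger0_norm.
have cg : continuous (gauss_avg a f).
  by apply: (@continuous_lipschitz _ C) => y z; exact: gauss_avg_lipschitz fC.
have := ge0_gauss_convolution x a0 b0 ch h0.
rewrite (EFin_gauss_avg _ _ ch hM).
under eq_integral do rewrite (EFin_gauss_avg _ _ ch hM) (gauss_avgD_cst _ _ _ cf fM).
rewrite (gauss_avgD_cst _ _ _ cf fM).
have gM y : `|gauss_avg a f y| <= M by exact: gauss_avg_bound.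
pose g y := gauss_avg a f y + M.
have cg' : continuous g by move=> y; apply: cvgD; [exact: cg|exact: cvg_cst].
have g'M y : `|g y| <= M + M by rewrite (le_trans (ler_normD _ _))// lerD// ger0_norm.
rewrite (@EFin_gauss_avg g _ x b cg' g'M) (gauss_avgD_cst _ _ _ cg gM).
by move=> [] /addIr.
Qed.

(** The test functions of Lindeberg's method. [f1] and [f2] stand for the derivatives, but only the
    Taylor estimate links them to [f]: the class is then stable under [gauss_avg] by mere
    integration, with the same [M] and no derivative under the integral. *)
Definition smooth_test (f f1 f2 : R -> R) (M : R) : Prop :=
  [/\ forall x, [/\ `|f x| <= M, `|f1 x| <= M & `|f2 x| <= M],
      forall x y, [/\ `|f x - f y| <= M * `|x - y|,
        `|f1 x - f1 y| <= M * `|x - y| & `|f2 x - f2 y| <= M * `|x - y|] &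
      forall x y, `|f (x + y) - f x - y * f1 x - y ^+ 2 / 2 * f2 x| <= M * `|y| ^+ 3].

Lemma smooth_test_gauss_avg (f f1 f2 : R -> R) (M a : R) :
  smooth_test f f1 f2 M ->
  smooth_test (gauss_avg a f) (gauss_avg a f1) (gauss_avg a f2) M.
Proof.
move=> [fM fL fT].
have fM0 x : `|f x| <= M by case: (fM x).
have fM1 x : `|f1 x| <= M by case: (fM x).
have fM2 x : `|f2 x| <= M by case: (fM x).
have fL0 x y : `|f x - f y| <= M * `|x - y| by case: (fL x y).
have fL1 x y : `|f1 x - f1 y| <= M * `|x - y| by case: (fL x y).
have fL2 x y : `|f2 x - f2 y| <= M * `|x - y| by case: (fL x y).
have [cf cf1 cf2] := And3 (continuous_lipschitz fL0) (continuous_lipschitz fL1)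
  (continuous_lipschitz fL2).
split=> [x|x y|x y].
- by split; exact: gauss_avg_bound.
- by split; exact: gauss_avg_lipschitz.
have ig (g : R -> R) w : continuous g -> (forall x, `|g x| <= M) ->
    gauss.-integrable setT (EFin \o (fun z => g (w + a * z))).
  by move=> cg gM; exact: integrable_gauss_avg gM.
have igZ r (g : R -> R) w : continuous g -> (forall x, `|g x| <= M) ->
    gauss.-integrable setT (EFin \o (fun z => r * g (w + a * z))).
  move=> cg gM; under [X in _.-integrable _ X]eq_fun do rewrite /= EFinM.
  by apply: integrableZl => //; exact: ig.
have igB g h : gauss.-integrable setT (EFin \o g) -> gauss.-integrable setT (EFin \o h) ->
    gauss.-integrable setT (EFin \o (fun z => g z - h z)).
  by move=> ? ?; under [X in _.-integrable _ X]eq_fun do rewrite /= EFinB; exact: integrableB.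
have i1 := ig f (x + y) cf fM0.
have i2 := igB _ _ i1 (ig f x cf fM0).
have i3 := igB _ _ i2 (igZ y f1 x cf1 fM1).
have iT := igB _ _ i3 (igZ (y ^+ 2 / 2) f2 x cf2 fM2).
have -> : gauss_avg a f (x + y) - gauss_avg a f x - y * gauss_avg a f1 x -
    y ^+ 2 / 2 * gauss_avg a f2 x =
  \int[gauss]_z (f (x + y + a * z) - f (x + a * z) - y * f1 (x + a * z) -
    y ^+ 2 / 2 * f2 (x + a * z)).
  rewrite RintegralB//; last exact: igZ.
  rewrite RintegralB//; last exact: igZ.
  by rewrite RintegralB ?RintegralZl//; exact: ig.
apply: le_trans (le_normr_Rintegral measurableT iT) _.
rewrite -[leRHS]Rintegral_gauss_cst; apply: le_Rintegral => //.
- exact: (integrable_norm iT).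
- apply: (@integrable_gauss_bounded _ (M * `|y| ^+ 3)); first exact: cst_continuous.
  by move=> _; rewrite ger0_norm// (le_trans _ (fT 0 y)).
- by move=> z _; rewrite (addrAC x); exact: fT.
Qed.

(** The linear term vanishes because the mean is 0, and variance 1 gives [t ^+ 2 / 2]. Any centred
    variable of variance [t ^+ 2] has the same expansion, whence the replacement argument. *)
Lemma gauss_avg_increment (f f1 f2 : R -> R) (M t x : R) :
  smooth_test f f1 f2 M ->
  `|gauss_avg t f x - f x - t ^+ 2 / 2 * f2 x|
    <= M * (\int[gauss]_z `|z| ^+ 3) * `|t| ^+ 3.
Proof.
move=> [fM fL fT].
have fM0 y : `|f y| <= M by case: (fM y).
have cf : continuous f by apply: (@continuous_lipschitz _ M) => y z; case: (fL y z).
have M0 : 0 <= M by rewrite (le_trans _ (fM0 0)).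
have igB g h : gauss.-integrable setT (EFin \o g) -> gauss.-integrable setT (EFin \o h) ->
    gauss.-integrable setT (EFin \o (fun z => g z - h z)).
  by move=> ? ?; under [X in _.-integrable _ X]eq_fun do rewrite /= EFinB; exact: integrableB.
have igZ r g : gauss.-integrable setT (EFin \o g) ->
    gauss.-integrable setT (EFin \o (fun z => r * g z)).
  by move=> ?; under [X in _.-integrable _ X]eq_fun do rewrite /= EFinM; exact: integrableZl.
have i1 := integrable_gauss_avg x t cf fM0.
have i2 (r : R) : gauss.-integrable setT (EFin \o (fun=> r)).
  by apply: (@integrable_gauss_bounded _ `|r|) => //; exact: cst_continuous.
have i3 := igZ (t * f1 x) _ integrable_id.
have i4 := igZ (t ^+ 2 / 2 * f2 x) _ integrable_sqr.
have i5 : gauss.-integrable setT (EFin \o (fun z => `|z| ^+ 3)).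
  apply: (@integrable_gauss_cubic _ 0 1) => // [|z].
    move=> z; apply: (@continuous_comp _ _ _ (fun z : R => `|z|) (fun y => y ^+ 3)).
      exact: norm_continuous.
    exact: exprn_continuous.
  by rewrite add0r mul1r ger0_norm// exprn_ge0.
have iT := igB _ _ (igB _ _ (igB _ _ i1 (i2 (f x))) i3) i4.
have : `|\int[gauss]_z (f (x + t * z) - f x - t * f1 x * z - t ^+ 2 / 2 * f2 x * z ^+ 2)|
   <= \int[gauss]_z (M * `|t| ^+ 3 * `|z| ^+ 3).
  apply: le_trans (le_normr_Rintegral measurableT iT) _.
  apply: le_Rintegral => //; first exact: (integrable_norm iT).
    exact: igZ.
  move=> z _; have := fT x (t * z).
  rewrite normrM !exprMn -(mulrA M) (mulrAC t z).
  by rewrite (_ : t ^+ 2 * z ^+ 2 / 2 * f2 x = t ^+ 2 / 2 * f2 x * z ^+ 2)//; ring.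
have [m1 m2] := gauss_mean0_var1.
rewrite !RintegralB ?RintegralZl ?Rintegral_gauss_cst ?m1 ?m2 ?mulr0 ?subr0 ?mulr1//.
- by rewrite -(mulrA M) [_ * Rintegral _ _ _]mulrC mulrA.
- exact: igB.
- exact: igB _ _ (igB _ _ i1 (i2 (f x))) i3.
Qed.

(** At [s2 = 0] the Dirac mass agrees with averaging at deviation 0. For [s2 > 0] the change of
    variables wants a nonnegative function, hence [f + M] again. *)
Lemma integral_normal_law (f : R -> R) (M s2 : R) : 0 <= s2 ->
  continuous f -> (forall x, `|f x| <= M) ->
  (\int[normal_law 0 s2]_x (f x)%:E = (gauss_avg (Num.sqrt s2) f 0)%:E)%E.
Proof.
move=> s20 cf fM; rewrite /normal_law; case: eqVneq => [->|s2_neq0].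
  rewrite sqrtr0 gauss_avg0 integral_dirac//= ?diracT ?mul1e//.
  by apply/measurable_EFinP; exact: continuous_measurable_fun.
have a0 : 0 < Num.sqrt s2 by rewrite sqrtr_gt0 lt_neqAle eq_sym s2_neq0.
have M0 : 0 <= M by rewrite (le_trans _ (fM 0)).
pose h y := f y + M.
have ch : continuous h by move=> y; apply: cvgD; [exact: cf|exact: cvg_cst].
have h0 y : 0 <= h y by have := fM y; rewrite ler_norml => /andP[+ _]; rewrite /h; lra.
have hM y : `|h y| <= M + M by rewrite (le_trans (ler_normD _ _))// lerD// ger0_norm.
have := etrans (integral_normal_affine 0 a0 ch h0) (EFin_gauss_avg 0 (Num.sqrt s2) ch hM).
rewrite (gauss_avgD_cst 0 (Num.sqrt s2) M cf fM) EFinD.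
have if_ : (normal_prob 0 (Num.sqrt s2)).-integrable setT (EFin \o f).
  apply: measurable_bounded_integrable => //.
  - by rewrite /= [normal_prob _ _ _]integral_normal_pdf ltry.
  - exact: continuous_measurable_fun.
  - exists M; split=> [|x Mx y _]; first exact: num_real.
    exact: le_trans (fM y) (ltW Mx).
under eq_integral do rewrite EFinD.
rewrite integralD//=.
  rewrite integral_cst//= [normal_prob _ _ _]integral_normal_pdf mule1.
  by move=> /(congr1 (fun x => x - M%:E)%E); rewrite !addeK.
by apply: finite_measure_integrable_cst.
Qed.

End gaussian_expectation.

(** * Smooth approximation *)

Section smoothing.
Context {R : realType}.
Local Notation mu := (@lebesgue_measure R).
Implicit Types f g : R -> R.

Let integrable_itvcc f (a b : R) : continuous f -> mu.-integrable `[a, b] (EFin \o f).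
Proof.
move=> cf; apply: continuous_compact_integrable; first exact: segment_compact.
exact: continuous_subspaceT.
Qed.

(** [G a t] integrates over a segment, so [a] has to lie to the left of [t], and the base point
    moves with [t]. This does no harm: [G a t - G a 0] is the same for every [a] to the left of [t]
    and [0], so near [x] a fixed [a] serves. *)
Lemma continuous_primitive f : continuous f ->
  exists F : R -> R, forall x : R, is_derive x 1 F (f x).
Proof.
move=> cf; pose G (a t : R) := \int[mu]_(x in `[a, t]) f x.
have GG (a b t : R) : b <= a -> a <= 0 -> a <= t -> G b t - G b 0 = G a t - G a 0.
  move=> ba a0 at_; pose m := Num.max t 0.
  have h (s : R) : a <= s -> s <= m -> G b s - G b a = G a s.
    move=> as_ sm; rewrite /G Rintegral_itvB ?bnd_simp//; last exact: integrable_itvcc.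
    apply: Rintegral_itv_obnd_cbnd.
    by apply: integrableS (integrable_itvcc a s cf) => //; exact: subset_itv_oc_cc.
  have := h t at_; have := h 0 a0; rewrite /m !le_max !lexx orbT.
  by move=> /(_ isT) <- /(_ isT) <-; rewrite opprB addrA subrK.
exists (fun x => G (Num.min x 0 - 1) x - G (Num.min x 0 - 1) 0) => x.
pose a := Num.min x 0 - 2.
have ax : a < x by rewrite ltrBlDr gt_min ltrDl ltr0n.
have [dG G'] : derivable (G a) x 1 /\ ((G a)^`())%classic x = f x.
  apply: (@continuous_FTC1_closed _ f a x (x + 1)) => //; first by rewrite ltrDl.
    exact: integrable_itvcc.
  exact: cf.
apply: (@near_eq_is_derive _ _ _ (fun t => G a t - G a 0)); last first.
  have dG' : is_derive x 1 (G a) (f x) by apply: DeriveDef; [exact: dG|rewrite -derive1E; exact: G'].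
  by apply: is_derive_eq; rewrite subr0.
near=> t; apply/esym.
have t1 : `|x - t| < 1.
  by near: t; apply: cvgr_dist_lt; [exact: cvg_id|exact: ltr01].
move: t1; rewrite ltr_norml => /andP[t1 t2].
apply/esym/GG.
- by rewrite /a /Num.min; case: ifP; case: ifP; lra.
- by rewrite subr_le0 ge_min ler01 orbT.
- by rewrite lerBlDr ge_min lerDl ler01.
Unshelve. all: by end_near. Qed.

Let is_derive_addr f (h x f' : R) :
  is_derive (x + h) 1 f f' -> is_derive x 1 (fun y => f (y + h)) f'.
Proof.
move=> df; have dh : is_derive x 1 (fun y : R => y + h) 1.
  by apply: is_derive_eq; rewrite addr0.
by have := @is_derive1_comp _ f (fun y => y + h) x f' 1 df dh; rewrite mulr1.
Qed.

(** Averaging over [[x, x + h]] gains one derivative, and each value of [g] is a value of [f] at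
    distance at most [h], so sup bounds carry over and [g] stays uniformly close to [f]. *)
Lemma running_average f (h : R) : 0 < h -> continuous f ->
  exists g, (forall x : R, is_derive x 1 g (h^-1 * (f (x + h) - f x))) /\
    (forall x, exists xi, [/\ x <= xi, xi <= x + h & g x = f xi]).
Proof.
move=> h0 /continuous_primitive[F dF].
exists (fun x => h^-1 * (F (x + h) - F x)); split=> x.
  have dFh : is_derive x 1 (fun y => F (y + h)) (f (x + h)).
    exact: is_derive_addr.
  by apply: is_derive_eq; rewrite /GRing.scale/=; ring.
have cF : {within `[x, x + h], continuous F}.
  apply: continuous_subspaceT => z.
  exact/differentiable_continuous/derivable1_diffP/ex_derive.
have xh : x <= x + h by rewrite lerDl ltW.
have [xi /[!in_itv]/= /andP[x1 x2] ->] := MVT_segment xh (fun y _ => dF y) cF.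
exists xi; split=> //; field; by rewrite gt_eqF.
Qed.

(** Three running averages: [c] gets a second derivative [c2] that is Lipschitz, which is all the
    cubic Taylor bound needs. *)
Lemma smooth_test_approx f (M e : R) : (forall x, `|f x| <= M) ->
  (forall e : R, 0 < e -> exists2 d : R, 0 < d &
    forall x y, `|x - y| <= d -> `|f x - f y| <= e) ->
  0 < e -> exists g g1 g2 K, smooth_test g g1 g2 K /\ forall x, `|g x - f x| <= e.
Proof.
move=> fM fu e0; have [d d0 fd] := fu _ e0.
have cf : continuous f.
  move=> x; apply/cvgrPdist_le => e' /fu[d' d'0 fd']; near=> y.
  by apply: fd'; near: y; apply: cvgr_dist_le => //; exact: cvg_id.
(* Each of the three averages displaces the argument by at most [h], so [c x] is a value of [f]
   within [d] of [x]. *)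
pose h := d / 3; have h0 : 0 < h by rewrite divr_gt0.
have cd g g1 : (forall x : R, is_derive x 1 g (g1 x)) -> continuous g.
  by move=> dg x; exact/differentiable_continuous/derivable1_diffP/ex_derive.
have lip g g1 (B : R) : (forall x : R, is_derive x 1 g (g1 x)) -> (forall x, `|g1 x| <= B) ->
    forall x y, `|g x - g y| <= B * `|x - y|.
  by move=> dg g1B x y; apply: (mean_value_bound dg) => z _.
have [a [da aE]] := running_average h0 cf.
have [b [db bE]] := running_average h0 (cd _ _ da).
have [c [dc cE]] := running_average h0 (cd _ _ db).
pose b1 x := h^-1 * (a (x + h) - a x).
pose c1 x := h^-1 * (b (x + h) - b x).
pose c2 x := h^-1 * (b1 (x + h) - b1 x).
have M0 : 0 <= M by rewrite (le_trans _ (fM 0)).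
have H0 : 0 <= h^-1 by rewrite invr_ge0 ltW.
have qb g (B : R) : (forall x, `|g x| <= B) -> forall x, `|h^-1 * (g (x + h) - g x)| <= 2 * h^-1 * B.
  move=> gB x; rewrite normrM ger0_norm// mulrAC mulrC ler_wpM2r//.
  by rewrite mulr_natl mulr2n (le_trans (ler_normB _ _))// lerD.
have aM x : `|a x| <= M by have [xi [_ _ ->]] := aE x.
have bM x : `|b x| <= M by have [xi [_ _ ->]] := bE x.
have cM x : `|c x| <= M by have [xi [_ _ ->]] := cE x.
have b1M := qb _ _ aM. have c1M := qb _ _ bM. have c2M := qb _ _ b1M.
have aL := lip _ _ _ da (qb _ _ fM).
have qL g (B : R) : (forall x y, `|g x - g y| <= B * `|x - y|) ->
    forall x y, `|h^-1 * (g (x + h) - g x) - h^-1 * (g (y + h) - g y)| <=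
      2 * h^-1 * B * `|x - y|.
  move=> gB x y; rewrite -mulrBr normrM ger0_norm// -!mulrA mulrCA ler_wpM2l//.
  rewrite (_ : _ - _ = (g (x + h) - g (y + h)) - (g x - g y)); last by ring.
  rewrite (le_trans (ler_normB _ _))// mulr_natl mulr2n lerD//.
  by apply: le_trans (gB _ _) _; rewrite (_ : x + h - (y + h) = x - y)//; ring.
have b1L := qL _ _ aL. have c2L := qL _ _ b1L.
have dc1 (x : R) : is_derive x 1 c1 (c2 x).
  have dbh : is_derive x 1 (fun y => b (y + h)) (b1 (x + h)).
    exact: is_derive_addr.
  by apply: is_derive_eq; rewrite /GRing.scale/= /c2 /b1; ring.
have cL := lip _ _ _ dc c1M. have c1L := lip _ _ _ dc1 c2M.
(* Every difference quotient with step [h] multiplies a sup bound or a Lipschitz constant by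
   [2 / h]. *)
pose K0 := M; pose K1 := 2 * h^-1 * K0; pose K2 := 2 * h^-1 * K1; pose K3 := 2 * h^-1 * K2.
have K10 : 0 <= K1 by rewrite !mulr_ge0.
have K20 : 0 <= K2 by rewrite mulr_ge0// mulr_ge0.
have K30 : 0 <= K3 by rewrite mulr_ge0// mulr_ge0.
pose K := M + K1 + K2 + K3.
have [KM KK1 KK2 KK3] : [/\ M <= K, K1 <= K, K2 <= K & K3 <= K].
  by rewrite /K; move: K10 K20 K30; move: (K1) (K2) (K3) => x1 x2 x3 *; split; lra.
exists c, c1, c2, K; split; last first.
  move=> x; have [x1 [x10 x1h ->]] := cE x; have [x2 [x20 x2h ->]] := bE x1.
  have [x3 [x30 x3h ->]] := aE x2; apply: fd.
  have hd : d = 3 * h by rewrite /h; field.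
  move: x10 x1h x20 x2h x30 x3h hd; clear; move: (h) => h0 *.
  by rewrite ger0_norm; lra.
split=> [x|x y|x y].
- split; [exact: le_trans (cM x) KM|exact: le_trans (c1M x) KK1|].
  exact: le_trans (c2M x) KK2.
- split; [apply: le_trans (cL x y) _|apply: le_trans (c1L x y) _|apply: le_trans (c2L x y) _];
    exact: ler_wpM2r.
have sh (u u1 : R -> R) (z : R) : (forall x : R, is_derive x 1 u (u1 x)) ->
    is_derive z 1 (fun z => u (z + x)) (u1 (z + x)) by move=> du; exact: (@is_derive_addr u x z _ (du _)).
have := @taylor2_lipschitz _ (fun z => c (z + x)) (fun z => c1 (z + x))
  (fun z => c2 (z + x)) y K (fun z => sh _ _ z dc) (fun z => sh _ _ z dc1).
rewrite !add0r (addrC y); apply=> z _.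
apply: le_trans (c2L _ _) _; rewrite addrK; exact: ler_wpM2r.
Unshelve. all: by end_near. Qed.

End smoothing.

(** * Lindeberg's method on a finite probability space *)

Section finite_expectation.
Context {R : realType} {Om : finType} (p : Om -> R).
Hypotheses (p_ge0 : forall x, 0 <= p x) (p_sum1 : \sum_x p x = 1).
Implicit Types h g : Om -> R.

Definition fexp h : R := \sum_x p x * h x.

Lemma eq_fexp h g : h =1 g -> fexp h = fexp g.
Proof. by move=> hg; apply: eq_bigr => x _; rewrite hg. Qed.

Lemma fexpD h g : fexp (fun x => h x + g x) = fexp h + fexp g.
Proof. by rewrite -big_split; apply: eq_bigr => x _; rewrite mulrDr. Qed.

Lemma fexpZ a h : fexp (fun x => a * h x) = a * fexp h.
Proof. by rewrite mulr_sumr; apply: eq_bigr => x _; rewrite mulrCA. Qed.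

Lemma fexpN h : fexp (fun x => - h x) = - fexp h.
Proof. by rewrite /fexp -sumrN; apply: eq_bigr => x _; rewrite mulrN. Qed.

Lemma fexpB h g : fexp (fun x => h x - g x) = fexp h - fexp g.
Proof. by rewrite fexpD fexpN. Qed.

Lemma fexp_cst a : fexp (fun=> a) = a.
Proof. by rewrite /fexp -mulr_suml p_sum1 mul1r. Qed.

Lemma fexp_sum (I : Type) (r : seq I) (P : pred I) (F : I -> Om -> R) :
  fexp (fun x => \sum_(i <- r | P i) F i x) = \sum_(i <- r | P i) fexp (F i).
Proof.
rewrite /fexp exchange_big; apply: eq_bigr => x _; exact: mulr_sumr.
Qed.

Lemma fexp_le h g : (forall x, h x <= g x) -> fexp h <= fexp g.
Proof. by move=> hg; apply: ler_sum => x _; rewrite ler_wpM2l. Qed.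

Lemma fexp_ge0 h : (forall x, 0 <= h x) -> 0 <= fexp h.
Proof. by move=> h0; apply: sumr_ge0 => x _; rewrite mulr_ge0. Qed.

Lemma fexp_norm h : `|fexp h| <= fexp (fun x => `|h x|).
Proof.
apply: le_trans (ler_norm_sum _ _ _) _; apply: ler_sum => x _.
by rewrite normrM ger0_norm.
Qed.

Lemma fexp_norm_le h a : (forall x, `|h x| <= a) -> `|fexp h| <= a.
Proof. by move=> ha; rewrite -[a]fexp_cst; apply: le_trans (fexp_norm _) (fexp_le ha). Qed.

Lemma fexp_cauchy_schwarz h g :
  fexp (fun x => h x * g x) ^+ 2 <= fexp (fun x => h x ^+ 2) * fexp (fun x => g x ^+ 2).
Proof.
set a := fexp (fun x => h x * g x); set b := fexp _; set c := fexp (fun x => g x ^+ 2).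
have q (t : R) : 0 <= b + 2 * t * a + t ^+ 2 * c.
  rewrite /b /a /c -!fexpZ -!fexpD; apply: fexp_ge0 => x.
  by rewrite (_ : _ + _ = (h x + t * g x) ^+ 2) ?sqr_ge0//; ring.
have c0 : 0 <= c by apply: fexp_ge0 => x; exact: sqr_ge0.
have b0 : 0 <= b by apply: fexp_ge0 => x; exact: sqr_ge0.
have [c00|cn0] := eqVneq c 0.
  rewrite c00 mulr0 (_ : a = 0) ?expr0n//; apply/eqP; apply: contraT => a0.
  have := q (- (b + 1) / (2 * a)); rewrite c00 mulr0 addr0.
  have -> : b + 2 * (- (b + 1) / (2 * a)) * a = - 1 by field.
  by rewrite ler0N1.
have cp : 0 < c by rewrite lt_neqAle eq_sym cn0.
have := q (- a / c).
have -> : b + 2 * (- a / c) * a + (- a / c) ^+ 2 * c = b - a ^+ 2 / c by field.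
by rewrite subr_ge0 ler_pdivrMr.
Qed.

Lemma fexp_sqr_le h : fexp h ^+ 2 <= fexp (fun x => h x ^+ 2).
Proof.
have := fexp_cauchy_schwarz h (fun=> 1).
rewrite expr1n fexp_cst mulr1; congr (_ ^+ 2 <= _).
by apply: eq_fexp => x; rewrite mulr1.
Qed.

(* Swapping the increments one at a time against independent Gaussian ones. *)
Lemma lindeberg (Y : nat -> Om -> R) (m : nat) (f f1 f2 : R -> R) (M e t b : R) :
  smooth_test f f1 f2 M -> 0 <= t ->
  (forall k x, (k < m)%N -> `|Y k x| <= e) ->
  (forall k, (k < m)%N -> fexp (Y k) = 0) ->
  (forall k, (k < m)%N -> fexp (fun x => Y k x ^+ 2) = t ^+ 2) ->
  (forall k (g : R -> R), (k < m)%N -> (forall x, `|g x| <= M) ->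
    `|fexp (fun x => g (\sum_(j < k) Y j x + Y k x)) -
      fexp (fun x => fexp (fun y => g (\sum_(j < k) Y j x + Y k y)))| <= M * b) ->
  `|fexp (fun x => f (\sum_(j < m) Y j x)) - gauss_avg (Num.sqrt m%:R * t) f 0|
    <= m%:R * (M * b + M * (e * t ^+ 2 + (\int[normal_prob 0 1]_z `|z| ^+ 3) * t ^+ 3)).
Proof.
move=> sf t0 Ye Y0 Y2 Yd; set kappa := Rintegral _ _ _; set dl := (X in _ <= _ * X).
(* [g k] is [f] averaged over the [m - k] Gaussian increments that replace the last variables; [gS]
   splits off one of them. *)
pose g k := gauss_avg (Num.sqrt (m - k)%:R * t) f.
pose g1 k := gauss_avg (Num.sqrt (m - k)%:R * t) f1.
pose g2 k := gauss_avg (Num.sqrt (m - k)%:R * t) f2.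
have sg k : smooth_test (g k) (g1 k) (g2 k) M by exact: smooth_test_gauss_avg.
have [fM fL fT] := sf.
have fM0 y : `|f y| <= M by case: (fM y).
have fL0 x y : `|f x - f y| <= M * `|x - y| by case: (fL x y).
have cf : continuous f by exact: continuous_lipschitz fL0.
have M0 : 0 <= M by rewrite (le_trans _ (fM0 0)).
have gS k x : (k < m)%N -> g k x = gauss_avg t (g k.+1) x.
  move=> km; rewrite /g (gauss_avg_conv _ cf fM0 fL0) ?mulr_ge0//.
  rewrite exprMn sqr_sqrtr ?ler0n// -[X in _ * _ + X]mul1r -mulrDl natr1 -subSn// subSS.
  by rewrite sqrtrM ?ler0n// sqrtr_sqr ger0_norm.
pose S k x : R := \sum_(j < k) Y j x.
have step k : (k < m)%N ->
    `|fexp (fun x => g k.+1 (S k.+1 x)) - fexp (fun x => g k (S k x))| <= dl.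
  move=> km.
  have gM y : `|g k.+1 y| <= M by have [+ _ _] := sg k.+1; move=> /(_ y)[].
  have -> : fexp (fun x => g k.+1 (S k.+1 x)) =
      fexp (fun x => g k.+1 (S k x + Y k x)).
    by apply: eq_fexp => x; rewrite /S big_ord_recr.
  (* Midway stands the expectation in which [Y k] is drawn independently of the past: decoupling
     bounds one half, Taylor's formula the other. *)
  rewrite -(subrKA (fexp (fun x => fexp (fun y => g k.+1 (S k x + Y k y))))).
  apply: le_trans (ler_normD _ _) _; apply: lerD; first exact: Yd.
  rewrite -fexpB; apply: fexp_norm_le => x.
  rewrite gS//; set s := S k x.
  (* [Y k] and the Gaussian increment share their first two moments, hence this expansion; the third
     moments leave the errors [e * t ^+ 2] and [t ^+ 3], up to constants. *)
  rewrite -(subrKA (g k.+1 s + t ^+ 2 / 2 * g2 k.+1 s)).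
  apply: le_trans (ler_normD _ _) _; rewrite mulrDr; apply: lerD.
    have -> : fexp (fun y => g k.+1 (s + Y k y)) - (g k.+1 s + t ^+ 2 / 2 * g2 k.+1 s) =
      fexp (fun y => g k.+1 (s + Y k y) - g k.+1 s - Y k y * g1 k.+1 s -
        Y k y ^+ 2 / 2 * g2 k.+1 s).
      rewrite !fexpB fexp_cst.
      under [X in _ = _ - X - _]eq_fexp do rewrite mulrC.
      under [X in _ = _ - X]eq_fexp do rewrite mulrC mulrA.
      under [X in _ = _ - X]eq_fexp do rewrite mulrAC.
      rewrite !fexpZ Y0// Y2// mulr0 subr0 opprD addrA; congr (_ - _).
      by rewrite mulrC mulrA mulrAC.
    apply: le_trans (fexp_norm _) _.
    apply: (@le_trans _ _ (fexp (fun y => M * e * Y k y ^+ 2))).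
      apply: fexp_le => y; have [_ _ T] := sg k.+1; apply: le_trans (T _ _) _.
      rewrite -mulrA ler_wpM2l// exprS real_normK ?num_real//.
      by rewrite ler_wpM2r ?sqr_ge0// Ye.
    by rewrite fexpZ Y2// mulrA.
  rewrite distrC opprD addrA.
  have := gauss_avg_increment t s (sg k.+1); rewrite (ger0_norm t0) -/kappa.
  by rewrite -(mulrA M kappa).
have : forall k, (k <= m)%N -> `|fexp (fun x => g k (S k x)) - g 0%N 0| <= k%:R * dl.
  elim=> [_|k IH km].
    rewrite mul0r normr_le0 subr_eq0; apply/eqP.
    under eq_fexp do rewrite /S big_ord0.
    exact: fexp_cst.
  rewrite -(subrKA (fexp (fun x => g k (S k x)))).
  apply: le_trans (ler_normD _ _) _; rewrite -natr1 mulrDl mul1r addrC.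
  by apply: lerD; [exact/IH/ltnW|exact: step].
move=> /(_ m (leqnn m)); rewrite /g subn0 subnn sqrtr0 mul0r.
by under eq_fexp do rewrite gauss_avg0.
Qed.

End finite_expectation.

(** * Weak convergence on finite probability spaces *)

Section weak_convergence.
Context {R : realType} (Om : nat -> finType) (p : forall n, Om n -> R).
Arguments p : clear implicits.
Hypotheses (p_ge0 : forall n x, 0 <= p n x) (p_sum1 : forall n, \sum_x p n x = 1).
Implicit Types (V W D : forall n, Om n -> R) (f : R -> R).

Definition unif_cont f := forall e : R, 0 < e -> exists2 d : R, 0 < d &
  forall x y, `|x - y| <= d -> `|f x - f y| <= e.

Definition fprob n (A : pred (Om n)) : R := fexp (p n) (fun x => (A x)%:R).

(** Convergence in law to [N(0, a^2)], the Dirac mass at 0 if [a = 0]. Uniformly continuous tests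
    make perturbations easy to handle; the other bounded continuous ones are recovered in
    [cvg_law_continuous]. *)
Definition cvg_law W (a : R) := forall f (M : R), (forall x, `|f x| <= M) ->
  unif_cont f -> fexp (p n) (fun x => f (W n x)) @[n --> \oo] --> gauss_avg a f 0.

(** Convergence to 0 in probability, on spaces that vary with [n]. *)
Definition asymp_negl V := forall d : R, 0 < d ->
  fprob (fun x : Om n => d < `|V n x|) @[n --> \oo] --> 0.

Lemma unif_cont_continuous f : unif_cont f -> continuous f.
Proof.
move=> fu x; apply/cvgrPdist_le => e /fu[d d0 fd]; near=> y.
by apply: fd; near: y; apply: cvgr_dist_le => //; exact: cvg_id.
Unshelve. all: by end_near. Qed.

Lemma fprob_ge0 n (A : pred (Om n)) : 0 <= fprob A.
Proof. by apply: fexp_ge0 => // x; rewrite ler0n. Qed.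

Lemma fprob_le n (A B : pred (Om n)) : subpred A B -> fprob A <= fprob B.
Proof. by move=> AB; apply: fexp_le => // x; rewrite ler_nat; have := AB x; by case: (A x) => //= /(_ isT) ->. Qed.

Lemma fprobU_le n (A B C : pred (Om n)) : (forall x, A x -> B x || C x) ->
  fprob A <= fprob B + fprob C.
Proof.
move=> ABC; rewrite -fexpD; apply: fexp_le => // x; rewrite -natrD ler_nat.
by have := ABC x; case: (A x) => //= /(_ isT); case: (B x); case: (C x).
Qed.

Lemma fprob_markov n (V : Om n -> R) (d : R) : 0 < d ->
  fprob (fun x => d < `|V x|) <= d^-1 * fexp (p n) (fun x => `|V x|).
Proof.
move=> d0; rewrite -fexpZ; apply: fexp_le => // x.
case: ltP => /= [dV|_]; last by rewrite mulr_ge0// invr_ge0 ltW.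
by rewrite mulrC ler_pdivlMr// mul1r ltW.
Qed.

Lemma cvg0_le (u v : nat -> R) : (\forall n \near \oo, 0 <= u n <= v n) ->
  v n @[n --> \oo] --> 0 -> u n @[n --> \oo] --> 0.
Proof. by move=> uv; apply: (squeeze_cvgr uv); exact: cvg_cst. Qed.

Lemma asymp_negl_L1 V : fexp (p n) (fun x => `|V n x|) @[n --> \oo] --> 0 ->
  asymp_negl V.
Proof.
move=> V0 d d0; apply: cvg0_le; last first.
  by rewrite -(mulr0 d^-1); apply: cvgMr; exact: V0.
by near=> n; rewrite fprob_ge0 fprob_markov.
Unshelve. all: by end_near. Qed.

Lemma asymp_neglD V W : asymp_negl V -> asymp_negl W ->
  asymp_negl (fun n x => V n x + W n x).
Proof.
move=> V0 W0 d d0; have d20 : 0 < d / 2 by rewrite divr_gt0.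
apply: cvg0_le; last by rewrite -(addr0 0); apply: cvgD; [exact: V0 d20|exact: W0 d20].
near=> n; rewrite fprob_ge0/=; apply: fprobU_le => x dVW.
rewrite -implyNb; apply/implyP; rewrite -leNgt => Vd.
rewrite ltNge; apply/negP => Wd.
move: dVW; rewrite ltNge (le_trans (ler_normD _ _))//; lra.
Unshelve. all: by end_near. Qed.

Lemma asymp_negl_le V W : (\forall n \near \oo, forall x, `|V n x| <= `|W n x|) ->
  asymp_negl W -> asymp_negl V.
Proof.
move=> VW W0 d d0; apply: cvg0_le (W0 d d0).
near=> n; rewrite fprob_ge0/=; apply: fprob_le => x /= dV.
have h : forall y, `|V n y| <= `|W n y| by near: n; exact: VW.
exact: lt_le_trans dV (h x).
Unshelve. all: by end_near. Qed.

(** Slutsky's lemma: where [V] and [W] differ by at most [d], the values of [f] differ by at most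
    [e / 3]; elsewhere, on a small event, by at most [2 * M]. *)
Lemma cvg_law_transfer V W a : cvg_law W a -> asymp_negl (fun n x => V n x - W n x) ->
  cvg_law V a.
Proof.
move=> Wa VW f M fM fu; have M0 : 0 <= M by rewrite (le_trans _ (fM 0)).
apply/cvgrPdist_le => e e0.
have e3 : 0 < e / 3 by rewrite divr_gt0.
have [d d0 fd] := fu _ e3.
have e6 : 0 < e / 3 / (2 * M + 1) by rewrite !divr_gt0// ltr_pwDr// mulr_ge0.
near=> n; rewrite -(subrKA (fexp (p n) (fun x => f (W n x)))) (le_trans (ler_normD _ _))//.
have h1 : `|gauss_avg a f 0 - fexp (p n) (fun x => f (W n x))| <= e / 3.
  by near: n; apply: cvgr_dist_le; [exact: Wa fM fu|rewrite divr_gt0].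
have h2 : fprob (fun x => d < `|V n x - W n x|) <= e / 3 / (2 * M + 1).
  rewrite -[leLHS]ger0_norm ?fprob_ge0// -[leLHS]normrN -sub0r.
  near: n; apply: cvgr_dist_le e6; exact: VW d0.
have h3 : `|fexp (p n) (fun x => f (W n x)) - fexp (p n) (fun x => f (V n x))| <=
    e / 3 + 2 * M * fprob (fun x => d < `|V n x - W n x|).
  rewrite -fexpB (le_trans (fexp_norm _ _))//.
  rewrite -fexpZ -{1}(fexp_cst (p_sum1 n) (e / 3)) -fexpD; apply: fexp_le => // x.
  case: ltP => [_|Vd] /=.
    rewrite mulr1 (le_trans (ler_normB _ _))// mulr_natl mulr2n.
    by rewrite (le_trans (lerD (fM _) (fM _)))// lerDr ltW// divr_gt0.
  by rewrite mulr0 addr0 fd// distrC.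
have h4 : 2 * M * fprob (fun x => d < `|V n x - W n x|) <= e / 3.
  apply: (@le_trans _ _ ((2 * M + 1) * (e / 3 / (2 * M + 1)))); last first.
    by rewrite mulrC divfK// gt_eqF// ltr_pwDr// mulr_ge0.
  apply: ler_pM => //; [by rewrite mulr_ge0|exact: fprob_ge0|by rewrite lerDl].
lra.
Unshelve. all: by end_near. Qed.

Lemma gauss_avg_close f g (M a e : R) : continuous f -> continuous g ->
  (forall x, `|f x| <= M) -> (forall x, `|g x| <= M) ->
  (forall x, `|f x - g x| <= e) -> `|gauss_avg a f 0 - gauss_avg a g 0| <= e.
Proof.
move=> cf cg fM gM fg.
have := @gauss_avg_bound _ (fun x => f x - g x) e 0 a.
rewrite /gauss_avg RintegralB//; first last.
- exact: integrable_gauss_avg gM.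
- exact: integrable_gauss_avg fM.
apply=> // x; apply: cvgB; [exact: cf|exact: cg].
Qed.

(** Bounded uniformly continuous functions are uniform limits of smooth tests. *)
Lemma cvg_law_smooth W a :
  (forall f f1 f2 (M : R), smooth_test f f1 f2 M ->
     fexp (p n) (fun x => f (W n x)) @[n --> \oo] --> gauss_avg a f 0) ->
  cvg_law W a.
Proof.
move=> h f M fM fu; apply/cvgrPdist_le => e e0.
have e3 : 0 < e / 3 by rewrite divr_gt0.
have [g [g1 [g2 [K [sg gf]]]]] := smooth_test_approx fM fu e3.
have [gK gL _] := sg.
have cg : continuous g.
  by apply: (@continuous_lipschitz _ _ K) => x y; case: (gL x y).
have gK0 x : `|g x| <= K by case: (gK x).
have h1 : `|gauss_avg a f 0 - gauss_avg a g 0| <= e / 3.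
  apply: (@gauss_avg_close _ _ (Num.max M K)) => //.
  - exact: unif_cont_continuous.
  - by move=> x; rewrite le_max fM.
  - by move=> x; rewrite le_max gK0 orbT.
  - by move=> x; rewrite distrC.
near=> n.
have h2 : `|gauss_avg a g 0 - fexp (p n) (fun x => g (W n x))| <= e / 3.
  by near: n; apply: cvgr_dist_le e3; exact: h sg.
have h3 : `|fexp (p n) (fun x => g (W n x)) - fexp (p n) (fun x => f (W n x))| <= e / 3.
  by rewrite -fexpB; apply: fexp_norm_le => // x; exact: gf.
move: h1 h2 h3; rewrite !ler_norml; lra.
Unshelve. all: by end_near. Qed.

Lemma dist_min (a x y : R) : `|Num.min a x - Num.min a y| <= `|x - y|.
Proof.
have := ler_norm (x - y); have := ler_norm (y - x); rewrite (distrC y).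
by rewrite /Num.min ler_norml; case: ltP => ?; case: ltP => ?; lra.
Qed.

Lemma dist_max (a x y : R) : `|Num.max a x - Num.max a y| <= `|x - y|.
Proof.
have := ler_norm (x - y); have := ler_norm (y - x); rewrite (distrC y).
by rewrite /Num.max ler_norml; case: ltP => ?; case: ltP => ?; lra.
Qed.

Lemma unif_cont_lipschitz f (C : R) : (forall x y, `|f x - f y| <= C * `|x - y|) ->
  unif_cont f.
Proof.
move=> fC e e0; have C0 : 0 <= C.
  by have := fC 0 1; rewrite sub0r normrN1 mulr1; exact: le_trans.
have C1 : 0 < C + 1 by rewrite ltr_pwDr.
exists (e / (C + 1)) => [|x y xy]; first exact: divr_gt0.
apply: le_trans (fC x y) _; apply: (@le_trans _ _ ((C + 1) * (e / (C + 1)))).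
  by apply: ler_pM => //; rewrite lerDl.
by rewrite mulrC divfK ?gt_eqF.
Qed.

(** The function [min 1 (|x| / d)] vanishes at the limit point 0 and is 1 wherever [|x| > d]. *)
Lemma cvg_law0_negl W : cvg_law W 0 -> asymp_negl W.
Proof.
move=> W0 d d0; pose f (x : R) := Num.min 1 (d^-1 * `|x|).
have f1 x : `|f x| <= 1.
  rewrite ger0_norm ?ge_min ?lexx// le_min ler01 mulr_ge0// invr_ge0 ltW//.
have fu : unif_cont f.
  apply: (@unif_cont_lipschitz _ d^-1) => x y; apply: le_trans (dist_min _ _ _) _.
  rewrite -mulrBr normrM ger0_norm ?invr_ge0 ?(ltW d0)// ler_wpM2l ?invr_ge0 ?(ltW d0)//.
  exact: ler_dist_dist.
have := W0 f 1 f1 fu; rewrite gauss_avg0 /f normr0 mulr0 /Num.min ltNge ler01/=.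
apply: cvg0_le; near=> n; rewrite fprob_ge0/=; apply: fexp_le => // x.
case: ltP => /= [dW|_]; last by case: ifP => // _; rewrite mulr_ge0// invr_ge0 ltW.
by rewrite ifT// -ltr_pdivrMl ?invr_gt0// invrK mulr1.
Unshelve. all: by end_near. Qed.

Lemma gauss_avg_tail_le f (C a : R) : continuous f -> 0 <= C ->
  (forall x, `|f x| <= C * x ^+ 2) -> `|gauss_avg a f 0| <= C * a ^+ 2.
Proof.
move=> cf C0 fC.
have iS : (normal_prob 0 1).-integrable setT (EFin \o (fun z : R => C * a ^+ 2 * z ^+ 2)).
  apply: (@integrable_gauss_cubic _ _ (C * a ^+ 2) (C * a ^+ 2)).
  - by rewrite mulr_ge0// sqr_ge0.
  - by rewrite mulr_ge0// sqr_ge0.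
  - by move=> x; apply: cvgMr; exact: exprn_continuous.
  - move=> z; rewrite ger0_norm ?(mulr_ge0 (mulr_ge0 C0 (sqr_ge0 _))) ?sqr_ge0//.
    have := ler_wpM2l (mulr_ge0 C0 (sqr_ge0 a)) (sqr_le_cube z).
    by rewrite mulrDr mulr1.
have fS z : `|f (0 + a * z)| <= C * a ^+ 2 * z ^+ 2.
  by apply: le_trans (fC _) _; rewrite add0r exprMn mulrA.
have iF : (normal_prob 0 1).-integrable setT (EFin \o (fun z : R => f (0 + a * z))).
  apply: (@le_integrable _ _ _ _ setT measurableT _ _ _ _ iS).
    by apply/measurable_EFinP; apply: continuous_measurable_fun; exact: continuous_affine.
  move=> z _; rewrite !abse_EFin lee_fin (le_trans (fS z))//; exact: ler_norm.
apply: le_trans (le_normr_Rintegral measurableT iF) _.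
have E : \int[normal_prob 0 1]_z (C * a ^+ 2 * z ^+ 2) = C * a ^+ 2.
  have [_ m2] := @gauss_mean0_var1 R.
  rewrite RintegralZl ?m2 ?mulr1//.
  apply: (@integrable_gauss_cubic _ _ 1 1) => //; first exact: exprn_continuous.
  by move=> z; rewrite ger0_norm ?sqr_ge0// mul1r sqr_le_cube.
rewrite -[leRHS]E.
apply: le_Rintegral => //; exact: (integrable_norm iF).
Qed.

(** The mass beyond [K] is tested by a Lipschitz cut-off that vanishes on [[- K0, K0]] and lies
    below [x^2 / K0]; the Gaussian second moment [a^2] controls its limit. *)
Lemma cvg_law_tight W a : cvg_law W a -> forall e : R, 0 < e ->
  exists2 K0 : R, 0 < K0 & forall K, K0 <= K ->
    \forall n \near \oo, fprob (fun x : Om n => K < `|W n x|) <= e.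
Proof.
(* Chosen so that [a ^+ 2 / K0 <= e / 2]; the summand 1 makes [x ^+ 2 / K0 >= 1] beyond [K0]. *)
move=> Wa e e0; pose K0 := 1 + 2 * a ^+ 2 / e.
have K01 : 1 <= K0 by rewrite lerDl divr_ge0 ?(ltW e0)// mulr_ge0// sqr_ge0.
have K00 : 0 < K0 by rewrite (lt_le_trans ltr01).
exists (K0 + 1) => [|K KK]; first by rewrite addr_gt0.
pose f (x : R) := Num.min 1 (Num.max 0 (`|x| - K0)).
have f0 x : 0 <= f x by rewrite le_min ler01 le_max lexx.
have f1 x : `|f x| <= 1 by rewrite ger0_norm// ge_min lexx.
have fL x y : `|f x - f y| <= 1 * `|x - y|.
  apply: le_trans (dist_min _ _ _) _; apply: le_trans (dist_max _ _ _) _.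
  rewrite (_ : `|x| - K0 - (`|y| - K0) = `|x| - `|y|); last by ring.
  by rewrite mul1r; exact: ler_dist_dist.
have cf := continuous_lipschitz fL.
have ga : gauss_avg a f 0 <= e / 2.
  apply: le_trans (ler_norm _) _.
  have := @gauss_avg_tail_le f (K0^-1) a cf; rewrite invr_ge0 (ltW K00) => /(_ isT).
  have fK x : `|f x| <= K0^-1 * x ^+ 2.
    rewrite ger0_norm// /f; case: (leP `|x| K0) => xK.
      apply: (@le_trans _ _ 0).
        by rewrite ge_min ge_max lexx subr_le0 xK orbT.
      by apply: mulr_ge0; [rewrite invr_ge0 ltW|exact: sqr_ge0].
    apply: (@le_trans _ _ 1); first by rewrite ge_min lexx.
    rewrite mulrC ler_pdivlMr// mul1r -real_normK ?num_real// expr2.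
    by apply: le_trans (ltW xK) _; rewrite ler_peMl// (le_trans K01)// ltW.
  move=> /(_ fK) /le_trans; apply.
  rewrite mulrC ler_pdivrMr//.
  rewrite /K0 mulrDr mulr1 -lerBlDl.
  have -> : e / 2 * (2 * a ^+ 2 / e) = a ^+ 2 by field; rewrite gt_eqF.
  by rewrite gerBl divr_ge0// ltW.
near=> n.
have h : `|gauss_avg a f 0 - fexp (p n) (fun x => f (W n x))| <= e / 2.
  near: n; apply: cvgr_dist_le; last by rewrite divr_gt0.
  exact: Wa f1 (unif_cont_lipschitz fL).
have h1 : fprob (fun x : Om n => K < `|W n x|) <= fexp (p n) (fun x => f (W n x)).
  apply: fexp_le => // x; case: ltP => //= KW.
  rewrite /f le_min lexx le_max/= lerBrDl (le_trans _ (ltW KW)) ?orbT//.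
move: h; rewrite ler_norml; lra.
Unshelve. all: by end_near. Qed.

Lemma asymp_negl_ratio W D a : cvg_law W a -> asymp_negl (fun n x => D n x - 1) ->
  asymp_negl (fun n x => W n x / D n x - W n x).
Proof.
move=> Wa D1 d d0; apply/cvgrPdist_le => e e0.
have e2 : 0 < e / 2 by rewrite divr_gt0.
have [K K0 KW] := cvg_law_tight Wa e2.
(* The first bound keeps [D] above [1 / 2], the second makes [|W| |1 - D|] at most [d / 2] where
   [|W| <= K]. *)
pose dl := Num.min (1 / 2) (d / (2 * K)).
have dl0 : 0 < dl by rewrite lt_min divr_gt0//= divr_gt0// mulr_gt0.
near=> n.
have h1 : fprob (fun x : Om n => K < `|W n x|) <= e / 2 by near: n; exact: KW.
have h2 : fprob (fun x : Om n => dl < `|D n x - 1|) <= e / 2.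
  rewrite -[leLHS]ger0_norm ?fprob_ge0// -[leLHS]normrN -sub0r.
  near: n; apply: cvgr_dist_le e2; exact: D1 dl0.
rewrite sub0r normrN ger0_norm ?fprob_ge0//.
apply: le_trans (_ : e / 2 + e / 2 <= e); last by lra.
apply: le_trans (lerD h1 h2); apply: fprobU_le => x.
apply: contraTT; rewrite negb_or -!leNgt => /andP[WK Ddl].
have [dl1 dl2] : dl <= 1 / 2 /\ dl <= d / (2 * K) by rewrite !ge_min !lexx orbT.
have D12 : 1 / 2 <= D n x by move: Ddl; rewrite ler_norml; lra.
have D0 : 0 < D n x by lra.
have -> : W n x / D n x - W n x = W n x * (1 - D n x) * (D n x)^-1.
  by field; rewrite gt_eqF.
rewrite normrM normfV (gtr0_norm D0) ler_pdivrMr// normrM distrC.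
apply: (@le_trans _ _ (K * (d / (2 * K)))).
  by apply: ler_pM => //; exact: le_trans Ddl dl2.
have -> : K * (d / (2 * K)) = d * (1 / 2) by field; rewrite gt_eqF.
by rewrite ler_pM2l.
Unshelve. all: by end_near. Qed.

Lemma near_unif_cont f (K e : R) : continuous f -> 0 < e -> exists2 d : R, 0 < d &
  forall x y, `|x| <= K -> `|x - y| <= d -> `|f x - f y| <= e.
Proof.
move=> cf e0.
have /compact_near_coveringP cK := @segment_compact R (- K) K.
have : \forall d \near 0^'+, `[- K, K]%classic `<=`
    [set x | forall y, `|x - y| <= d -> `|f x - f y| <= e].
  apply: cK => x _.
  have e2 : 0 < e / 2 by rewrite divr_gt0.
  have /cvgrPdist_le/(_ _ e2) := cf x; move=> /nbhs_ballP[r r0 xr].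
  have r2 : 0 < r / 2 by rewrite divr_gt0.
  exists (ball x (r / 2), [set d : R | d <= r / 2]) => /=.
    by split; [exact: nbhsx_ballx|exact: nbhs_right_le].
  move=> [z d] /= [xz dr] y zy; rewrite /ball/= in xz.
  have hz : ball x r z by rewrite /ball/= (lt_trans xz)//; lra.
  have hy : ball x r y.
    rewrite /ball/= (_ : x - y = (x - z) + (z - y)); last by ring.
    rewrite (le_lt_trans (ler_normD _ _))// [ltRHS]splitr ltr_leD//.
    exact: le_trans zy dr.
  have := xr _ hz; have := xr _ hy; rewrite /= !ler_norml; lra.
move=> [r /= r0 rP]; exists (r / 2) => [|x y xK xy]; first by rewrite divr_gt0.
apply: (rP (r / 2)) => //=.
- rewrite /ball_/= sub0r normrN gtr0_norm ?divr_gt0//; lra.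
- by rewrite divr_gt0.
- by rewrite in_itv/= -ler_norml.
Unshelve. all: by end_near. Qed.

(** [f] composed with the clipping to [[- K, K]] is uniformly continuous and differs from [f] only
    on the tails, which are small by tightness for [W] and by the second moment for the limit
    law. *)
Lemma cvg_law_continuous W a f (M : R) : cvg_law W a -> continuous f ->
  (forall x, `|f x| <= M) ->
  fexp (p n) (fun x => f (W n x)) @[n --> \oo] --> gauss_avg a f 0.
Proof.
move=> Wa cf fM; apply/cvgrPdist_le => e e0.
have M0 : 0 <= M by rewrite (le_trans _ (fM 0)).
have M1 : 0 < 2 * M + 1 by rewrite ltr_pwDr// mulr_ge0.
have e3 : 0 < e / 3 / (2 * M + 1) by rewrite !divr_gt0.
have [K1 K10 KW] := cvg_law_tight Wa e3.
(* The first bound makes the tails of [W n] small, the second those of the Gaussian: the clipping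
   error is pointwise below [(2 * M + 1) / K * x ^+ 2]. *)
pose K := Num.max K1 (1 + a ^+ 2 * (2 * M + 1) / (e / 3)).
have K1K : K1 <= K by rewrite le_max lexx.
have K01 : 1 <= K.
  have h : 0 <= a ^+ 2 * (2 * M + 1) / (e / 3).
    by apply: divr_ge0; [apply: mulr_ge0; [exact: sqr_ge0|exact: ltW]|rewrite divr_ge0// ltW].
  by rewrite le_max lerDl h orbT.
have K0 : 0 < K by rewrite (lt_le_trans ltr01).
pose clip (x : R) := Num.max (- K) (Num.min K x).
have clipK x : `|clip x| <= K.
  by rewrite ler_norml /clip le_max lexx ge_max ge_min lexx andbT/= ge0_cp// ltW.
have clip_id x : `|x| <= K -> clip x = x.
  rewrite ler_norml => /andP[x1 x2]; rewrite /clip (min_idPr x2); exact/max_idPr.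
pose g x := f (clip x).
have gM x : `|g x| <= M by exact: fM.
have gu : unif_cont g.
  move=> e' e'0; have [d d0 fd] := near_unif_cont K cf e'0.
  exists d => // x y xy; apply: fd; first exact: clipK.
  by apply: le_trans (dist_max _ _ _) _; apply: le_trans (dist_min _ _ _) xy.
have cg := unif_cont_continuous gu.
have fg x : `|f x - g x| <= 2 * M.
  by rewrite (le_trans (ler_normB _ _))// mulr_natl mulr2n lerD.
have h1 : `|gauss_avg a f 0 - gauss_avg a g 0| <= e / 3.
  have := @gauss_avg_tail_le (fun x => f x - g x) ((2 * M + 1) / K) a.
  rewrite {1}/gauss_avg RintegralB//; first last.
  - exact: integrable_gauss_avg gM.
  - exact: integrable_gauss_avg fM.
  move=> h; apply: le_trans (h _ _ _) _.
  - by move=> x; apply: cvgB; [exact: cf|exact: cg].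
  - by rewrite divr_ge0 ?ltW.
  - move=> x; case: (leP `|x| K) => xK.
      by rewrite /g clip_id// subrr normr0 mulr_ge0 ?sqr_ge0// divr_ge0// ltW.
    apply: le_trans (fg x) _; apply: (@le_trans _ _ (2 * M + 1)); first by rewrite lerDl.
    rewrite -[leLHS]mulr1 -mulrA ler_wpM2l ?(ltW M1)// mulrC ler_pdivlMr// mul1r.
    rewrite -real_normK ?num_real// expr2 (le_trans (ltW xK))// ler_peMl//.
    by rewrite (le_trans K01)// ltW.
  - rewrite mulrAC ler_pdivrMr// -ler_pdivrMl ?divr_gt0//.
    rewrite le_max; apply/orP; right.
    by rewrite mulrC [_ * a ^+ 2]mulrC lerDr.
near=> n.
have h2 : `|gauss_avg a g 0 - fexp (p n) (fun x => g (W n x))| <= e / 3.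
  by near: n; apply: cvgr_dist_le; [exact: Wa gM gu|rewrite divr_gt0].
have h3 : `|fexp (p n) (fun x => g (W n x)) - fexp (p n) (fun x => f (W n x))| <= e / 3.
  have hP : fprob (fun x : Om n => K < `|W n x|) <= e / 3 / (2 * M + 1).
    by near: n; exact: KW.
  rewrite -fexpB (le_trans (fexp_norm _ _))//.
  apply: (@le_trans _ _ ((2 * M + 1) * fprob (fun x : Om n => K < `|W n x|))).
    rewrite -fexpZ; apply: fexp_le => // x; case: ltP => [_|xK] /=.
      by rewrite mulr1 distrC (le_trans (fg _))// lerDl.
    by rewrite mulr0 /g clip_id// subrr normr0.
  by rewrite -ler_pdivlMl// mulrC.
move: h1 h2 h3; rewrite !ler_norml; lra.
Unshelve. all: by end_near. Qed.

End weak_convergence.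

(** * Exceedance patterns and beta-mixing *)

Section finite_classification.
Context {d : measure_display} {U : measurableType d} {R : realType}.
Context {F : finType} (c : U -> F).
Hypothesis mc : forall b, measurable (c @^-1` [set b]).

Let class_cons b s :
  [set y | c y \in b :: s] = c @^-1` [set b] `|` [set y | c y \in s].
Proof.
apply/seteqP; split=> y /=; rewrite in_cons.
  by move=> /orP[/eqP|]; [left|right].
by case=> [->|->]; rewrite ?eqxx ?orbT.
Qed.

Let measurable_class_seq (s : seq F) : measurable [set y | c y \in s].
Proof.
elim: s => [|b s IH]; last by rewrite class_cons; exact: measurableU.
by rewrite (_ : [set y | _] = set0)//; apply/seteqP; split.
Qed.

Lemma measurable_class (S : pred F) : measurable [set y | S (c y)].
Proof.
have := measurable_class_seq (enum S).
by under [X in measurable X]eq_set do rewrite mem_enum.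
Qed.

Lemma measure_class (mu : {measure set U -> \bar R}) (S : pred F) :
  mu [set y | S (c y)] = (\sum_(b | S b) mu (c @^-1` [set b]))%E.
Proof.
have : uniq (enum S) by exact: enum_uniq.
rewrite -big_enum/= (_ : [set y | S (c y)] = [set y | c y \in enum S]); last first.
  by apply/seteqP; split=> y /=; rewrite mem_enum.
elim: (enum S) => [_|b s IH /= /andP[bs /IH{}IH]].
  by rewrite big_nil (_ : [set y | _] = set0) ?measure0//; apply/seteqP; split.
rewrite class_cons measureU//.
  by rewrite big_cons; congr (_ + _)%E; exact: IH.
by apply/seteqP; split=> // y /= [-> h]; rewrite h in bs.
Qed.

Lemma integral_class (P : probability U R) (h : F -> R) :
  (\int[P]_y (h (c y))%:E = (\sum_b fine (P (c @^-1` [set b])) * h b)%:E)%E.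
Proof.
have mP b : (fine (P (c @^-1` [set b])))%:E = P (c @^-1` [set b]).
  by rewrite fineK// fin_num_measure.
transitivity (\int[P]_y (\sum_b (h b)%:E * (\1_(c @^-1` [set b]) y)%:E))%E.
  apply: eq_integral => y _; rewrite (bigD1 (c y))//= big1 ?adde0.
    by rewrite indicE mem_set// mule1.
  by move=> b bc; rewrite indicE memNset ?mule0// => /= cb; rewrite cb eqxx in bc.
have iI b : P.-integrable setT (fun y => (\1_(c @^-1` [set b]) y)%:E).
  apply: integrable_indic => //; exact: fin_num_fun_lty.
rewrite integral_sum//; last by move=> b; exact: integrableZl.
rewrite -sumEFin; apply: eq_bigr => b _.
by rewrite integralZl// integral_indic// setIT EFinM mP muleC.
Qed.

End finite_classification.

Section mixing.
Context {d : measure_display} {T : measurableType d} {R : realType}.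
Context (P : probability T R) (X : int -> {RV P >-> R}).

(* The integrand of [mixing_gap] is an uncountable supremum, hence possibly not measurable. *)
Lemma ge0_le_integralT (f g : T -> \bar R) : (forall w, 0 <= f w)%E ->
  (forall w, f w <= g w)%E -> (\int[P]_w f w <= \int[P]_w g w)%E.
Proof.
move=> f0 fg; rewrite !ge0_integralTE//; last by move=> w; exact: le_trans (f0 w) (fg w).
apply: le_ereal_sup => _ [h hf <-]; exists h => // w.
exact: le_trans (hf w) (fg w).
Qed.

Lemma sigma_gen_measurable i j : sigma_gen X i j `<=` measurable.
Proof. by move=> A [t _ [B mB <-]]; rewrite setTI; exact: measurable_funPTI. Qed.

Lemma g_sigma_gen_measurable i j : <<s sigma_gen X i j >> `<=` measurable.
Proof.
apply: smallest_sub; first exact: sigma_algebra_measurable.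
exact: sigma_gen_measurable.
Qed.

Lemma measurable_segment i m : measurable_fun setT (segment X i m).
Proof.
apply/measurable_fun_tnthP => j.
rewrite (_ : _ \o _ = X (Posz (i + j))); first exact: measurable_funPT.
by apply/funext => w; rewrite /= tnth_mktuple.
Qed.

(** For any regular version, the best event at [w] collects the values of [c2] that become more
    likely given [w]; it may depend on [w], as the supremum is inside the expectation. This yields
    half the L1 distance between the joint law of the two classes and the product law, for every
    version and so for the infimum. *)
Lemma mixing_gap_ge (n k l : nat) (F1 F2 : finType) (c1 : T -> F1)
    (c2 : (n - (l + k)).-tuple R -> F2) :
  (forall a, <<s sigma_gen X 1 l >> (c1 @^-1` [set a])) ->
  (forall b, measurable (c2 @^-1` [set b])) ->
  ((2^-1 * \sum_a \sum_b
     `|prob P [set w | c1 w = a /\ c2 (segment X (l + k + 1) (n - (l + k)) w) = b] -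
       prob P [set w | c1 w = a] *
       prob P [set w | c2 (segment X (l + k + 1) (n - (l + k)) w) = b]|)%:E
   <= mixing_gap X n k l)%E.
Proof.
move=> mc1 mc2; set Y := segment X _ _; apply: le_ereal_inf_tmp => _ [kappa kP <-].
have mT1 a : measurable (c1 @^-1` [set a]) by exact: g_sigma_gen_measurable (mc1 a).
have mY : measurable_fun setT Y by exact: measurable_segment.
have mT2 b : measurable (Y @^-1` (c2 @^-1` [set b])).
  by rewrite -[X in measurable X]setTI; exact: mY.
pose y b := prob P [set w | c2 (Y w) = b].
pose x b (w : T) := fine (kappa w (c2 @^-1` [set b])).
have k1 w B : measurable B -> (kappa w B <= 1)%E.
  move=> mB; rewrite -(@prob_kernel _ _ _ _ _ kappa w); apply: le_measure; rewrite ?inE//.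
have kfinB w B : measurable B -> kappa w B \is a fin_num.
  by move=> mB; rewrite ge0_fin_numE// (le_lt_trans (k1 w B mB))// ltry.
have kfin b w : kappa w (c2 @^-1` [set b]) \is a fin_num by exact: kfinB.
have yE b : (y b)%:E = P (Y @^-1` (c2 @^-1` [set b])) by rewrite /y /prob fineK//; apply: fin_num_measure; exact: mT2.
have x01 b w : `|x b w| <= 1.
  rewrite ger0_norm ?fine_ge0// -lee_fin fineK//.
  exact: k1.
have mx b : measurable_fun [set: T] (x b).
  move=> _ B mB; rewrite setTI; apply: (@g_sigma_gen_measurable 1 l).
  have := measurableT_comp (@fine_measurable R setT measurableT)
    (measurable_kernel kappa _ (mc2 b)).
  by move=> /(_ measurableT B mB); rewrite setTI.
have ix b (A : set T) : measurable A -> P.-integrable A (EFin \o x b).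
  move=> mA; apply: (integrableS measurableT) => //.
  apply: measurable_bounded_integrable => //; first exact: fin_num_fun_lty.
  exists 1; split=> [|z z1 w _]; first exact: num_real.
  exact: le_trans (x01 b w) (ltW z1).
have ic r (A : set T) : measurable A -> P.-integrable A (EFin \o (fun=> r)).
  move=> mA; apply: (integrableS measurableT) => //.
  exact: finite_measure_integrable_cst.
have iB b (A : set T) : measurable A -> P.-integrable A (EFin \o (fun w => x b w - y b)).
  move=> mA; under [X in _.-integrable _ X]eq_fun do rewrite /= EFinB.
  by apply: integrableB; [|exact: ix|exact: ic].
have term a b : `|prob P [set w | c1 w = a /\ c2 (Y w) = b] -
    prob P [set w | c1 w = a] * y b| <= \int[P]_(w in c1 @^-1` [set a]) `|x b w - y b|.
  rewrite (_ : _ - _ = \int[P]_(w in c1 @^-1` [set a]) (x b w - y b)).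
    by apply: le_normr_Rintegral => //; exact: iB.
  rewrite RintegralB//; [|exact: ix|exact: ic].
  congr (_ - _); last by rewrite Rintegral_cst// mulrC.
  rewrite /prob -(kP _ _ (mc1 a) (mc2 b)); congr fine; apply: eq_integral => w _.
  by rewrite /x fineK.
pose D w := \sum_b `|x b w - y b|.
have iD b (A : set T) : measurable A -> P.-integrable A (EFin \o (fun w => `|x b w - y b|)).
  by move=> mA; exact: (integrable_norm (iB b _ mA)).
have mD : measurable_fun [set: T] (EFin \o D).
  apply/measurable_EFinP; apply: measurable_sum => b.
  apply: measurableT_comp => //; exact: measurable_funB.
have D0 w : 0 <= D w by exact: sumr_ge0.
(* The fibres of [c1] partition the space, so the integrals over them add up to that of [D]. *)
have sumD : ((\sum_a \sum_b `|prob P [set w | c1 w = a /\ c2 (Y w) = b] -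
    prob P [set w | c1 w = a] * y b|)%:E <= \int[P]_w (D w)%:E)%E.
  apply: (@le_trans _ _ (\sum_a \int[P]_(w in c1 @^-1` [set a]) (D w)%:E)%E).
    rewrite -sumEFin; apply: lee_sum => a _.
    apply: (@le_trans _ _ (\sum_b \int[P]_(w in c1 @^-1` [set a]) `|x b w - y b|)%:E).
      by rewrite lee_fin; apply: ler_sum => b _; exact: term.
    rewrite -sumEFin.
    rewrite (eq_integral (fun w => \sum_b `|x b w - y b|%:E))%E; last first.
      by move=> w _; rewrite sumEFin.
    rewrite integral_sum//; last by move=> b; exact: iD.
    apply: lee_sum => b _; rewrite /Rintegral fineK//.
    by apply: integrable_fin_num => //; exact: iD.
  have -> : (\int[P]_w (D w)%:E = \int[P]_w \sum_a ((D w)%:E * (\1_(c1 @^-1` [set a]) w)%:E))%E.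
    apply: eq_integral => w _; rewrite (bigD1 (c1 w))//= big1 ?adde0.
      by rewrite indicE mem_set// mule1.
    by move=> a ac; rewrite indicE memNset ?mule0// => /= ca; rewrite ca eqxx in ac.
  rewrite ge0_integral_sum//.
  - apply: lee_sum => a _.
    rewrite (_ : (\int[P]_(w in c1 @^-1` [set a]) (D w)%:E)%E =
      (\int[P]_w ((D w)%:E * (\1_(c1 @^-1` [set a]) w)%:E))%E)//.
    rewrite [LHS]integral_mkcond; apply: eq_integral => w _; rewrite patchE indicE.
    by case: (w \in _); rewrite ?mule1 ?mule0.
  - move=> a; apply: emeasurable_funM => //.
    by apply/measurable_EFinP; exact: measurable_indic.
  - by move=> a w _; rewrite mule_ge0// lee_fin.
have Dsup w : ((2^-1 * D w)%:E <=
  ereal_sup [set `|kappa w B - P (Y @^-1` B)| | B in measurable])%E.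
  pose S : pred F2 := fun b => y b < x b w.
  have xS (Q : pred F2) : kappa w [set z | Q (c2 z)] = (\sum_(b | Q b) x b w)%:E.
    rewrite (measure_class mc2) -sumEFin; apply: eq_bigr => b _.
    by rewrite /x fineK.
  have yS (Q : pred F2) : P (Y @^-1` [set z | Q (c2 z)]) = (\sum_(b | Q b) y b)%:E.
    rewrite (@measure_class _ _ _ _ (c2 \o Y)) -?sumEFin; last exact: mT2.
    by apply: eq_bigr => b _; rewrite yE.
  (* Both are probability vectors: the positive and the negative part of the difference have equal
     sums, whence the factor [2^-1]. *)
  have tot : \sum_b x b w = \sum_b y b.
    have := xS predT; have := yS predT.
    have -> : [set z | predT (c2 z)] = setT by apply/seteqP; split.
    rewrite preimage_setT probability_setT prob_kernel => y1 x1.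
    by apply: EFin_inj; rewrite -x1 -y1.
  apply: (@le_trans _ _ (`|kappa w [set z | S (c2 z)] - P (Y @^-1` [set z | S (c2 z)])|)%E).
    rewrite xS yS -EFinB abse_EFin lee_fin; apply: le_trans (ler_norm _).
    rewrite ler_pdivrMl// /D (bigID S)/=.
    rewrite (bigID S) [in RHS](bigID S)/= in tot.
    rewrite (eq_bigr (fun b => x b w - y b)); last first.
      by move=> b Sb; rewrite ger0_norm// subr_ge0 ltW.
    rewrite [X in _ + X](eq_bigr (fun b => y b - x b w)); last first.
      by move=> b; rewrite /S -leNgt => Sb; rewrite ler0_norm ?opprB// subr_le0.
    rewrite !sumrB; lra.
  apply: ereal_sup_ubound; exists [set z | S (c2 z)] => //.
  exact: measurable_class.
apply: (@le_trans _ _ (\int[P]_w (2^-1 * D w)%:E)%E).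
  under eq_integral do rewrite EFinM.
  have h2 : (0 <= (2^-1 : R)%:E)%E by rewrite lee_fin invr_ge0.
  rewrite (@ge0_integralZl _ _ _ P setT measurableT (EFin \o D))//.
    by rewrite EFinM lee_wpmul2l.
  by move=> w _; rewrite lee_fin.
apply: ge0_le_integralT => // w; by rewrite lee_fin mulr_ge0// invr_ge0.
Qed.

End mixing.

(** Statistics are functions of infinite bit sequences, so that shifts and windows need no bounds or
    casts; [local] records the finitely many bits that count. *)
Definition local {R : realType} (a len : nat) (H : (nat -> bool) -> R) : Prop :=
  forall x y : nat -> bool, (forall i, (a <= i < a + len)%N -> x i = y i) -> H x = H y.

Definition shift_seq (a : nat) (x : nat -> bool) (i : nat) : bool := x (a + i)%N.

(** Padding by [false]: the guard cuts off the arbitrary values that [inord] produces out of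
    range. *)
Definition extend {n : nat} (om : {ffun 'I_n.+1 -> bool}) (i : nat) : bool :=
  (i < n.+1)%N && om (inord i).

Section pattern.
Context {d : measure_display} {T : measurableType d} {R : realType}.
Context (P : probability T R) (X : int -> {RV P >-> R}) (n : nat) (u : R).
Local Notation bits := {ffun 'I_n.+1 -> bool}.

(** Index 0 precedes the sample [X_1, ..., X_n]: it hosts the conditioning on [X_0] in (3) and the
    statistics of a block written from bit 0. *)
Definition pattern (w : T) : bits := [ffun i : 'I_n.+1 => u < X (Posz i) w].

Definition pattern_weight (om : bits) : R := prob P (pattern @^-1` [set om]).

Lemma measurable_bits_fiber d' (U : measurableType d') (I : finType) (b : I -> U -> bool) :
  (forall i, measurable [set w | b i w]) ->
  forall om : {ffun I -> bool},
    measurable ((fun w => [ffun i => b i w]) @^-1` [set om]).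
Proof.
move=> mb om; rewrite (_ : _ @^-1` _ = \big[setI/setT]_(i : I) [set w | b i w = om i]).
  apply: bigsetI_measurable => i _; case: (om i); first exact: mb.
  rewrite (_ : [set w | _] = ~` [set w | b i w]); first exact: measurableC.
  by apply/seteqP; split=> w /=; [move=> ->|move=> /negP/negbTE].
rewrite -bigcap_seq; apply/seteqP; split=> w /=.
  by move=> <- i _; rewrite /= ffunE.
by move=> h; apply/ffunP => i; rewrite ffunE; apply: h; rewrite /= mem_index_enum.
Qed.

Lemma measurable_exceeds i : measurable [set w | u < X i w].
Proof.
rewrite (_ : [set w | _] = X i @^-1` `]u, +oo[); last first.
  by apply/seteqP; split=> w /=; rewrite in_itv/= andbT.
exact: measurable_funPTI.
Qed.

Lemma measurable_pattern om : measurable (pattern @^-1` [set om]).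
Proof. by apply: measurable_bits_fiber => i; exact: measurable_exceeds. Qed.

Lemma pattern_weight_ge0 om : 0 <= pattern_weight om.
Proof. exact: fine_ge0. Qed.

Lemma integral_pattern (h : bits -> R) :
  (\int[P]_w (h (pattern w))%:E = (fexp pattern_weight h)%:E)%E.
Proof. by rewrite (integral_class measurable_pattern). Qed.

Lemma pattern_weight_sum1 : \sum_om pattern_weight om = 1.
Proof.
have := integral_pattern (fun=> 1); rewrite integral_cst//= [P _]probability_setT mule1.
by move=> [->]; apply: eq_bigr => om _; rewrite mulr1.
Qed.

Lemma expectation_pattern (h : bits -> R) :
  ('E_P[fun w => h (pattern w)] = (fexp pattern_weight h)%:E)%E.
Proof. by rewrite unlock integral_pattern. Qed.

Lemma extend_pattern w i : (i <= n)%N -> extend (pattern w) i = (u < X (Posz i) w).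
Proof. by move=> ni; rewrite /extend ltnS ni ffunE inordK. Qed.

Lemma prob_pattern (A : pred bits) :
  prob P [set w | A (pattern w)] = fexp pattern_weight (fun om => (A om)%:R).
Proof.
apply: EFin_inj; rewrite -integral_pattern.
rewrite (_ : (fun _ => _) = (fun w => (\1_[set w | A (pattern w)] w)%:E)).
  have mA := measurable_class measurable_pattern A.
  by rewrite integral_indic// setIT fineK// fin_num_measure.
by apply/funext => w; rewrite indicE; case: (boolP (A (pattern w))) => h; [rewrite mem_set|rewrite memNset//; apply/negP].
Qed.

(** A window of bits is a function of a vector of finitely many [X_t], which is where stationarity
    applies; the shifted window has to fit into [0..n], beyond which there is only padding. *)
Lemma fexp_pattern_shift (H : (nat -> bool) -> R) (a len : nat) :
  stationary X -> local 0 len H -> (a + len <= n.+1)%N ->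
  fexp pattern_weight (fun om => H (shift_seq a (extend om))) =
  fexp pattern_weight (fun om => H (extend om)).
Proof.
move=> sX Hl an.
pose q (b : nat) (w : T) : {ffun 'I_len -> bool} := [ffun i : 'I_len => u < X (Posz (b + i)) w].
pose ex (y : {ffun 'I_len -> bool}) (i : nat) : bool :=
  if insub i is Some j then y j else false.
have mq b y : measurable (q b @^-1` [set y]).
  by apply: measurable_bits_fiber => i; exact: measurable_exceeds.
have E b : (b + len <= n.+1)%N ->
    (fexp pattern_weight (fun om => H (shift_seq b (extend om))))%:E =
    (\sum_y fine (P (q b @^-1` [set y])) * H (ex y))%:E.
  move=> bn; rewrite -(integral_class (mq b)) -integral_pattern.
  apply: eq_integral => w _; congr _%:E; apply: Hl => i /= il.
  rewrite /shift_seq extend_pattern; last by rewrite -ltnS (leq_trans _ bn)// ltn_add2l.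
  by rewrite /ex insubT ffunE.
apply: EFin_inj; rewrite E//.
have := E 0%N (leq_trans (leq_addl _ _) an).
rewrite (_ : (fun om => H (shift_seq 0 (extend om))) = (fun om => H (extend om)))//.
move=> ->; congr _%:E; apply: eq_bigr => y _; congr (fine _ * _).
pose A := (fun t : len.-tuple R => [ffun i : 'I_len => u < tnth t i]) @^-1` [set y].
have mA : measurable A.
  apply: measurable_bits_fiber => i.
  rewrite (_ : [set w | _] = (@tnth _ R ^~ i) @^-1` `]u, +oo[); last first.
    by apply/seteqP; split=> w /=; rewrite in_itv/= andbT.
  by rewrite -[X in measurable X]setTI; exact: measurable_tnth.
have := sX len [tuple Posz i | i < len] (Posz a) A mA.
have Q b : [set w | A [tuple X (tnth [tuple Posz i | i < len] i + Posz b) w | i < len]] =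
    q b @^-1` [set y].
  apply/seteqP; split=> w; rewrite /A/= => <-; apply/ffunP => i;
    by rewrite !ffunE !tnth_mktuple addrC.
rewrite Q => ->; rewrite -(Q 0%N); congr (P _); apply/seteqP; split=> w /=;
  congr A; apply: eq_from_tnth => i; rewrite !tnth_mktuple addr0//.
Qed.

(** [W] sees the bits [1..l] and [Y] the bits [l + k + 1..n], the two sides of the mixing
    coefficient. The factor 2 converts total variation into L1 distance. *)
Lemma fexp_pattern_decouple (k l : nat) (W Y : (nat -> bool) -> R) (g : R -> R) (M b : R) :
  local 1 l W -> local (l + k + 1) (n - (l + k)) Y -> (forall x, `|g x| <= M) ->
  (mixing_gap X n k l <= b%:E)%E ->
  `|fexp pattern_weight (fun om => g (W (extend om) + Y (extend om))) -
    fexp pattern_weight (fun om =>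
      fexp pattern_weight (fun om' => g (W (extend om) + Y (extend om'))))| <= M * (2 * b).
Proof.
move=> Wl Yl gM gb.
(* The pattern masked to each of the two windows. Bit 0 is masked as well, since [X_0] is not among
   the generators of the sigma-field of [X_1, ..., X_l]. *)
pose c1 (w : T) : bits := [ffun i : 'I_n.+1 => (0 < i <= l)%N && (u < X (Posz i) w)].
pose c2 (t : (n - (l + k)).-tuple R) : bits :=
  [ffun i : 'I_n.+1 => (l + k + 1 <= i)%N && (u < nth 0 t (i - (l + k + 1)))].
pose S := segment X (l + k + 1) (n - (l + k)).
have c2S w : c2 (S w) = [ffun i : 'I_n.+1 => (l + k + 1 <= i)%N && (u < X (Posz i) w)].
  apply/ffunP => i; rewrite 2!ffunE; case: leqP => // li; rewrite !andTb.
  have il : (i - (l + k + 1) < n - (l + k))%N by have := ltn_ord i; lia.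
  have -> : nth 0 (S w) (i - (l + k + 1)) = tnth (S w) (Ordinal il) by rewrite (tnth_nth 0).
  by rewrite tnth_mktuple/= subnKC.
have mc1 a : <<s sigma_gen X 1 l >> (c1 @^-1` [set a]).
  apply: (@measurable_bits_fiber _ (g_sigma_algebraType (sigma_gen X 1 l))) => i.
  case: (boolP (0 < i <= l)%N) => il /=; last first.
    by rewrite (_ : [set w | _] = set0)//; apply/seteqP; split.
  apply: sub_sigma_algebra; exists (i : nat) => //; exists `]u, +oo[%classic => //.
  by rewrite setTI; apply/seteqP; split=> w /=; rewrite in_itv/= andbT.
have mc2 a : measurable (c2 @^-1` [set a]).
  apply: measurable_bits_fiber => i.
  case: (leqP (l + k + 1) i) => li /=; last first.
    by rewrite (_ : [set w | _] = set0)//; apply/seteqP; split.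
  have il : (i - (l + k + 1) < n - (l + k))%N by have := ltn_ord i; lia.
  rewrite (_ : [set w | _] = (@tnth _ R ^~ (Ordinal il)) @^-1` `]u, +oo[); last first.
    by apply/seteqP; split=> w /=; rewrite in_itv/= andbT (tnth_nth 0).
  by rewrite -[X in measurable X]setTI; exact: measurable_tnth.
have mT1 a : measurable (c1 @^-1` [set a]) by exact: g_sigma_gen_measurable (mc1 a).
have mT2 a : measurable ((c2 \o S) @^-1` [set a]).
  rewrite -[X in measurable X]setTI comp_preimage; apply: measurable_segment => //; exact: mc2.
have WE w : W (extend (pattern w)) = W (extend (c1 w)).
  apply: Wl => i /andP[i1 i2]; rewrite /extend; case: ltnP => //= iN.
  by rewrite !ffunE inordK// i1/= -ltnS -add1n i2.
have YE w : Y (extend (pattern w)) = Y (extend (c2 (S w))).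
  apply: Yl => i /andP[i1 i2]; rewrite /extend; case: ltnP => //= iN.
  by rewrite c2S !ffunE inordK// i1.
pose h (a c : bits) := g (W (extend a) + Y (extend c)).
pose cc (w : T) : bits * bits := (c1 w, c2 (S w)).
have ccE a c : cc @^-1` [set (a, c)] = [set w | c1 w = a /\ c2 (S w) = c].
  apply/seteqP; split=> w; last by rewrite /= /cc => -[-> ->].
  by move=> E; split; [exact: (congr1 fst E)|exact: (congr1 snd E)].
have mcc ac : measurable (cc @^-1` [set ac]).
  by case: ac => a c; rewrite ccE; exact: (measurableI _ _ (mT1 a) (mT2 c)).
have E1 : fexp pattern_weight (fun om => g (W (extend om) + Y (extend om))) =
    \sum_a \sum_c prob P [set w | c1 w = a /\ c2 (S w) = c] * h a c.
  apply: EFin_inj; rewrite -integral_pattern.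
  transitivity (\int[P]_w ((fun ac => h ac.1 ac.2) (cc w))%:E)%E.
    by apply: eq_integral => w _; rewrite /h/= -WE -YE.
  rewrite (integral_class mcc P (fun ac => h ac.1 ac.2)) pair_big/=; congr _%:E; apply: eq_bigr => -[a c] _.
  by rewrite ccE.
have E2 : fexp pattern_weight (fun om =>
      fexp pattern_weight (fun om' => g (W (extend om) + Y (extend om')))) =
    \sum_a \sum_c prob P [set w | c1 w = a] * prob P [set w | c2 (S w) = c] * h a c.
  have F1 z : fexp pattern_weight (fun om' => g (z + Y (extend om'))) =
      \sum_c prob P [set w | c2 (S w) = c] * g (z + Y (extend c)).
    apply: EFin_inj; rewrite -integral_pattern.
    transitivity (\int[P]_w ((fun c => g (z + Y (extend c))) ((c2 \o S) w))%:E)%E.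
      by apply: eq_integral => w _; rewrite /= -YE.
    by rewrite (integral_class mT2 P (fun c => g (z + Y (extend c)))).
  under eq_fexp do rewrite F1.
  apply: EFin_inj; rewrite -integral_pattern.
  transitivity (\int[P]_w ((fun a => \sum_c prob P [set w | c2 (S w) = c] * h a c) (c1 w))%:E)%E.
    by apply: eq_integral => w _; rewrite /= WE.
  rewrite (integral_class mT1 P
    (fun a => \sum_c prob P [set w | c2 (S w) = c] * h a c)); congr _%:E; apply: eq_bigr => a _.
  by rewrite mulr_sumr; apply: eq_bigr => c _; rewrite mulrA.
have M0 : 0 <= M by rewrite (le_trans _ (gM 0)).
have := le_trans (mixing_gap_ge mc1 mc2) gb; rewrite lee_fin -/S => sb.
rewrite E1 E2 -sumrB.
apply: (@le_trans _ _ (M * (2 * (2^-1 * \sum_a \sum_c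
     `|prob P [set w | c1 w = a /\ c2 (S w) = c] -
       prob P [set w | c1 w = a] * prob P [set w | c2 (S w) = c]|)))); last first.
  by rewrite ler_wpM2l// ler_pM2l.
rewrite mulVKf// mulr_sumr; apply: le_trans (ler_norm_sum _ _ _) _.
apply: ler_sum => a _; rewrite -sumrB mulr_sumr.
apply: le_trans (ler_norm_sum _ _ _) _; apply: ler_sum => c _.
by rewrite -mulrBl normrM mulrC ler_wpM2r// gM.
Qed.

End pattern.

(** * Central limit theorem for block sums *)

Section block_clt.
(** Weights on bit strings, with the properties of the series as hypotheses: stationarity is
    [pexp_shift], mixing is [decouple], and condition (3) enters through [pair_le], [sum_e_le] and
    [tail_e]. *)
Context {R : realType} (p : forall n, {ffun 'I_n.+1 -> bool} -> R).
Arguments p : clear implicits.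
Variables (v : nat -> R) (s r : nat -> nat) (bt : nat -> R).
Local Notation Om := (fun n => {ffun 'I_n.+1 -> bool}).

Definition pexp (n : nat) (H : (nat -> bool) -> R) : R :=
  fexp (p n) (fun om => H (extend om)).

Hypotheses (p_ge0 : forall n x, 0 <= p n x) (p_sum1 : forall n, \sum_x p n x = 1).
Hypothesis pexp_shift : forall n (H : (nat -> bool) -> R) a len,
  local 0 len H -> (a + len <= n.+1)%N ->
  pexp n (fun x => H (shift_seq a x)) = pexp n H.
Hypothesis bt_ge0 : forall n, 0 <= bt n.
Hypothesis decouple : \forall n \near \oo,
  forall l (W Y : (nat -> bool) -> R) (g : R -> R) (M : R),
  (1 <= l <= n - (s n - 1) - 1)%N -> local 1 l W ->
  local (l + (s n - 1) + 1) (n - (l + (s n - 1))) Y -> (forall x, `|g x| <= M) ->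
  `|fexp (p n) (fun om => g (W (extend om) + Y (extend om))) -
    fexp (p n) (fun om => fexp (p n) (fun om' => g (W (extend om) + Y (extend om'))))|
  <= M * (2 * bt n).

Lemma local_widen (a b len len' : nat) (H : (nat -> bool) -> R) :
  local a len H -> (b <= a)%N -> (a + len <= b + len')%N -> local b len' H.
Proof.
move=> Hl ba al x y xy; apply: Hl => i /andP[ai il]; apply: xy.
by rewrite (leq_trans ba ai) (leq_trans il al).
Qed.

Lemma local_shift (a c len : nat) (H : (nat -> bool) -> R) :
  local c len H -> local (a + c) len (fun x => H (shift_seq a x)).
Proof.
move=> Hl x y xy; apply: Hl => i /andP[ci il]; apply: xy.
by rewrite leq_add2l ci -addnA ltn_add2l.
Qed.

Lemma local_comp (h : R -> R) (a len : nat) (H : (nat -> bool) -> R) :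
  local a len H -> local a len (fun x => h (H x)).
Proof. by move=> Hl x y xy; rewrite (Hl x y xy). Qed.

Lemma local_sum (I : finType) (a len : nat) (H : I -> (nat -> bool) -> R) :
  (forall i, local a len (H i)) -> local a len (fun x => \sum_i H i x).
Proof. by move=> Hl x y xy; apply: eq_bigr => i _; exact: Hl. Qed.

Definition block_sum (n : nat) (H : (nat -> bool) -> R) (a D m : nat) (x : nat -> bool) : R :=
  \sum_(k < m) (H (shift_seq (a + k * D) x) - pexp n H).

(** From the last bit of one window to the first bit of the next the lag is at least [s], as
    decoupling from all earlier windows demands. That [e / w] tends to 0 is Lindeberg's condition
    for bounded variables. *)
Lemma block_sum_clt (H : nat -> (nat -> bool) -> R) (e : nat -> R) (w : nat -> R)
    (a len D m : nat -> nat) (s2 : R) :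
  (forall n, local 0 (len n) (H n)) ->
  (forall n x, `|H n x| <= e n) ->
  (\forall n \near \oo, 0 < w n) ->
  e n / w n @[n --> \oo] --> 0 ->
  (\forall n \near \oo, [/\ (1 <= a n)%N, (1 <= len n)%N, (len n + s n <= (D n).+1)%N,
     (1 <= s n)%N & ((m n).-1 * D n + a n + len n <= n.+1)%N]) ->
  (m n)%:R * bt n @[n --> \oo] --> 0 ->
  (m n)%:R * (pexp n (fun x => H n x ^+ 2) - pexp n (H n) ^+ 2) / w n ^+ 2
    @[n --> \oo] --> s2 ->
  cvg_law p (fun n om => block_sum n (H n) (a n) (D n) (m n) (extend om) / w n) (Num.sqrt s2).
Proof.
move=> Hl He w0 ew0 geom mbt var; apply: cvg_law_smooth => // f f1 f2 M sf.
have [fM fL _] := sf.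
have fM0 y : `|f y| <= M by case: (fM y).
have M0 : 0 <= M by rewrite (le_trans _ (fM0 0)).
have fL0 x y : `|f x - f y| <= M * `|x - y| by case: (fL x y).
have cf : continuous f by exact: continuous_lipschitz fL0.
set kappa := \int[normal_prob 0 1]_z `|z| ^+ 3 : R.
pose mu n := pexp n (H n).
pose vr n := pexp n (fun x => H n x ^+ 2) - mu n ^+ 2.
pose t n := Num.sqrt (vr n) / w n.
have vr0 n : 0 <= vr n by rewrite subr_ge0; exact: fexp_sqr_le.
have e0 n : 0 <= e n by rewrite (le_trans _ (He n (fun=> false))).
(* The error of [lindeberg]: [m * bt] from decoupling, and the cubic terms as [e / w] times the
   total variance, which converges. *)
pose bd n := M * (2 * ((m n)%:R * bt n)) +
  M * (1 + kappa) * (2 * (e n / w n)) * ((m n)%:R * vr n / w n ^+ 2).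
have bd0 : bd n @[n --> \oo] --> 0.
  rewrite (_ : 0 = M * (2 * 0) + M * (1 + kappa) * (2 * 0) * s2); last by ring.
  apply: cvgD; first by apply: cvgMr; apply: cvgMr.
  by apply: cvgM => //; apply: cvgMr; apply: cvgMr.
have rootm n : 0 < w n -> Num.sqrt (m n)%:R * t n = Num.sqrt ((m n)%:R * vr n / w n ^+ 2).
  move=> wn; rewrite (_ : _ / w n ^+ 2 = (Num.sqrt (m n)%:R * t n) ^+ 2).
    by rewrite sqrtr_sqr ger0_norm// !mulr_ge0 ?sqrtr_ge0// invr_ge0 ltW.
  by rewrite exprMn expr_div_n !sqr_sqrtr ?ler0n// mulrA.
pose C := M * \int[normal_prob (0 : R) 1]_z `|z|.
have tail : C * `|Num.sqrt ((m n)%:R * vr n / w n ^+ 2) - Num.sqrt s2| @[n --> \oo] --> 0.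
  rewrite -(mulr0 C); apply: cvgMr; rewrite -(normr0 R); apply: cvg_norm.
  rewrite -(subrr (Num.sqrt s2)); apply: cvgB; last exact: cvg_cst.
  exact: continuous_cvg (@sqrt_continuous R _) var.
suff main : \forall n \near \oo, `|gauss_avg (Num.sqrt s2) f 0 -
   fexp (p n) (fun om => f (block_sum n (H n) (a n) (D n) (m n) (extend om) / w n))|
   <= bd n + C * `|Num.sqrt ((m n)%:R * vr n / w n ^+ 2) - Num.sqrt s2|.
  apply/cvgrPdist_le => eps eps0; near=> n.
  have h1 : `|0 - bd n| <= eps / 2 by near: n; apply: cvgr_dist_le => //; rewrite divr_gt0.
  have h2 : `|0 - C * `|Num.sqrt ((m n)%:R * vr n / w n ^+ 2) - Num.sqrt s2| | <= eps / 2.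
    by near: n; apply: cvgr_dist_le => //; rewrite divr_gt0.
  have h3 : `|gauss_avg (Num.sqrt s2) f 0 -
     fexp (p n) (fun om => f (block_sum n (H n) (a n) (D n) (m n) (extend om) / w n))|
     <= bd n + C * `|Num.sqrt ((m n)%:R * vr n / w n ^+ 2) - Num.sqrt s2|.
    by near: n.
  move: h1 h2 h3; rewrite !sub0r !normrN => h1 h2 h3.
  have := ler_norm (bd n); have := ler_norm (C * `|Num.sqrt ((m n)%:R * vr n / w n ^+ 2) - Num.sqrt s2|).
  lra.
near=> n.
have wn : 0 < w n by near: n.
have [a1 len1 Dl s1 amn] : [/\ (1 <= a n)%N, (1 <= len n)%N, (len n + s n <= (D n).+1)%N,
     (1 <= s n)%N & ((m n).-1 * D n + a n + len n <= n.+1)%N] by near: n.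
have dec : forall l (W Y : (nat -> bool) -> R) (g : R -> R) (M : R),
  (1 <= l <= n - (s n - 1) - 1)%N -> local 1 l W ->
  local (l + (s n - 1) + 1) (n - (l + (s n - 1))) Y -> (forall x, `|g x| <= M) ->
  `|fexp (p n) (fun om => g (W (extend om) + Y (extend om))) -
    fexp (p n) (fun om => fexp (p n) (fun om' => g (W (extend om) + Y (extend om'))))|
  <= M * (2 * bt n) by near: n; exact: decouple.
pose Z k (x : nat -> bool) := (H n (shift_seq (a n + k * D n) x) - mu n) / w n.
have Zl k : local (a n + k * D n) (len n) (Z k).
  have := @local_shift (a n + k * D n) 0 (len n) (H n) (Hl n); rewrite addn0.
  by move=> hl; exact: (@local_comp (fun y => (y - mu n) / w n) _ _ _ hl).
have range k : (k < m n)%N -> (a n + k * D n + len n <= n.+1)%N.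
  move=> km; apply: leq_trans amn; rewrite leq_add2r addnC leq_add2r leq_mul2r.
  by rewrite -ltnS prednK ?km ?orbT// (leq_ltn_trans (leq0n k)).
have shiftE k (h : R -> R) : (k < m n)%N ->
    fexp (p n) (fun om => h (H n (shift_seq (a n + k * D n) (extend om)))) =
    pexp n (fun x => h (H n x)).
  move=> km; exact: (pexp_shift (@local_comp h _ _ _ (Hl n)) (range k km)).
have Zb k x : `|Z k x| <= 2 * (e n / w n).
  rewrite normrM normfV (gtr0_norm wn) mulrA ler_wpM2r ?invr_ge0 ?(ltW wn)//.
  rewrite (le_trans (ler_normB _ _))// mulr_natl mulr2n lerD// /mu.
  by apply: fexp_norm_le => // om.
have Z0 k : (k < m n)%N -> fexp (p n) (fun om => Z k (extend om)) = 0.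
  move=> km; rewrite (shiftE k (fun y => (y - mu n) / w n))// /pexp.
  under eq_fexp do rewrite mulrC.
  by rewrite fexpZ fexpB fexp_cst// subrr mulr0.
have Z2 k : (k < m n)%N -> fexp (p n) (fun om => Z k (extend om) ^+ 2) = t n ^+ 2.
  move=> km; rewrite (shiftE k (fun y => ((y - mu n) / w n) ^+ 2))// /pexp.
  rewrite /t expr_div_n sqr_sqrtr// mulrC -[RHS]/(_ * vr n) /vr.
  under eq_fexp do rewrite expr_div_n mulrC.
  rewrite fexpZ; congr (_ * _).
  under eq_fexp do rewrite sqrrB.
  rewrite fexpD fexpB fexp_cst//.
  under [X in _ - X + _ = _]eq_fexp do rewrite -mulr_natl mulrA mulrC.
  rewrite !fexpZ (_ : fexp (p n) (fun om => H n (extend om)) = mu n)// /pexp; ring.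
have t0 : 0 <= t n by rewrite mulr_ge0 ?sqrtr_ge0// invr_ge0 ltW.
(* The deviation [t] is at most the sup bound [2 * (e n / w n)], so one factor [t] is traded for
   it. *)
have t3 : (m n)%:R * t n ^+ 3 <= (m n)%:R * (2 * (e n / w n) * t n ^+ 2).
  have [m0|mpos] := posnP (m n); first by rewrite m0 !mul0r.
  rewrite ler_wpM2l// exprS ler_wpM2r ?sqr_ge0//.
  rewrite -(@ler_pXn2r _ 2)// ?nnegrE//; last by rewrite mulr_ge0// divr_ge0// ltW.
  rewrite -(Z2 0%N mpos) -[leRHS](fexp_cst (p_sum1 n)); apply: fexp_le => // om.
  rewrite -[leLHS]real_normK ?num_real// lerXn2r// ?nnegrE//.
  by rewrite mulr_ge0// divr_ge0// ltW.
rewrite -(subrKA (gauss_avg (Num.sqrt (m n)%:R * t n) f 0)) (le_trans (ler_normD _ _))//.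
rewrite addrC; apply: lerD; last first.
  by rewrite (rootm n wn) distrC; apply: gauss_avg_dist fL0.
rewrite distrC.
have bsE om : block_sum n (H n) (a n) (D n) (m n) (extend om) / w n =
    \sum_(j < m n) Z j (extend om).
  by rewrite /block_sum mulr_suml.
under eq_fexp do rewrite bsE.
have dk k (g : R -> R) : (k < m n)%N -> (forall x, `|g x| <= M) ->
    `|fexp (p n) (fun om => g (\sum_(j < k) Z j (extend om) + Z k (extend om))) -
      fexp (p n) (fun om => fexp (p n) (fun om' =>
        g (\sum_(j < k) Z j (extend om) + Z k (extend om'))))| <= M * (2 * bt n).
  (* The first window has no past to be decoupled from. *)
  case: k => [|k] km gM.
    under eq_fexp do rewrite big_ord0 add0r.
    under [X in _ - X]eq_fexp do under eq_fexp do rewrite big_ord0 add0r.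
    by rewrite fexp_cst// subrr normr0 mulr_ge0// mulr_ge0.
  pose l := (a n + k * D n + len n - 1)%N.
  apply: (dec l (fun x => \sum_(j < k.+1) Z j x) (Z k.+1)) => //.
  - have := range _ km; rewrite /l mulSn; lia.
  - apply: local_sum => j; apply: local_widen (Zl j) _ _; first by rewrite (leq_trans a1)// leq_addr.
    have : (j * D n <= k * D n)%N by rewrite leq_mul2r -ltnS ltn_ord orbT.
    rewrite /l; lia.
  - apply: local_widen (Zl k.+1) _ _; rewrite /l mulSn; first lia.
    by have := range _ km; rewrite mulSn; lia.
have lb := @lindeberg R _ (p n) (@p_ge0 n) (p_sum1 n) (fun k om => Z k (extend om))
  (m n) f f1 f2 M (2 * (e n / w n)) (t n) (2 * bt n) sf t0
  (fun k om _ => Zb k (extend om)) Z0 Z2 dk.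
apply: le_trans lb _.
rewrite /bd -/kappa.
have kap0 : 0 <= kappa by apply: Rintegral_ge0 => z _; exact: exprn_ge0.
have t2E : t n ^+ 2 = vr n / w n ^+ 2 by rewrite /t expr_div_n sqr_sqrtr.
have -> : (m n)%:R * vr n / w n ^+ 2 = (m n)%:R * t n ^+ 2 by rewrite t2E mulrA.
rewrite mulrDr; apply: lerD; first by rewrite le_eqVlt; apply/orP; left; apply/eqP; ring.
rewrite -!(mulrA M) mulrCA ler_wpM2l// mulrDr.
have -> : (1 + kappa) * (2 * (e n / w n)) * ((m n)%:R * t n ^+ 2) =
  (m n)%:R * (2 * (e n / w n) * t n ^+ 2) +
  kappa * ((m n)%:R * (2 * (e n / w n) * t n ^+ 2)) by ring.
by rewrite lerD2l mulrCA ler_wpM2l.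
Unshelve. all: by end_near. Qed.

(** * Counts and pairs of exceedances *)

Definition count_seq (L : nat) (x : nat -> bool) : R := \sum_(i < L) (x i)%:R.

(** Pairs of exceedances more than [K] apart, indexed by the later one: [i < j - K]. *)
Definition far_pairs (K L : nat) (x : nat -> bool) : R :=
  \sum_(j < L) (x j)%:R * count_seq (j - K) x.

Hypothesis pexp_v : forall n, pexp n (fun x => (x 0%N)%:R) = v n.
Variable e : nat -> nat -> R.
Hypothesis e_ge0 : forall n k, 0 <= e n k.
Hypothesis pair_le : forall n k, (1 <= k <= n)%N ->
  pexp n (fun x => (x 0%N)%:R * (x k)%:R) <= v n * e n k.

Lemma count_seq_ge0 L x : 0 <= count_seq L x.
Proof. by apply: sumr_ge0 => i _; rewrite ler0n. Qed.

Lemma count_seqS L x : count_seq L.+1 x = count_seq L x + (x L)%:R.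
Proof. by rewrite /count_seq big_ord_recr. Qed.

Lemma count_seqD L L' x : count_seq (L + L') x = count_seq L x + count_seq L' (shift_seq L x).
Proof. by rewrite /count_seq big_split_ord. Qed.

Lemma count_seq_le L L' x : (L <= L')%N -> count_seq L x <= count_seq L' x.
Proof. by move=> /subnKC <-; rewrite count_seqD lerDl count_seq_ge0. Qed.

Lemma count_seq_leL L x : count_seq L x <= L%:R.
Proof.
rewrite -[X in X%:R]card_ord -sum1_card natr_sum; apply: ler_sum => i _.
by rewrite lern1 leq_b1.
Qed.

Lemma count_seq_ge1 L (x : nat -> bool) i : (i < L)%N -> x i -> 1 <= count_seq L x.
Proof.
move=> iL xi; rewrite /count_seq (bigD1 (Ordinal iL))//= xi lerDl.
by apply: sumr_ge0 => j _; rewrite ler0n.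
Qed.

Lemma local_count_seq L : local 0 L (count_seq L).
Proof.
by move=> x y xy; rewrite /count_seq; apply: eq_bigr => i _; rewrite xy //= add0n.
Qed.

Lemma count_seq_sqr L x : count_seq L x ^+ 2 = count_seq L x + 2 * far_pairs 0 L x.
Proof.
elim: L => [|L IH]; first by rewrite /far_pairs /count_seq !big_ord0 expr0n mulr0 addr0.
rewrite count_seqS sqrrD IH /far_pairs big_ord_recr/= subn0 -/(far_pairs 0 L x).
have -> : ((x L)%:R : R) ^+ 2 = (x L)%:R by case: (x L); rewrite ?expr1n ?expr0n.
rewrite -mulr_natl; ring.
Qed.

Lemma pexpD n (H G : (nat -> bool) -> R) : pexp n (fun x => H x + G x) = pexp n H + pexp n G.
Proof. exact: fexpD. Qed.

Lemma pexpZ n a (H : (nat -> bool) -> R) : pexp n (fun x => a * H x) = a * pexp n H.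
Proof. exact: fexpZ. Qed.

Lemma pexp_sum n (I : Type) (l : seq I) (Q : pred I) (F : I -> (nat -> bool) -> R) :
  pexp n (fun x => \sum_(i <- l | Q i) F i x) = \sum_(i <- l | Q i) pexp n (F i).
Proof. exact: fexp_sum. Qed.

Lemma pexp_le n (H G : (nat -> bool) -> R) : (forall x, H x <= G x) -> pexp n H <= pexp n G.
Proof. by move=> HG; apply: fexp_le => // om. Qed.

Lemma pexp_ge0 n (H : (nat -> bool) -> R) : (forall x, 0 <= H x) -> 0 <= pexp n H.
Proof. by move=> H0; apply: fexp_ge0 => // om. Qed.

Lemma v_ge0 n : 0 <= v n.
Proof. by rewrite -pexp_v; apply: pexp_ge0 => x; rewrite ler0n. Qed.

Lemma pexp_coord n i : (i <= n)%N -> pexp n (fun x => (x i)%:R) = v n.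
Proof.
move=> ni; rewrite -pexp_v.
have := @pexp_shift n (fun x => (x 0%N)%:R) i 1; rewrite addn1 ltnS ni => <-//.
  by apply: eq_fexp => om; rewrite /shift_seq addn0.
by move=> x y xy; rewrite xy.
Qed.

Lemma pexp_count n L : (L <= n.+1)%N -> pexp n (count_seq L) = L%:R * v n.
Proof.
move=> Ln; rewrite /count_seq pexp_sum (eq_bigr (fun=> v n)); last first.
  by move=> i _; apply: pexp_coord; rewrite -ltnS (leq_trans _ Ln).
by rewrite sumr_const card_ord mulr_natl.
Qed.

Lemma pexp_pair n i j : (i < j <= n)%N ->
  pexp n (fun x => (x i)%:R * (x j)%:R) <= v n * e n (j - i).
Proof.
move=> /andP[ij jn].
apply: le_trans (_ : _ <= pexp n (fun x => (x 0%N)%:R * (x (j - i)%N)%:R)) _; last first.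
  by apply: pair_le; rewrite subn_gt0 ij (leq_trans (leq_subr _ _)).
have := @pexp_shift n (fun x => (x 0%N)%:R * (x (j - i)%N)%:R) i (j - i).+1.
rewrite addnS subnKC ?(ltnW ij)// ltnS jn => <-//; last first.
  by move=> x y xy; rewrite !xy//=.
by apply: pexp_le => x; rewrite /shift_seq addn0 subnKC// ltnW.
Qed.

Lemma sum_ord_rev (f : nat -> R) m j : (m <= j)%N ->
  \sum_(i < m) f (j - i)%N = \sum_((j - m).+1 <= k < j.+1) f k.
Proof.
elim: m => [|m IH] mj; first by rewrite big_ord0 subn0 big_geq.
rewrite big_ord_recr/= IH ?(ltnW mj)//.
have -> : (j - m.+1).+1 = (j - m)%N by lia.
by rewrite [RHS]big_ltn ?ltnS ?leq_subr// addrC.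
Qed.

(** The lags of such pairs run from [K + 1] to at most [L - 1]; the sum is extended to [rr], later
    [r n], where condition (3) controls it. *)
Lemma pexp_far_pairs n K L rr : (L <= n.+1)%N -> (L <= rr)%N ->
  pexp n (far_pairs K L) <= L%:R * v n * \sum_(K.+1 <= k < rr.+1) e n k.
Proof.
move=> Ln Lr; rewrite /far_pairs pexp_sum.
rewrite -mulrA mulr_natl -[in leRHS](card_ord L) -sumr_const; apply: ler_sum => j _.
have jL := ltn_ord j.
rewrite /count_seq.
have -> : pexp n (fun x => (x j)%:R * \sum_(i < j - K) (x i)%:R) =
    \sum_(i < j - K) pexp n (fun x => (x i)%:R * (x j)%:R).
  rewrite -pexp_sum; apply: eq_fexp => om; rewrite mulr_sumr.
  by apply: eq_bigr => i _; rewrite mulrC.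
apply: (@le_trans _ _ (\sum_(i < j - K) v n * e n (j - i))).
  apply: ler_sum => i _; apply: pexp_pair; have := ltn_ord i; lia.
rewrite -mulr_sumr ler_wpM2l ?v_ge0// sum_ord_rev ?leq_subr//.
have [jK|Kj] := leqP j K.
  by rewrite (eqP (_ : (j - K == 0)%N))// subn0 big_geq//; apply: sumr_ge0.
rewrite (_ : j - (j - K) = K)%N; last by lia.
rewrite [leRHS](@big_cat_nat _ _ _ j.+1)//=; try lia.
by rewrite lerDl; apply: sumr_ge0.
Qed.

(** The second moment of a count is linear in [L], uniformly up to [r n]: this makes windows of
    [o(r n)] bits negligible. *)
Lemma pexp_count_sqr n L rr : (L <= n.+1)%N -> (L <= rr)%N ->
  pexp n (fun x => count_seq L x ^+ 2) <= L%:R * v n * (1 + 2 * \sum_(1 <= k < rr.+1) e n k).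
Proof.
move=> Ln Lr; rewrite /pexp; under eq_fexp do rewrite count_seq_sqr.
rewrite fexpD fexpZ -/(pexp n (count_seq L)) -/(pexp n (far_pairs 0 L)) pexp_count//.
by rewrite mulrDr mulr1 lerD2l mulrCA ler_pM2l// pexp_far_pairs.
Qed.

(** * Growth rates of the block lengths *)

Local Notation w := (fun n => Num.sqrt (n%:R * v n)).

Hypothesis nv_oo : n%:R * v n @[n --> \oo] --> +oo.
Hypothesis s_oo : s n @[n --> \oo] --> \oo.
Hypothesis r_gt0 : \forall n \near \oo, (0 < r n)%N.
Hypothesis sr0 : (s n)%:R / (r n)%:R @[n --> \oo] --> (0 : R).
Hypothesis rv0 : (r n)%:R * v n @[n --> \oo] --> 0.
Hypothesis rw0 : (r n)%:R / w n @[n --> \oo] --> 0.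
Hypothesis nrbt0 : n%:R / (r n)%:R * bt n @[n --> \oo] --> 0.
Variable Ce : R.
Hypothesis sum_e_le : \forall n \near \oo, \sum_(1 <= k < (r n).+1) e n k <= Ce.

Lemma cvg_near_eq (f1 f2 : nat -> R) (a : R) : (\forall n \near \oo, f1 n = f2 n) ->
  f1 n @[n --> \oo] --> a -> f2 n @[n --> \oo] --> a.
Proof.
move=> f12 fa; apply: cvg_trans fa; apply: near_eq_cvg.
by near=> n; near: n.
Unshelve. all: by end_near. Qed.

Lemma v_le1 n : v n <= 1.
Proof.
rewrite -pexp_v -[leRHS](fexp_cst (p_sum1 n)); apply: fexp_le => // om.
by rewrite lern1 leq_b1.
Qed.

Lemma near_s_ge K : \forall n \near \oo, (K <= s n)%N.
Proof. have h : \oo [set k | (K <= k)%N] by exists K. exact: (s_oo h). Qed.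

Lemma near_v_gt0 : \forall n \near \oo, 0 < v n.
Proof.
near=> n; have : 0 < n%:R * v n by near: n; move/cvgryPgt : nv_oo; exact.
have n0 : (0 < n)%N by near: n; exists 1%N.
by rewrite pmulr_rgt0// ltr0n.
Unshelve. all: by end_near. Qed.

Lemma near_sr_le (q : R) : 0 < q -> \forall n \near \oo, (s n)%:R <= q * (r n)%:R.
Proof.
move=> q0; near=> n.
have r0 : (0 < r n)%N by near: n.
rewrite -ler_pdivrMr ?ltr0n//.
have : `|0 - (s n)%:R / (r n)%:R| <= q by near: n; apply: cvgr_dist_le.
by rewrite sub0r normrN ger0_norm// divr_ge0.
Unshelve. all: by end_near. Qed.

Lemma near_s_leq (K : nat) : \forall n \near \oo, (K * s n <= r n)%N.
Proof.
have K0 : 0 < (K.+1%:R : R)^-1 by rewrite invr_gt0 ltr0n.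
near=> n.
have : (s n)%:R <= K.+1%:R^-1 * (r n)%:R :> R by near: n; exact: near_sr_le.
rewrite mulrC ler_pdivlMr ?ltr0n// -natrM ler_nat; nia.
Unshelve. all: by end_near. Qed.

Lemma w_le n : w n <= n%:R.
Proof.
rewrite -(ler_pXn2r (ltn0Sn 1)) ?nnegrE ?sqrtr_ge0// sqr_sqrtr ?mulr_ge0 ?v_ge0//.
case: n => [|n]; first by rewrite !mul0r expr0n.
by rewrite expr2 ler_wpM2l// (le_trans (v_le1 _))// ler1n.
Qed.

Lemma w_gt0 : \forall n \near \oo, 0 < w n.
Proof.
near=> n; rewrite sqrtr_gt0 mulr_gt0//; last by near: n; exact: near_v_gt0.
by rewrite ltr0n; near: n; exists 1%N.
Unshelve. all: by end_near. Qed.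

(** Since [v <= 1], [w n <= n], so [r / n] is below [r / w]. *)
Lemma rn0 : (r n)%:R / n%:R @[n --> \oo] --> (0 : R).
Proof.
apply: cvg0_le rw0; near=> n.
have wn : 0 < w n by near: n; exact: w_gt0.
rewrite divr_ge0// ler_wpM2l// lef_pV2 ?posrE ?w_le//.
exact: lt_le_trans wn (w_le n).
Unshelve. all: by end_near. Qed.

Lemma near_r_leq (K : nat) : \forall n \near \oo, (K * r n <= n)%N.
Proof.
have K0 : 0 < (K.+1%:R : R)^-1 by rewrite invr_gt0 ltr0n.
near=> n.
have n0 : (0 < n)%N by near: n; exists 1%N.
have : `|0 - (r n)%:R / n%:R| <= K.+1%:R^-1 :> R.
  by near: n; apply: cvgr_dist_le => //; exact: rn0.
rewrite sub0r normrN ger0_norm ?divr_ge0// ler_pdivrMr ?ltr0n//.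
rewrite mulrC ler_pdivlMr ?ltr0n// -natrM ler_nat; nia.
Unshelve. all: by end_near. Qed.

Lemma rvw0 : (r n)%:R * v n / w n @[n --> \oo] --> 0.
Proof.
apply: cvg0_le rw0; near=> n.
have wn : 0 < w n by near: n; exact: w_gt0.
rewrite mulr_ge0 ?invr_ge0 ?(ltW wn) ?mulr_ge0 ?v_ge0//=.
by rewrite ler_wpM2r ?invr_ge0 ?(ltW wn)// ler_piMr// v_le1.
Unshelve. all: by end_near. Qed.

(* A big block consists of [nb_small] blocks of length [s], the last two of which are left
   out to separate it from the next one; [nb_blocks] counts all the blocks of length [s]. *)
Definition nb_small n : nat := (r n %/ s n)%N.
Definition nb_blocks n : nat := (n %/ s n - 1)%N.
Definition nb_big n : nat := (nb_blocks n %/ nb_small n)%N.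

(** The [3 r] covers less than one big block and fewer than [2 s] bits lost at the end. As
    [nb_blocks] is one less than [n / s], every block has a successor in the sample, which its
    contribution may read. *)
Definition geometry n := [/\ (1 <= s n)%N,
  (4 <= nb_small n)%N,
  (r n < nb_small n * s n + s n)%N /\ (nb_small n * s n <= r n)%N,
  ((nb_blocks n + 1) * s n <= n)%N &
  (n <= nb_big n * (nb_small n * s n) + 3 * r n)%N].

Lemma near_geometry : \forall n \near \oo, geometry n.
Proof.
near=> n.
have s1 : (1 <= s n)%N by near: n; exact: near_s_ge.
have s4 : (4 * s n <= r n)%N by near: n; exact: near_s_leq.
have r4 : (4 * r n <= n)%N by near: n; exact: near_r_leq.
have g4 : (4 <= nb_small n)%N by rewrite /nb_small leq_divRL.
have nE := divn_eq n (s n); have nlt := ltn_pmod n s1.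
have rE := divn_eq (r n) (s n); have rlt := ltn_pmod (r n) s1.
have BE := divn_eq (nb_blocks n) (nb_small n).
have g0 : (0 < nb_small n)%N by lia.
have Blt := ltn_pmod (nb_blocks n) g0.
have ns : (1 <= n %/ s n)%N by rewrite divn_gt0//; nia.
have BnE : (nb_blocks n + 1 = n %/ s n)%N by rewrite /nb_blocks; lia.
split=> //.
- by rewrite /nb_small; lia.
- by rewrite BnE leq_divM.
- rewrite -/(nb_big n) in BE; rewrite -/(nb_small n) in rE.
  rewrite -BnE in nE; nia.
Unshelve. all: by end_near. Qed.

Lemma mr_cvg1 : (nb_big n)%:R * (r n)%:R / n%:R @[n --> \oo] --> (1 : R).
Proof.
(* [3 r / n] accounts for the end of the sample and [2 s / r] for the rounding of [r] to a multiple
   of [s], where the 2 is the a priori bound [y2] on the ratio. *)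
have lim0 : 3 * ((r n)%:R / n%:R) + 2 * ((s n)%:R / (r n)%:R) @[n --> \oo] --> (0 : R).
  rewrite (_ : 0 = 3 * 0 + 2 * 0); last by ring.
  by apply: cvgD; apply: cvgMr => //; exact: rn0.
apply/cvgrPdist_le => q q0; near=> n.
have n0 : 0 < (n%:R : R) by rewrite ltr0n; near: n; exists 1%N.
have r0 : 0 < ((r n)%:R : R) by rewrite ltr0n; near: n.
have [s1 g4 [rg gr] Bn nm] : geometry n by near: n; exact: near_geometry.
have mgn : (nb_big n * (nb_small n * s n) <= n)%N.
  rewrite mulnA (leq_trans _ Bn)// leq_mul2r (leq_trans (leq_divM _ _)) ?orbT//.
  by rewrite leq_addr.
have : `|0 - (3 * ((r n)%:R / n%:R) + 2 * ((s n)%:R / (r n)%:R))| <= q :> R.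
  by near: n; exact: cvgr_dist_le lim0 _ q0.
rewrite sub0r normrN => h0; have h := le_trans (ler_norm _) h0 => {h0}.
have s2 : (s n)%:R <= 2^-1 * (r n)%:R :> R by near: n; apply: near_sr_le.
set y := (nb_big n)%:R * (r n)%:R / n%:R.
have yE : y * n%:R = (nb_big n)%:R * (r n)%:R by rewrite /y divfK// gt_eqF.
have lo : 1 - 3 * ((r n)%:R / n%:R) <= y.
  rewrite -(ler_pM2r n0) yE mulrBl mul1r -!mulrA mulVf ?gt_eqF// mulr1 lerBlDr.
  rewrite -!natrM -natrD ler_nat; nia.
have h1 : (nb_big n)%:R * ((r n)%:R - (s n)%:R) <= n%:R :> R.
  apply: le_trans (_ : _ <= (nb_big n * (nb_small n * s n))%:R) _; last by rewrite ler_nat.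
  rewrite natrM ler_wpM2l// lerBlDr -natrD ler_nat ltnW//.
have h2 : y * (1 - (s n)%:R / (r n)%:R) <= 1.
  rewrite -(ler_pM2r n0) mul1r mulrAC yE mulrBr mulr1.
  by rewrite -mulrA (mulrCA (r n)%:R) mulfV ?gt_eqF// mulr1 -mulrBr.
have z2 : (s n)%:R / (r n)%:R <= 2^-1 :> R by rewrite ler_pdivrMr.
have z0 : 0 <= (s n)%:R / (r n)%:R :> R by rewrite divr_ge0.
have y0 : 0 <= y by rewrite /y !mulr_ge0// invr_ge0.
have y2 : y <= 2 by nra.
have x0 : 0 <= (r n)%:R / n%:R :> R by rewrite divr_ge0.
move: h2 h lo z0 x0; set z := _ / (r n)%:R; set x := (r n)%:R / _ => h2 h lo z0 x0.
have yz : y * z <= 2 * z by rewrite ler_wpM2r.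
by rewrite mulrBr mulr1 in h2; rewrite ler_norml; apply/andP; split; lra.
Unshelve. all: by end_near. Qed.

Lemma big_bt0 : (nb_big n)%:R * bt n @[n --> \oo] --> 0.
Proof.
rewrite -(mulr0 1); apply: cvg_near_eq (cvgM mr_cvg1 nrbt0).
near=> n.
have n0 : (n%:R : R) != 0 by rewrite pnatr_eq0 -lt0n; near: n; exists 1%N.
have r0 : ((r n)%:R : R) != 0 by rewrite pnatr_eq0 -lt0n; near: n.
by rewrite /=; field; rewrite n0 r0.
Unshelve. all: by end_near. Qed.

Lemma shift_seqD a b x : shift_seq b (shift_seq a x) = shift_seq (a + b) x.
Proof. by apply/funext => i; rewrite /shift_seq addnA. Qed.

Lemma count_seq_local_le L (F : (nat -> bool) -> R) C n a :
  (forall x, `|F x| <= C * count_seq L x) -> 0 <= C -> (a + L <= n.+1)%N ->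
  pexp n (fun x => `|F (shift_seq a x)|) <= C * (L%:R * v n).
Proof.
move=> FC C0 aL; have Ln : (L <= n.+1)%N by rewrite (leq_trans _ aL)// leq_addl.
apply: (@le_trans _ _ (pexp n (fun x => C * count_seq L (shift_seq a x)))).
  by apply: pexp_le => y; exact: FC.
by rewrite pexpZ (pexp_shift (@local_count_seq L) aL) pexp_count.
Qed.

Lemma sum_ord_mul (f : nat -> R) m g :
  \sum_(b < m * g) f b = \sum_(k < m) \sum_(j < g) f (k * g + j)%N.
Proof.
elim: m => [|m IH]; first by rewrite mul0n !big_ord0.
by rewrite mulSnr big_split_ord /= IH big_ord_recr.
Qed.

Lemma sum_ord_blocks (f : nat -> R) B g : (2 <= g)%N ->
  \sum_(b < B) f b = \sum_(k < B %/ g) \sum_(j < g - 2) f (k * g + j)%N +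
    \sum_(k < B %/ g) (f (k * g + (g - 2))%N + f (k * g + (g - 2)).+1) +
    \sum_(j < B %% g) f (B %/ g * g + j)%N.
Proof.
move=> g2; rewrite -[LHS](big_mkord xpredT) [in LHS](divn_eq B g) big_mkord.
rewrite big_split_ord/=; congr (_ + _).
rewrite sum_ord_mul -big_split; apply: eq_bigr => k _ /=.
move: g2; case: g k => [|[|q]] // k _.
by rewrite !big_ord_recr subn2/= -addrA addnS.
Qed.

(** Each bit lies in at most two of the overlapping windows of length [2 * s0], whence [2 * C]. *)
Lemma sum_shift_le (eta : (nat -> bool) -> R) C s0 q x :
  (forall x, `|eta x| <= C * count_seq (2 * s0) x) -> 0 <= C ->
  `|\sum_(b < q) eta (shift_seq (b * s0) x)| <= 2 * C * count_seq (q.+1 * s0) x.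
Proof.
move=> etaC C0; rewrite (le_trans (ler_norm_sum _ _ _))//.
apply: (@le_trans _ _ (\sum_(b < q) C * (count_seq s0 (shift_seq (b * s0) x) +
   count_seq s0 (shift_seq (b.+1 * s0) x)))).
  apply: ler_sum => b _; rewrite (le_trans (etaC _))// ler_wpM2l//.
  by rewrite mul2n -addnn count_seqD shift_seqD mulSnr.
rewrite -mulr_sumr (mulrC 2) -mulrA ler_wpM2l// big_split/=.
have sumE q' y : \sum_(b < q') count_seq s0 (shift_seq (b * s0) y) = count_seq (q' * s0) y.
  by rewrite /count_seq (sum_ord_mul (fun i => (y i)%:R)).
rewrite sumE mulr_natl mulr2n lerD ?count_seq_le ?leq_mul2r ?leqnSn ?orbT//.
rewrite -[leRHS]sumE big_ord_recl/= lerDr; exact: count_seq_ge0.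
Qed.

Section block_sums_clt.
(** [eta] is the contribution of one block, allowed to read the next block too (hence [2 * s n]) and
    controlled by the exceedances it sees. The variance hypothesis [var] concerns the retained
    blocks of a single group. *)
Variables (eta : nat -> (nat -> bool) -> R) (C s2 : R).
Hypothesis C_ge0 : 0 <= C.
Hypothesis eta_local : forall n, local 0 (2 * s n) (eta n).
Hypothesis eta_le : forall n x, `|eta n x| <= C * count_seq (2 * s n) x.

Let big_block n x := \sum_(b < nb_small n - 2) eta n (shift_seq (b * s n) x).
Let small_block n x := \sum_(b < 2) eta n (shift_seq (b * s n) x).

Lemma local_shift_sum q n : (1 <= q)%N ->
  local 0 (q.+1 * s n) (fun x => \sum_(b < q) eta n (shift_seq (b * s n) x)).
Proof.
move=> q1; apply: local_sum => b; have := @local_shift (b * s n) 0 _ _ (@eta_local n).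
by move=> h; apply: local_widen h _ _ => //; have := ltn_ord b; nia.
Qed.

Hypothesis var : pexp n (fun x => big_block n x ^+ 2) / ((r n)%:R * v n)
  @[n --> \oo] --> s2.

Lemma near_shift_sum_var q : (1 <= q)%N -> \forall n \near \oo,
  pexp n (fun x => (\sum_(b < q) eta n (shift_seq (b * s n) x)) ^+ 2) <=
  (2 * C) ^+ 2 * ((q.+1 * s n)%:R * v n * (1 + 2 * Ce)).
Proof.
move=> q1; near=> n.
have sr : (q.+1 * s n <= r n)%N by near: n; exact: near_s_leq.
have rn : (1 * r n <= n)%N by near: n; exact: near_r_leq.
apply: (@le_trans _ _ (pexp n (fun x => (2 * C) ^+ 2 * count_seq (q.+1 * s n) x ^+ 2))).
  apply: pexp_le => x; rewrite -exprMn -[leLHS]real_normK ?num_real//.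
  rewrite lerXn2r ?nnegrE// ?mulr_ge0 ?count_seq_ge0//.
  exact: sum_shift_le (eta_le n) C_ge0.
rewrite pexpZ ler_wpM2l ?sqr_ge0//.
apply: le_trans (@pexp_count_sqr n (q.+1 * s n) (r n) _ sr) _; first by lia.
rewrite ler_wpM2l ?mulr_ge0 ?v_ge0// lerD2l ler_wpM2l//.
by near: n; exact: sum_e_le.
Unshelve. all: by end_near. Qed.

Lemma big_blocks_clt : cvg_law p (fun n om => block_sum n (big_block n) 1
  (nb_small n * s n) (nb_big n) (extend om) / w n) (Num.sqrt s2).
Proof.
(* Centring costs nothing: the squared mean is of order [(r v)^2], which is [o(r v)]. *)
have mean0 : pexp n (big_block n) ^+ 2 / ((r n)%:R * v n) @[n --> \oo] --> 0.
  have lim0 : (2 * C) ^+ 2 * ((r n)%:R * v n) @[n --> \oo] --> 0.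
    by rewrite -(mulr0 ((2 * C) ^+ 2)); apply: cvgMr; exact: rv0.
  apply: cvg0_le lim0; near=> n.
  have rn : (1 * r n <= n)%N by near: n; exact: near_r_leq.
  have [s1 g4 [rg gr] Bn nm] : geometry n by near: n; exact: near_geometry.
  have v0 : 0 < v n by near: n; exact: near_v_gt0.
  have r0 : 0 < (r n)%:R :> R by rewrite ltr0n; lia.
  rewrite divr_ge0 ?sqr_ge0 ?mulr_ge0 ?(ltW v0)//= ler_pdivrMr ?mulr_gt0//.
  rewrite -mulrA -expr2 -exprMn -[leLHS]real_normK ?num_real//.
  rewrite lerXn2r ?nnegrE ?mulr_ge0 ?(ltW v0)//.
  rewrite (le_trans (fexp_norm (@p_ge0 n) _))//.
  apply: (@le_trans _ _ (pexp n (fun x => 2 * C * count_seq (r n) x))); last first.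
    by rewrite pexpZ pexp_count//; lia.
  apply: (@pexp_le n (fun x => `|big_block n x|)) => x.
  apply: le_trans (@sum_shift_le _ C (s n) _ x (eta_le n) C_ge0) _.
  by rewrite ler_wpM2l ?mulr_ge0// count_seq_le//; nia.
(* Windows start at bit 1, as the mixing coefficients do. They span one block more than they have
   contributions, since the last contribution reads the following block. *)
apply: (@block_sum_clt big_block (fun n => 2 * C * (r n)%:R) w (fun=> 1%N)
  (fun n => maxn 1 ((nb_small n - 2).+1 * s n)) (fun n => (nb_small n * s n)%N) nb_big).
- move=> n; rewrite /big_block.
  have [g2|g2] := posnP (nb_small n - 2)%N; first by move=> x y xy; rewrite g2 !big_ord0.
  apply: local_widen (@local_shift_sum _ n g2) _ _ => //.
  by rewrite !add0n leq_maxr.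
- move=> n x; rewrite /big_block.
  have [g2|g2] := posnP (nb_small n - 2)%N.
    by rewrite g2 big_ord0 normr0 !mulr_ge0.
  rewrite (le_trans (@sum_shift_le _ C (s n) _ x (eta_le n) C_ge0))//.
  rewrite ler_wpM2l ?mulr_ge0// (le_trans (count_seq_leL _ _))// ler_nat.
  apply: leq_trans (leq_divM (r n) (s n)); rewrite -/(nb_small n) leq_mul2r; lia.
- exact: w_gt0.
- under eq_fun do rewrite -mulrA.
  by rewrite -(mulr0 (2 * C)); apply: cvgMr.
- near=> n.
  have [s1 g4 [rg gr] Bn nm] : geometry n by near: n; exact: near_geometry.
  have mgB : (nb_big n * nb_small n <= nb_blocks n)%N by exact: leq_divM.
  have rn : (1 * r n <= n)%N by near: n; exact: near_r_leq.
  have mgs : (nb_big n * (nb_small n * s n) <= n)%N.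
    by rewrite mulnA (leq_trans _ Bn)// leq_mul2r (leq_trans mgB) ?leq_addr ?orbT.
  have gs : ((nb_small n - 2).+1 * s n + s n = nb_small n * s n)%N.
    by rewrite -mulSnr; congr muln; lia.
  have len0 : (1 <= (nb_small n - 2).+1 * s n)%N by rewrite muln_gt0 s1.
  rewrite (maxn_idPr len0); split=> //; first by rewrite gs leqnSn.
  have [m0|m0] := posnP (nb_big n); first by rewrite m0 mul0n; lia.
  by rewrite -(prednK m0) mulSnr in mgs; lia.
- exact: big_bt0.
rewrite (_ : s2 = 1 * (s2 - 0)); last by rewrite subr0 mul1r.
apply: cvg_near_eq (cvgM mr_cvg1 (cvgB var mean0)); near=> n => /=.
have v0 : 0 < v n by near: n; exact: near_v_gt0.
have r0 : 0 < (r n)%:R :> R by rewrite ltr0n; near: n.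
have n0 : 0 < n%:R :> R by rewrite ltr0n; near: n; exists 1%N.
rewrite sqr_sqrtr ?mulr_ge0 ?(ltW v0)// !fctE; field.
by rewrite !gt_eqF.
Unshelve. all: by end_near. Qed.

(** The omitted pairs form a sum of the same kind, with windows of [3 s] bits. Its variance is of
    order [s / r], so the central limit theorem holds with deviation 0, which is convergence in
    probability. *)
Lemma small_blocks_negl : asymp_negl p (fun n om => block_sum n (small_block n)
  (1 + (nb_small n - 2) * s n) (nb_small n * s n) (nb_big n) (extend om) / w n).
Proof.
apply: cvg_law0_negl => //; rewrite -(@sqrtr0 R).
apply: (@block_sum_clt small_block (fun n => 2 * C * (3 * (s n)%:R)) w
  (fun n => (1 + (nb_small n - 2) * s n)%N)
  (fun n => maxn 1 (3 * s n)) (fun n => (nb_small n * s n)%N) nb_big).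
- move=> n; apply: local_widen (@local_shift_sum 2 n isT) _ _ => //.
  by rewrite !add0n leq_maxr.
- move=> n x.
  rewrite (le_trans (@sum_shift_le _ C (s n) _ x (eta_le n) C_ge0))//.
  by rewrite ler_wpM2l ?mulr_ge0// -natrM count_seq_leL.
- exact: w_gt0.
- have lim0 : 2 * C * ((r n)%:R / w n) @[n --> \oo] --> 0.
    by rewrite -(mulr0 (2 * C)); apply: cvgMr.
  apply: cvg0_le lim0; near=> n.
  have wn : 0 < w n by near: n; exact: w_gt0.
  have sr : (3 * s n <= r n)%N by near: n; exact: near_s_leq.
  rewrite divr_ge0 ?(ltW wn) ?mulr_ge0//= -mulrA ler_wpM2l ?mulr_ge0//.
  by rewrite ler_wpM2r ?invr_ge0 ?(ltW wn)// -natrM ler_nat.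
- near=> n.
  have [s1 g4 [rg gr] Bn nm] : geometry n by near: n; exact: near_geometry.
  have rn : (4 * r n <= n)%N by near: n; exact: near_r_leq.
  have mgB : (nb_big n * nb_small n <= nb_blocks n)%N by exact: leq_divM.
  have mgs : ((nb_big n * (nb_small n * s n)) + s n <= n)%N.
    rewrite mulnA -mulSnr (leq_trans _ Bn)// leq_mul2r addn1 ltnS mgB orbT//.
  have gs : ((nb_small n - 2) * s n + 2 * s n = nb_small n * s n)%N.
    by rewrite -mulnDl subnK//; lia.
  have g4s : (4 * s n <= nb_small n * s n)%N by rewrite leq_mul2r g4 orbT.
  have len0 : (1 <= 3 * s n)%N by rewrite muln_gt0.
  rewrite (maxn_idPr len0); split=> //; first by lia.
  have [m0|m0] := posnP (nb_big n); first by rewrite m0 mul0n; lia.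
  by rewrite -(prednK m0) mulSnr in mgs; lia.
- exact: big_bt0.
have lim0 : (2 * C) ^+ 2 * 3 * (1 + 2 * Ce) *
    ((nb_big n)%:R * (r n)%:R / n%:R * ((s n)%:R / (r n)%:R)) @[n --> \oo] --> 0.
  rewrite (_ : 0 = (2 * C) ^+ 2 * 3 * (1 + 2 * Ce) * (1 * 0)); last by rewrite !mulr0.
  by apply: cvgMr; apply: cvgM => //; exact: mr_cvg1.
apply: cvg0_le lim0; near=> n.
have v0 : 0 < v n by near: n; exact: near_v_gt0.
have r0 : 0 < (r n)%:R :> R by rewrite ltr0n; near: n.
have n0 : 0 < n%:R :> R by rewrite ltr0n; near: n; exists 1%N.
have w2 : w n ^+ 2 = n%:R * v n by rewrite sqr_sqrtr ?mulr_ge0 ?(ltW v0).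
rewrite w2 divr_ge0 ?mulr_ge0 ?(ltW v0)//=; last by rewrite subr_ge0 fexp_sqr_le.
rewrite ler_pdivrMr ?mulr_gt0//.
apply: (@le_trans _ _ ((nb_big n)%:R * ((2 * C) ^+ 2 * ((3 * s n)%:R * v n * (1 + 2 * Ce))))).
  rewrite ler_wpM2l// lerBlDr ler_wpDr ?sqr_ge0//.
  by near: n; exact: near_shift_sum_var.
rewrite natrM le_eqVlt; apply/orP; left; apply/eqP; field.
by rewrite !gt_eqF.
Unshelve. all: by end_near. Qed.

Let rest n x := \sum_(j < nb_blocks n %% nb_small n)
  (eta n (shift_seq (1 + (nb_big n * nb_small n + j) * s n) x) - pexp n (eta n)).

Lemma pexp_dev_le n a : (a + 2 * s n <= n.+1)%N ->
  pexp n (fun x => `|eta n (shift_seq a x) - pexp n (eta n)|) <= 4 * C * ((s n)%:R * v n).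
Proof.
move=> an.
have mu_le : `|pexp n (eta n)| <= C * ((2 * s n)%:R * v n).
  apply: le_trans (fexp_norm (@p_ge0 n) _) _.
  have an0 : (0 + 2 * s n <= n.+1)%N by rewrite add0n (leq_trans _ an)// leq_addl.
  have := @count_seq_local_le (2 * s n) _ C n 0 (eta_le n) C_ge0 an0.
  by rewrite /pexp; exact.
apply: (@le_trans _ _ (pexp n (fun x => `|eta n (shift_seq a x)| + `|pexp n (eta n)|))).
  by apply: pexp_le => x; exact: ler_normB.
rewrite pexpD [X in _ + X](_ : _ = `|pexp n (eta n)|); last exact: fexp_cst.
have := @count_seq_local_le (2 * s n) _ C n a (eta_le n) C_ge0 an.
rewrite !natrM in mu_le * => h.
rewrite (_ : 4 * C * _ = C * (2 * (s n)%:R * v n) + C * (2 * (s n)%:R * v n)); last by ring.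
exact: lerD.
Qed.

(** Fewer than [nb_small] blocks follow the last group: their L1 norm is of order [r v], which is
    [o(w)]. *)
Lemma rest_negl : asymp_negl p (fun n om => rest n (extend om) / w n).
Proof.
apply: asymp_negl_L1 => //.
have lim0 : 4 * C * ((r n)%:R * v n / w n) @[n --> \oo] --> 0.
  by rewrite -(mulr0 (4 * C)); apply: cvgMr; exact: rvw0.
apply: cvg0_le lim0; near=> n.
have wn : 0 < w n by near: n; exact: w_gt0.
have rn : (1 * r n <= n)%N by near: n; exact: near_r_leq.
have [s1 g4 [rg gr] Bn nm] : geometry n by near: n; exact: near_geometry.
rewrite fexp_ge0//=.
have g0 : (0 < nb_small n)%N by lia.
have jg : (nb_blocks n %% nb_small n <= nb_small n)%N by rewrite ltnW// ltn_pmod.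
apply: (@le_trans _ _ ((w n)^-1 * \sum_(j < nb_blocks n %% nb_small n) 4 * C * ((s n)%:R * v n))).
  rewrite /rest; under eq_fexp do rewrite normrM mulrC normfV (gtr0_norm wn).
  rewrite fexpZ ler_wpM2l ?invr_ge0 ?(ltW wn)//.
  apply: (@le_trans _ _ (\sum_(j < nb_blocks n %% nb_small n)
    pexp n (fun x => `|eta n (shift_seq (1 + (nb_big n * nb_small n + j) * s n) x) - pexp n (eta n)|))).
    rewrite -pexp_sum.
    apply: (@pexp_le n (fun x => `|rest n x|)) => x; exact: ler_norm_sum.
  apply: ler_sum => j _; apply: pexp_dev_le.
  have : ((nb_big n * nb_small n + j).+1 <= nb_blocks n)%N.
    by rewrite {2}(divn_eq (nb_blocks n) (nb_small n)) ltn_add2l.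
  by move: (_ + j)%N => q; nia.
rewrite [leRHS](_ : _ = (w n)^-1 * (4 * C * ((r n)%:R * v n))); last by rewrite [RHS]mulrC -!mulrA.
rewrite ler_wpM2l ?invr_ge0 ?(ltW wn)// sumr_const card_ord.
rewrite -[leLHS]mulr_natl mulrCA ler_wpM2l ?mulr_ge0// mulrA ler_wpM2r ?v_ge0//.
rewrite -natrM ler_nat (leq_trans _ gr)// leq_mul2r jg orbT//.
Unshelve. all: by end_near. Qed.

Lemma shift_sum_centered n q A x : (q.+1 * s n <= n.+1)%N ->
  \sum_(b < q) eta n (shift_seq (b * s n) (shift_seq A x)) -
    pexp n (fun y => \sum_(b < q) eta n (shift_seq (b * s n) y)) =
  \sum_(b < q) (eta n (shift_seq (A + b * s n) x) - pexp n (eta n)).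
Proof.
move=> qs; rewrite pexp_sum -sumrB; apply: eq_bigr => b _.
rewrite shift_seqD (pexp_shift (@eta_local n))//.
by have := ltn_ord b; nia.
Qed.

Lemma small_blocks_clt : cvg_law p (fun n om => block_sum n (eta n) 1
  (s n) (nb_blocks n) (extend om) / w n) (Num.sqrt s2).
Proof.
apply: (cvg_law_transfer _ _ big_blocks_clt) => //.
have negl := asymp_neglD p_ge0 small_blocks_negl rest_negl.
apply: asymp_negl_le negl => //; near=> n => om.
have [s1 g4 _ _ _] : geometry n by near: n; exact: near_geometry.
have g2 : (2 <= nb_small n)%N by lia.
have gr : ((nb_small n - 2).+1 * s n <= r n)%N.
  rewrite (leq_trans _ (leq_divM (r n) (s n)))// leq_mul2r -/(nb_small n).
  by apply/orP; right; lia.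
have rn : (1 * r n <= n)%N by near: n; exact: near_r_leq.
have sr : (3 * s n <= r n)%N by near: n; exact: near_s_leq.
rewrite le_eqVlt; apply/orP; left; apply/eqP; congr `|_|.
rewrite -mulrDl -mulrBl; congr (_ / _); set x := extend om.
rewrite /block_sum (sum_ord_blocks (fun b => eta n (shift_seq (1 + b * s n) x) - pexp n (eta n)) _ g2).
rewrite -/(nb_big n).
set t1 := (X in X + _ + _ - _); set t2 := (X in t1 + X + _ - _); set t3 := (X in _ + X - _).
have -> : t1 = \sum_(k < nb_big n)
   (big_block n (shift_seq (1 + k * (nb_small n * s n)) x) - pexp n (big_block n)).
  rewrite /t1; apply: eq_bigr => k _; rewrite shift_sum_centered; last by lia.
  by apply: eq_bigr => j _; rewrite mulnDl addnA mulnA.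
have -> : t2 = \sum_(k < nb_big n)
   (small_block n (shift_seq (1 + (nb_small n - 2) * s n + k * (nb_small n * s n)) x) - pexp n (small_block n)).
  rewrite /t2; apply: eq_bigr => k _; rewrite shift_sum_centered; last by lia.
  rewrite !big_ord_recl big_ord0 addr0/=.
  by congr (eta n (shift_seq _ x) - _ + (eta n (shift_seq _ x) - _)); rewrite /bump/=; nia.
by apply/eqP; rewrite subr_eq -addrA addrC.
Unshelve. all: by end_near. Qed.
End block_sums_clt.

(** * Variance of a block *)

Hypothesis tail_e : forall q : R, 0 < q -> exists K,
  \forall n \near \oo, \sum_(K.+1 <= k < (r n).+1) e n k <= q.
Variable c : R.
Hypothesis count_var : pexp n (fun x => count_seq (r n) x ^+ 2) / ((r n)%:R * v n)
  @[n --> \oo] --> c.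

Lemma near_rv_gt0 : \forall n \near \oo, 0 < (r n)%:R * v n.
Proof.
near=> n; rewrite mulr_gt0//; last by near: n; exact: near_v_gt0.
by rewrite ltr0n; near: n.
Unshelve. all: by end_near. Qed.

(** [H^2 - G^2 = (H - G)^2 + 2 G (H - G)] and Cauchy-Schwarz. *)
Lemma l2_transfer (H G : nat -> (nat -> bool) -> R) (a : R) :
  pexp n (fun x => (H n x - G n x) ^+ 2) / ((r n)%:R * v n) @[n --> \oo] --> 0 ->
  pexp n (fun x => G n x ^+ 2) / ((r n)%:R * v n) @[n --> \oo] --> a ->
  pexp n (fun x => H n x ^+ 2) / ((r n)%:R * v n) @[n --> \oo] --> a.
Proof.
move=> HG0 Ga; rewrite -[X in _ --> X]add0r.
suff : pexp n (fun x => H n x ^+ 2) / ((r n)%:R * v n) -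
    pexp n (fun x => G n x ^+ 2) / ((r n)%:R * v n) @[n --> \oo] --> 0.
  move=> h; apply: cvg_near_eq (cvgD h Ga); near=> n => /=.
  by rewrite subrK.
apply: norm_cvg0 => /=.
set d := fun n => pexp n (fun x => (H n x - G n x) ^+ 2) / ((r n)%:R * v n).
set g := fun n => pexp n (fun x => G n x ^+ 2) / ((r n)%:R * v n).
have lim0 : d n + 2 * Num.sqrt (g n * d n) @[n --> \oo] --> 0.
  rewrite (_ : 0 = 0 + 2 * Num.sqrt (a * 0)); last by rewrite mulr0 sqrtr0 mulr0 addr0.
  apply: cvgD => //; apply: cvgMr.
  by apply: continuous_cvg; [exact: sqrt_continuous|exact: cvgM].
apply: cvg0_le lim0; near=> n.
have rv : 0 < (r n)%:R * v n by near: n; exact: near_rv_gt0.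
rewrite normr_ge0/= -mulrBl.
have -> : pexp n (fun x => H n x ^+ 2) - pexp n (fun x => G n x ^+ 2) =
  pexp n (fun x => (H n x - G n x) ^+ 2) + 2 * pexp n (fun x => G n x * (H n x - G n x)).
  rewrite -pexpZ -pexpD /pexp -fexpB; apply: eq_fexp => om; ring.
rewrite mulrDl (le_trans (ler_normD _ _))// lerD//.
  by rewrite ger0_norm// divr_ge0 ?(ltW rv)// pexp_ge0// => x; rewrite sqr_ge0.
rewrite -mulrA normrM ger0_norm// ler_wpM2l//.
rewrite normrM normfV (gtr0_norm rv) ler_pdivrMr//.
rewrite -(ler_pXn2r (ltn0Sn 1)) ?nnegrE ?mulr_ge0 ?sqrtr_ge0 ?v_ge0 ?(ltW rv)//.
rewrite exprMn sqr_sqrtr; last first.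
  by rewrite mulr_ge0// divr_ge0 ?(ltW rv)// pexp_ge0// => x; rewrite sqr_ge0.
have v0 : 0 < v n by near: n; exact: near_v_gt0.
have r0 : 0 < (r n)%:R :> R by rewrite ltr0n; near: n.
have -> : g n * d n * ((r n)%:R * v n) ^+ 2 =
    pexp n (fun x => G n x ^+ 2) * pexp n (fun x => (H n x - G n x) ^+ 2).
  by rewrite /g /d; field; rewrite !gt_eqF.
rewrite real_normK ?num_real//.
exact: (fexp_cauchy_schwarz (@p_ge0 n)).
Unshelve. all: by end_near. Qed.

Definition big_len n : nat := ((nb_small n - 2) * s n)%N.

Definition big_block_geometry n := [/\ (1 <= s n)%N,
  (big_len n <= r n)%N,
  (r n <= big_len n + 3 * s n)%N,
  (big_len n + 2 * s n <= r n)%N &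
  (4 * r n <= n)%N].

Lemma near_big_len : \forall n \near \oo, big_block_geometry n.
Proof.
near=> n.
have [s1 g4 [rg gr] _ _] : geometry n by near: n; exact: near_geometry.
have gs : ((nb_small n - 2) * s n + 2 * s n = nb_small n * s n)%N.
  by rewrite -mulnDl subnK//; lia.
rewrite /big_block_geometry /big_len; split=> //; [lia|lia|lia|].
by near: n; exact: near_r_leq.
Unshelve. all: by end_near. Qed.

Lemma big_len_ratio : (big_len n)%:R / (r n)%:R @[n --> \oo] --> (1 : R).
Proof.
apply/cvgrPdist_le => q q0; near=> n.
have [_ Lr rL _ _] : big_block_geometry n by near: n; exact: near_big_len.
have sq : (s n)%:R <= q / 3 * (r n)%:R.
  by near: n; apply: near_sr_le; rewrite divr_gt0.
have r0 : 0 < (r n)%:R :> R by rewrite ltr0n; near: n.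
rewrite -[X in X - _](divff (lt0r_neq0 r0)) -mulrBl normrM normfV (gtr0_norm r0) ler_pdivrMr//.
rewrite ger0_norm ?subr_ge0 ?ler_nat// lerBlDl.
apply: (@le_trans _ _ ((big_len n + 3 * s n)%:R)); first by rewrite ler_nat.
rewrite natrD natrM; lra.
Unshelve. all: by end_near. Qed.

(** Condition (2) concerns [r n] bits; dropping the last ones, at most [3 s], changes the count by
    [o(r v)] in squared L2 norm. *)
Lemma count_big_var : pexp n (fun x => count_seq (big_len n) x ^+ 2) / ((r n)%:R * v n)
  @[n --> \oo] --> c.
Proof.
apply: (@l2_transfer (fun n => count_seq (big_len n)) (fun n => count_seq (r n))) => //.
have lim0 : 3 * (1 + 2 * Ce) * ((s n)%:R / (r n)%:R) @[n --> \oo] --> 0.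
  by rewrite -(mulr0 (3 * (1 + 2 * Ce))); apply: cvgMr.
apply: cvg0_le lim0; near=> n.
have [_ Lr rL _ rn] : big_block_geometry n by near: n; exact: near_big_len.
have v0 : 0 < v n by near: n; exact: near_v_gt0.
have r0 : 0 < (r n)%:R :> R by rewrite ltr0n; near: n.
have e0 : \sum_(1 <= k < (r n).+1) e n k <= Ce by near: n; exact: sum_e_le.
have e1 : 0 <= \sum_(1 <= k < (r n).+1) e n k by apply: sumr_ge0.
apply/andP; split.
  by rewrite divr_ge0 ?mulr_ge0 ?(ltW v0) ?(ltW r0)// pexp_ge0// => x; rewrite sqr_ge0.
rewrite ler_pdivrMr ?mulr_gt0//.
have -> : pexp n (fun x => (count_seq (big_len n) x - count_seq (r n) x) ^+ 2) =
    pexp n (fun x => count_seq (r n - big_len n) (shift_seq (big_len n) x) ^+ 2).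
  apply: eq_fexp => om; rewrite -[in count_seq (r n)](subnKC Lr) count_seqD.
  by rewrite opprD addNKr sqrrN.
rewrite (pexp_shift (@local_comp (fun y => y ^+ 2) _ _ _ (@local_count_seq (r n - big_len n))));
  last by lia.
apply: le_trans (@pexp_count_sqr n (r n - big_len n) (r n) _ (leq_subr _ _)) _; first by lia.
rewrite (_ : _ * ((s n)%:R / _) * _ = (3 * (s n)%:R) * v n * (1 + 2 * Ce)); last first.
  by field; rewrite gt_eqF.
apply: ler_pM; rewrite ?mulr_ge0 ?addr_ge0 ?mulr_ge0 ?(ltW v0)//.
  by rewrite ler_wpM2r ?(ltW v0)// -natrM ler_nat; lia.
by rewrite lerD2l ler_wpM2l.
Unshelve. all: by end_near. Qed.

Definition hit L (x : nat -> bool) : bool := [exists i : 'I_L, x i].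

Lemma hit_count L x : ((hit L x)%:R : R) * count_seq L x = count_seq L x.
Proof.
have [_|/existsPn h] := boolP (hit L x); first by rewrite mul1r.
by rewrite mul0r /count_seq big1// => i _; have := h i; case: (x i).
Qed.

Lemma hit_le_count L x : ((hit L x)%:R : R) <= count_seq L x.
Proof.
have [/existsP[i xi]|_] := boolP (hit L x); last exact: count_seq_ge0.
exact: count_seq_ge1 (ltn_ord i) xi.
Qed.

Lemma local_hit L : local 0 L (fun x => (hit L x)%:R : R).
Proof.
move=> x y xy; congr ((nat_of_bool _)%:R); apply: eq_existsb => i.
by apply: xy; rewrite add0n /=.
Qed.

(** The L2 hypothesis replaces [B] by the indicator in the second moment, the L1 hypothesis does so
    in the mean. *)
Lemma block_variance (B : nat -> (nat -> bool) -> R) (theta : R) :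
  pexp n (fun x => (B n x - (hit (big_len n) x)%:R) ^+ 2) / ((r n)%:R * v n)
    @[n --> \oo] --> 0 ->
  pexp n (fun x => `|B n x - (hit (big_len n) x)%:R|) / ((r n)%:R * v n)
    @[n --> \oo] --> 0 ->
  pexp n (B n) / ((r n)%:R * v n) @[n --> \oo] --> theta ->
  pexp n (fun x => (B n x - theta * count_seq (big_len n) x) ^+ 2) / ((r n)%:R * v n)
    @[n --> \oo] --> theta * (theta * c - 1).
Proof.
move=> B2 B1 Bt.
apply: (@l2_transfer (fun n x => B n x - theta * count_seq (big_len n) x)
  (fun n x => (hit (big_len n) x)%:R - theta * count_seq (big_len n) x)).
  apply: cvg_near_eq B2; near=> n; congr (_ / _); apply: eq_fexp => om.
  by congr (_ ^+ 2); ring.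
have hit_lim : pexp n (fun x => (hit (big_len n) x)%:R) / ((r n)%:R * v n)
    @[n --> \oo] --> theta.
  have h0 : pexp n (fun x => B n x - (hit (big_len n) x)%:R) / ((r n)%:R * v n)
      @[n --> \oo] --> 0.
    apply: norm_cvg0; apply: cvg0_le B1; near=> n.
    have rv : 0 < (r n)%:R * v n by near: n; exact: near_rv_gt0.
    rewrite normr_ge0 normrM normfV (gtr0_norm rv)/= ler_wpM2r ?invr_ge0 ?(ltW rv)//.
    exact: fexp_norm.
  rewrite -(subr0 theta); apply: cvg_near_eq (cvgB Bt h0); near=> n.
  rewrite !fctE -mulrBl; congr (_ / _); rewrite /pexp -fexpB.
  by apply: eq_fexp => om; ring.
rewrite (_ : _ * (_ - 1) = theta - 2 * theta * 1 + theta ^+ 2 * c); last by ring.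
have len_lim : 2 * theta * ((big_len n)%:R / (r n)%:R) @[n --> \oo] --> 2 * theta * 1.
  by apply: cvgMr; exact: big_len_ratio.
have cnt_lim : theta ^+ 2 *
    (pexp n (fun x => count_seq (big_len n) x ^+ 2) / ((r n)%:R * v n)) @[n --> \oo] -->
    theta ^+ 2 * c by apply: cvgMr; exact: count_big_var.
apply: cvg_near_eq (cvgD (cvgB hit_lim len_lim) cnt_lim); near=> n.
have [_ Lr rL _ rn] : big_block_geometry n by near: n; exact: near_big_len.
have v0 : 0 < v n by near: n; exact: near_v_gt0.
have r0 : 0 < (r n)%:R :> R by rewrite ltr0n; near: n.
have -> : pexp n (fun x => ((hit (big_len n) x)%:R - theta * count_seq (big_len n) x) ^+ 2) =
  pexp n (fun x => (hit (big_len n) x)%:R) - 2 * theta * pexp n (count_seq (big_len n)) +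
  theta ^+ 2 * pexp n (fun x => count_seq (big_len n) x ^+ 2).
  rewrite -!pexpZ /pexp -fexpB -fexpD; apply: eq_fexp => om.
  have ha := hit_count (big_len n) (extend om).
  have hh : ((hit (big_len n) (extend om))%:R : R) ^+ 2 = (hit (big_len n) (extend om))%:R.
    by case: (hit _ _); rewrite ?expr1n ?expr0n.
  move: ha hh; set h := (hit _ _)%:R; set a := count_seq _ _ => ha hh.
  by ring: ha hh.
rewrite pexp_count; last by lia.
by rewrite !fctE; field; rewrite !gt_eqF.
Unshelve. all: by end_near. Qed.

(** * Deviations from the block indicator *)

Lemma count_seq_nat L (x : nat -> bool) : count_seq L x = (\sum_(i < L) x i)%N%:R.
Proof. by rewrite natr_sum. Qed.

(** Serves to turn L2 bounds on integer-valued deviations into L1 bounds. *)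
Lemma nat_dist_le_sqr (m k : nat) : `|m%:R - k%:R| <= (m%:R - k%:R) ^+ 2 :> R.
Proof.
wlog mk : m k / (k <= m)%N => [hw|].
  have [/hw//|/ltnW/hw] := leqP k m.
  by rewrite distrC -sqrrN opprB.
by rewrite -natrB// normr_nat -natrX ler_nat; case: (m - k)%N => // q; rewrite leq_pmulr.
Qed.

Lemma sum_count_blocks s0 q x :
  \sum_(b < q) count_seq s0 (shift_seq (b * s0) x) = count_seq (q * s0) x.
Proof. by rewrite /count_seq (sum_ord_mul (fun i => (x i)%:R)). Qed.

(** [(m - 1)^2 <= m (m - 1)] for a count [m >= 1], and the right-hand side is the number of ordered
    pairs. *)
Lemma count_sub_hit_sqr q h : (count_seq q h - (hit q h)%:R) ^+ 2 <= 2 * far_pairs 0 q h.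
Proof.
have := count_seq_sqr q h; have hc := hit_count q h; move=> sq.
have -> : 2 * far_pairs 0 q h = count_seq q h ^+ 2 - count_seq q h by rewrite sq addrC addKr.
have [/existsP[i hi]|nh] := boolP (hit q h).
  have := count_seq_ge1 (ltn_ord i) hi; move: (count_seq q h) => D D1 /=; nra.
by move: hc; rewrite (negbTE nh) mul0r => <-; rewrite subrr expr0n subrr.
Qed.

Lemma hit_blocks s0 q x : hit (q * s0) x = hit q (fun b => hit s0 (shift_seq (b * s0) x)).
Proof.
apply/existsP/existsP => [[[i iqs] /= xi]|[b /existsP[i xi]]]; last first.
  have bi : (b * s0 + i < q * s0)%N by have := ltn_ord b; have := ltn_ord i; nia.
  by exists (Ordinal bi).
have s0p : (0 < s0)%N by move: iqs; case: (s0) => //; rewrite muln0.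
have bq : (i %/ s0 < q)%N by rewrite ltn_divLR.
exists (Ordinal bq); apply/existsP; exists (Ordinal (ltn_pmod i s0p)) => /=.
by rewrite /shift_seq -divn_eq.
Qed.

Definition disjoint_sum s0 q x : R := \sum_(b < q) (hit s0 (shift_seq (b * s0) x))%:R.

(* Of two hit blocks, an exceedance in the later one lies more than [K] after the earlier
   one, unless it is among the first [K] of its block. *)
Lemma disjoint_dev K s0 q x : (K <= s0)%N ->
  (disjoint_sum s0 q x - (hit (q * s0) x)%:R) ^+ 2 <=
  2 * (far_pairs K (q * s0) x + \sum_(b < q) count_seq K (shift_seq (b * s0) x)).
Proof.
move=> Ks; set h := fun b => hit s0 (shift_seq (b * s0) x).
(* The disjoint statistic is itself a count, for the sequence [h] of hit blocks, so its deviation is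
   governed by pairs of hit blocks. *)
rewrite hit_blocks -/h (_ : disjoint_sum s0 q x = count_seq q h)//.
apply: le_trans (count_sub_hit_sqr q h) _; rewrite ler_wpM2l//.
rewrite /far_pairs (sum_ord_mul (fun j => (x j)%:R * count_seq (j - K) x)) -big_split/=.
apply: ler_sum => b _; rewrite subn0.
have nn i : 0 <= (x (b * s0 + i)%N)%:R * count_seq (b * s0 + i - K) x :> R.
  by rewrite mulr_ge0 ?count_seq_ge0.
have hle b' : count_seq b' h <= count_seq (b' * s0) x.
  by rewrite -sum_count_blocks; apply: ler_sum => i _; exact: hit_le_count.
have [hb|_] := boolP (h b); last first.
  by rewrite mul0r addr_ge0 ?count_seq_ge0// sumr_ge0.
have /existsP[i xi] := hb; rewrite mul1r.
have {}xi : x (b * s0 + i)%N by exact: xi.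
have term : count_seq (b * s0 + i - K) x <=
    \sum_(i0 < s0) (x (b * s0 + i0)%N)%:R * count_seq (b * s0 + i0 - K) x.
  by rewrite (bigD1 i)//= xi mul1r lerDl sumr_ge0.
have [Ki|iK] := leqP K i.
  apply: le_trans (hle b) _; apply: (@le_trans _ _ (count_seq (b * s0 + i - K) x)).
    by apply: count_seq_le; lia.
  by apply: le_trans term _; rewrite lerDl count_seq_ge0.
(* Only the block just before can be closer than [K], as [K <= s0]; it costs at most 1, paid for by
   the exceedance among the first [K] bits. *)
apply: (@le_trans _ _ (count_seq (b * s0 + i - K) x + 1)); last first.
  by apply: lerD => //; apply: (count_seq_ge1 iK).
case: (nat_of_ord b) => [|b']; first by rewrite /count_seq big_ord0 addr_ge0 ?sumr_ge0.
rewrite count_seqS lerD ?lern1 ?leq_b1// (le_trans (hle b'))// count_seq_le//; lia.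
Qed.

Lemma disjoint_dist_le s0 q x : `|disjoint_sum s0 q x - (hit (q * s0) x)%:R| <=
  (disjoint_sum s0 q x - (hit (q * s0) x)%:R) ^+ 2.
Proof.
rewrite (_ : disjoint_sum s0 q x = count_seq q (fun b => hit s0 (shift_seq (b * s0) x)))//.
by rewrite count_seq_nat nat_dist_le_sqr.
Qed.

(** [K] is fixed first: pairs farther apart cost the tail of (3), and the first [K] bits of each
    block cost a fraction [K / s] of [r v], which vanishes as [s] grows. *)
Lemma disjoint_dev_lim : pexp n (fun x =>
    (disjoint_sum (s n) (nb_small n - 2) x - (hit (big_len n) x)%:R) ^+ 2) / ((r n)%:R * v n)
  @[n --> \oo] --> 0.
Proof.
apply/cvgrPdist_le => q q0.
have q4 : 0 < q / 4 by rewrite divr_gt0.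
have [K HK] := tail_e q4; near=> n.
have [s1 Lr rL _ rn] : big_block_geometry n by near: n; exact: near_big_len.
have v0 : 0 < v n by near: n; exact: near_v_gt0.
have r0 : 0 < (r n)%:R :> R by rewrite ltr0n; near: n.
have Ks : (K <= s n)%N by near: n; exact: near_s_ge.
have Ks4 : K%:R <= q / 4 * (s n)%:R.
  have : (Num.truncn (K%:R / (q / 4)) < s n)%N by near: n; exact: near_s_ge.
  rewrite [leRHS]mulrC -ler_pdivrMr// => h.
  by rewrite (le_trans (ltW (truncnS_gt _)))// ler_nat.
have TK : \sum_(K.+1 <= k < (r n).+1) e n k <= q / 4 by near: n; exact: HK.
have nn : 0 <= pexp n (fun x => (disjoint_sum (s n) (nb_small n - 2) x -
    (hit (big_len n) x)%:R) ^+ 2) by apply: pexp_ge0 => x; exact: sqr_ge0.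
rewrite sub0r normrN ger0_norm ?divr_ge0 ?mulr_ge0 ?(ltW v0) ?(ltW r0)//.
rewrite ler_pdivrMr ?mulr_gt0//.
apply: (@le_trans _ _ (pexp n (fun x => 2 * (far_pairs K (big_len n) x +
    \sum_(b < nb_small n - 2) count_seq K (shift_seq (b * s n) x))))).
  by apply: pexp_le => x; exact: disjoint_dev.
rewrite pexpZ pexpD [X in _ * (_ + X)]pexp_sum.
have fp := @pexp_far_pairs n K (big_len n) (r n) (ltac:(clear - Lr rn; lia)) Lr.
have cK : \sum_(b < nb_small n - 2) pexp n (fun x => count_seq K (shift_seq (b * s n) x)) =
    (nb_small n - 2)%:R * (K%:R * v n).
  rewrite -[in RHS](card_ord (nb_small n - 2)) mulr_natl -sumr_const.
  apply: eq_bigr => b _.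
  have bK : (b * s n + K <= n.+1)%N.
    have : (b.+1 * s n <= big_len n)%N by rewrite leq_mul2r ltn_ord orbT.
    by rewrite mulSnr; clear - Lr rn Ks; lia.
  by rewrite (pexp_shift (@local_count_seq K) bK) pexp_count//; clear - bK; lia.
rewrite cK.
have h1 : pexp n (far_pairs K (big_len n)) <= (r n)%:R * v n * (q / 4).
  apply: le_trans fp _; apply: ler_pM => //; rewrite ?mulr_ge0 ?(ltW v0)//.
    by apply: sumr_ge0.
  by rewrite ler_wpM2r ?(ltW v0)// ler_nat.
have h2 : (nb_small n - 2)%:R * (K%:R * v n) <= (r n)%:R * v n * (q / 4).
  apply: (@le_trans _ _ ((nb_small n - 2)%:R * (q / 4 * (s n)%:R * v n))).
    by rewrite ler_wpM2l// ler_wpM2r// ltW.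
  rewrite (_ : _ * (_ * v n) = (nb_small n - 2)%:R * (s n)%:R * (v n * (q / 4))); last by ring.
  rewrite -[leRHS]mulrA ler_wpM2r ?mulr_ge0 ?(ltW v0) ?(ltW q4)//.
    by rewrite ltW.
  by rewrite -natrM ler_nat.
lra.
Unshelve. all: by end_near. Qed.

Definition sliding_avg s0 x : R := s0%:R^-1 * \sum_(i < s0) (hit s0 (shift_seq i x))%:R.

(** The shift only exchanges some of the first [s0] bits for some of the [s0] bits after the window;
    if the indicator changes, one of these is an exceedance. *)
Lemma hit_shift_dist s0 L i x : (i <= s0)%N ->
  `|(hit L (shift_seq i x))%:R - (hit L x)%:R| <=
  count_seq s0 x + count_seq s0 (shift_seq L x).
Proof.
move=> is0; have c0 : 0 <= count_seq s0 x + count_seq s0 (shift_seq L x).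
  by rewrite addr_ge0 ?count_seq_ge0.
have [/existsP[j xj]|/existsPn nj] := boolP (hit L (shift_seq i x));
    have [/existsP[k xk]|/existsPn nk] := boolP (hit L x); rewrite ?subrr ?normr0//=.
- rewrite subr0 normr1; have [ijL|Lij] := ltnP (i + j) L.
    by have := nk (Ordinal ijL); rewrite /= -[x _]/(shift_seq i x j) xj.
  rewrite ler_wpDl ?count_seq_ge0//; apply: (@count_seq_ge1 _ _ (i + j - L)).
    by have := ltn_ord j; lia.
  by rewrite /shift_seq subnKC.
- rewrite sub0r normrN1; have [ki|ik] := ltnP k i.
    by rewrite ler_wpDr ?count_seq_ge0//; apply: (@count_seq_ge1 _ _ k) => //; lia.
  have kiL : (k - i < L)%N by have := ltn_ord k; lia.
  by have := nj (Ordinal kiL); rewrite /= /shift_seq subnKC// xk.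
Qed.

Lemma sqr_avg_le s0 (f : nat -> R) : (0 < s0)%N ->
  (s0%:R^-1 * \sum_(i < s0) f i) ^+ 2 <= s0%:R^-1 * \sum_(i < s0) f i ^+ 2.
Proof.
move=> s0p; rewrite !mulr_sumr.
apply: (@fexp_sqr_le _ _ (fun _ : 'I_s0 => s0%:R^-1)) => [i|].
  by rewrite invr_ge0.
by rewrite sumr_const card_ord -[LHS]mulr_natl divff// pnatr_eq0 -lt0n.
Qed.

(** One bound for the absolute value and, doubled, for the square of the sliding deviation: the
    averaged disjoint deviations of the shifted sequences, plus the boundary cost of shifting the
    indicator. *)
Definition sliding_err s0 q x : R := s0%:R^-1 * (\sum_(i < s0)
    (disjoint_sum s0 q (shift_seq i x) - (hit (q * s0) (shift_seq i x))%:R) ^+ 2) +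
  (count_seq s0 x + count_seq s0 (shift_seq (q * s0) x)).

Lemma sliding_sumE s0 q x : \sum_(b < q) sliding_avg s0 (shift_seq (b * s0) x) =
  s0%:R^-1 * \sum_(i < s0) disjoint_sum s0 q (shift_seq i x).
Proof.
rewrite -mulr_sumr exchange_big/=; congr (_ * _).
by apply: eq_bigr => i _; apply: eq_bigr => b _; rewrite !shift_seqD addnC.
Qed.

(* The sliding statistic is the average of the disjoint ones of the [s0] shifted sequences. *)
Lemma sliding_dev s0 q x : (0 < s0)%N ->
  let y := \sum_(b < q) sliding_avg s0 (shift_seq (b * s0) x) - (hit (q * s0) x)%:R in
  y ^+ 2 <= 2 * sliding_err s0 q x /\ `|y| <= sliding_err s0 q x.
Proof.
move=> s0p /=.
set V := count_seq s0 x + count_seq s0 (shift_seq (q * s0) x).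
pose a (i : nat) := disjoint_sum s0 q (shift_seq i x) - (hit (q * s0) (shift_seq i x))%:R.
pose t (i : nat) : R := (hit (q * s0) (shift_seq i x))%:R - (hit (q * s0) x)%:R.
have s0R : (s0%:R : R) != 0 by rewrite pnatr_eq0 -lt0n.
have avg_cst (k : R) : s0%:R^-1 * \sum_(i < s0) k = k.
  by rewrite sumr_const card_ord -[X in _ * X]mulr_natl mulrA mulVf// mul1r.
have -> : \sum_(b < q) sliding_avg s0 (shift_seq (b * s0) x) - (hit (q * s0) x)%:R =
    s0%:R^-1 * \sum_(i < s0) (a i + t i).
  rewrite sliding_sumE -[X in _ - X]avg_cst -mulrBr -sumrB; congr (_ * _).
  by apply: eq_bigr => i _; rewrite /a /t addrA subrK.
have tV (i : 'I_s0) : `|t i| <= V by apply: hit_shift_dist; exact/ltnW/ltn_ord.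
have t2 i : t i ^+ 2 <= `|t i|.
  by rewrite /t; case: (hit _ _); case: (hit _ _); rewrite ?subrr ?sub0r ?subr0 ?normr0 ?normrN ?normr1 ?sqrrN ?expr1n ?expr0n.
have a1 i : `|a i| <= a i ^+ 2 by exact: disjoint_dist_le.
have V0 : 0 <= V by rewrite addr_ge0 ?count_seq_ge0.
rewrite /sliding_err -/V; split.
  apply: le_trans (sqr_avg_le (fun i => a i + t i) s0p) _.
  rewrite mulrDr -[X in _ + X](avg_cst (2 * V)) mulrCA -mulrDr ler_wpM2l ?invr_ge0//.
  rewrite mulr_sumr -big_split ler_sum// => i _ /=.
  have := tV i; have := t2 i; have := sqr_ge0 (a i - t i); rewrite -/(a i); lra.
rewrite normrM ger0_norm ?invr_ge0// -[X in _ + X](avg_cst V) -mulrDr ler_wpM2l ?invr_ge0//.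
rewrite (le_trans (ler_norm_sum _ _ _))// -big_split ler_sum// => i _ /=.
by rewrite (le_trans (ler_normD _ _))// lerD.
Qed.

Lemma local_disjoint_dev s0 q : local 0 (q * s0)
  (fun x => (disjoint_sum s0 q x - (hit (q * s0) x)%:R) ^+ 2).
Proof.
move=> x y xy; congr ((_ - _) ^+ 2); last exact: local_hit.
apply: eq_bigr => b _; apply: local_hit => i; rewrite add0n => ilt.
by apply: xy; have := ltn_ord b; nia.
Qed.

(** By stationarity all shifts contribute equally, which leaves the disjoint deviation; the two
    boundary counts have mean [2 s v = o(r v)]. *)
Lemma sliding_err_lim : pexp n (sliding_err (s n) (nb_small n - 2)) / ((r n)%:R * v n)
  @[n --> \oo] --> 0.
Proof.
have lim0 : pexp n (fun x =>
    (disjoint_sum (s n) (nb_small n - 2) x - (hit (big_len n) x)%:R) ^+ 2) / ((r n)%:R * v n) +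
    2 * ((s n)%:R / (r n)%:R) @[n --> \oo] --> 0.
  rewrite (_ : 0 = 0 + 2 * 0); last by rewrite mulr0 addr0.
  by apply: cvgD; [exact: disjoint_dev_lim|exact: cvgMr].
apply: cvg_near_eq lim0; near=> n.
have [s1 Lr rL Ls rn] : big_block_geometry n by near: n; exact: near_big_len.
have v0 : 0 < v n by near: n; exact: near_v_gt0.
have r0 : 0 < (r n)%:R :> R by rewrite ltr0n; near: n.
have s0R : ((s n)%:R : R) != 0 by rewrite pnatr_eq0 -lt0n.
rewrite /sliding_err pexpD pexpZ pexp_sum.
have -> : \sum_(i < s n) pexp n (fun x => (disjoint_sum (s n) (nb_small n - 2) (shift_seq i x) -
      (hit ((nb_small n - 2) * s n) (shift_seq i x))%:R) ^+ 2) =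
    (s n)%:R * pexp n (fun x =>
      (disjoint_sum (s n) (nb_small n - 2) x - (hit (big_len n) x)%:R) ^+ 2).
  rewrite -[X in X%:R * _](card_ord (s n)) mulr_natl -sumr_const.
  apply: eq_bigr => i _; apply: (pexp_shift (@local_disjoint_dev (s n) (nb_small n - 2))).
  by have := ltn_ord i; clear - Ls rn; rewrite /big_len in Ls *; lia.
rewrite mulKf// pexpD.
rewrite (pexp_shift (@local_count_seq (s n))); last by clear - Ls rn; rewrite /big_len in Ls; lia.
rewrite pexp_count; last by clear - Ls rn; lia.
by field; rewrite !gt_eqF.
Unshelve. all: by end_near. Qed.

Definition isolated s0 (x : nat -> bool) i := x i && ~~ hit s0.-1 (shift_seq i.+1 x).

Lemma isolated_shift s0 a x i : isolated s0 (shift_seq a x) i = isolated s0 x (a + i).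
Proof. by rewrite /isolated shift_seqD addnS. Qed.

(** Two isolated exceedances are at least [s0] apart, hence a far pair. If a window has exceedances
    but no isolated one, there must be another among the [s0] bits beyond it. *)
Lemma runs_dev s0 L x : (0 < s0)%N ->
  (count_seq L (isolated s0 x) - (hit L x)%:R) ^+ 2 <=
  count_seq s0 (shift_seq L x) + 2 * far_pairs s0.-1 L x.
Proof.
move=> s0p; set a := isolated s0 x.
have V0 := count_seq_ge0 s0 (shift_seq L x).
have ax i : a i -> x i by case/andP.
have fp : far_pairs 0 L a <= far_pairs s0.-1 L x.
  apply: ler_sum => j _; rewrite subn0.
  have [aj|_] := boolP (a j); last by rewrite mul0r mulr_ge0 ?count_seq_ge0.
  rewrite (ax _ aj) !mul1r.
  (* An isolated exceedance within [s0.-1] bits before [j] is contradicted by the exceedance at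
     [j]. *)
  have -> : count_seq j a = count_seq (j - s0.-1) a.
    rewrite -{1}(subnK (leq_subr s0.-1 j)) addnC count_seqD.
    rewrite [X in _ + X]big1 ?addr0// => i _; rewrite /shift_seq.
    have [/andP[_ /existsPn h]|//] := boolP (a _); exfalso.
    have ij := ltn_ord i.
    have ks : (j - (j - s0.-1 + i).+1 < s0.-1)%N by lia.
    have := h (Ordinal ks); rewrite /= /shift_seq subnKC ?(ax _ aj)//; lia.
  by apply: ler_sum => i _; rewrite ler_nat; case: (boolP (a i)) => [/ax ->|].
have fp0 : 0 <= far_pairs 0 L a by apply: sumr_ge0 => j _; rewrite mulr_ge0 ?count_seq_ge0.
have aL := count_sub_hit_sqr L a.
have [ha|ha] := boolP (hit L a).
  have hx : hit L x by have /existsP[i ai] := ha; apply/existsP; exists i; exact: ax.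
  rewrite ha in aL; rewrite hx; lra.
have a0 : count_seq L a = 0 by rewrite -hit_count (negbTE ha) mul0r.
rewrite a0 sub0r sqrrN; have [/existsP[k xk]|nx] := boolP (hit L x); last first.
  by rewrite expr0n/=; lra.
rewrite expr1n; suff : 1 <= count_seq s0 (shift_seq L x) by lra.
(* The last exceedance among the first [L + s0] bits: inside the window it would be isolated, as
   nothing follows it. *)
have ex : exists i, (i < L + s0)%N && x i by exists k; rewrite xk andbT ltn_addr.
have ub i : (i < L + s0)%N && x i -> (i <= L + s0)%N by case/andP => /ltnW.
case: (ex_maxnP ex ub) => i /andP[iLs xi] imax.
have [iL|Li] := ltnP i L; last first.
  apply: (@count_seq_ge1 _ _ (i - L)); first by clear - iLs Li; lia.
  by rewrite /shift_seq subnKC.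
move/existsPn : ha => /(_ (Ordinal iL)) /=; rewrite /a /isolated xi/= negbK => /existsP[j xj].
have jlt := ltn_ord j.
have := imax (i.+1 + j)%N; rewrite [x _]xj andbT.
have -> : (i.+1 + j < L + s0)%N by clear - jlt iL s0p; lia.
by move=> /(_ isT) h; exfalso; clear - h; lia.
Qed.

Lemma runs_dist_le s0 L x : `|count_seq L (isolated s0 x) - (hit L x)%:R| <=
  (count_seq L (isolated s0 x) - (hit L x)%:R) ^+ 2.
Proof. by rewrite count_seq_nat nat_dist_le_sqr. Qed.

Lemma runs_dev_lim : pexp n (fun x =>
    (count_seq (big_len n) (isolated (s n) x) - (hit (big_len n) x)%:R) ^+ 2) / ((r n)%:R * v n)
  @[n --> \oo] --> 0.
Proof.
apply/cvgrPdist_le => q q0.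
have q4 : 0 < q / 4 by rewrite divr_gt0.
have [K HK] := tail_e q4; near=> n.
have [s1 Lr rL Ls rn] : big_block_geometry n by near: n; exact: near_big_len.
have v0 : 0 < v n by near: n; exact: near_v_gt0.
have r0 : 0 < (r n)%:R :> R by rewrite ltr0n; near: n.
have Ks : (K.+1 <= s n)%N by near: n; exact: near_s_ge.
have s4 : (s n)%:R <= q / 4 * (r n)%:R by near: n; apply: near_sr_le.
have TK : \sum_(K.+1 <= k < (r n).+1) e n k <= q / 4 by near: n; exact: HK.
have nn : 0 <= pexp n (fun x => (count_seq (big_len n) (isolated (s n) x) -
    (hit (big_len n) x)%:R) ^+ 2) by apply: pexp_ge0 => x; exact: sqr_ge0.
rewrite sub0r normrN ger0_norm ?divr_ge0 ?mulr_ge0 ?(ltW v0) ?(ltW r0)//.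
rewrite ler_pdivrMr ?mulr_gt0//.
apply: (@le_trans _ _ (pexp n (fun x => count_seq (s n) (shift_seq (big_len n) x) +
    2 * far_pairs (s n).-1 (big_len n) x))).
  by apply: pexp_le => x; exact: runs_dev.
rewrite pexpD pexpZ.
have fp := @pexp_far_pairs n (s n).-1 (big_len n) (r n) (ltac:(clear - Lr rn; lia)) Lr.
have Lsn : (big_len n + s n <= n.+1)%N by clear - Ls rn; lia.
have sn : (s n <= n.+1)%N by clear - Lsn; lia.
rewrite (pexp_shift (@local_count_seq (s n)) Lsn) pexp_count//.
have T0 : 0 <= \sum_((s n).-1.+1 <= k < (r n).+1) e n k by apply: sumr_ge0.
have TT : \sum_((s n).-1.+1 <= k < (r n).+1) e n k <= q / 4.
  apply: le_trans TK; rewrite prednK// [leRHS](@big_cat_nat _ _ _ (s n))//=.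
    by rewrite lerDr sumr_ge0.
  by clear - Ls; lia.
have h1 : pexp n (far_pairs (s n).-1 (big_len n)) <= (r n)%:R * v n * (q / 4).
  apply: le_trans fp _; apply: ler_pM => //; rewrite ?mulr_ge0 ?(ltW v0)//.
  by rewrite ler_wpM2r ?(ltW v0)// ler_nat.
have h2 : (s n)%:R * v n <= q / 4 * ((r n)%:R * v n) by rewrite mulrA ler_wpM2r ?(ltW v0).
have h3 : 0 <= q * ((r n)%:R * v n) by rewrite mulr_ge0 ?mulr_ge0 ?(ltW v0) ?(ltW q0) ?(ltW r0).
lra.
Unshelve. all: by end_near. Qed.

(** * Ratio statistics *)

Lemma asymp_negl_cst (a : nat -> R) : a n @[n --> \oo] --> 0 ->
  asymp_negl p (fun n _ => a n).
Proof.
move=> a0; apply: asymp_negl_L1 => //.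
under eq_fun do rewrite fexp_cst//.
by rewrite -(@normr0 _ R); exact: cvg_norm.
Qed.

Lemma asymp_negl_scale (W : forall n, Om n -> R) (a : R) (k : nat -> R) :
  cvg_law p W a -> k n @[n --> \oo] --> 0 -> asymp_negl p (fun n om => k n * W n om).
Proof.
move=> Wa k0 d d0; apply/cvgrPdist_le => q q0.
have [K K0 KW] := cvg_law_tight p_ge0 Wa q0.
near=> n.
have WK : fprob p (fun om : Om n => K < `|W n om|) <= q by near: n; exact: KW (lexx K).
have kK : `|0 - k n| <= d / K by near: n; apply: cvgr_dist_le => //; rewrite divr_gt0.
rewrite sub0r normrN ger0_norm ?fprob_ge0//; apply: le_trans WK.
apply: fprob_le => // om; rewrite normrM; apply: contraTT; rewrite -!leNgt => h.
rewrite (le_trans (ler_wpM2l (normr_ge0 _) h))// -ler_pdivlMr//.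
by move: kK; rewrite sub0r normrN.
Unshelve. all: by end_near. Qed.

Lemma s_over_w : (s n)%:R * v n / w n @[n --> \oo] --> 0.
Proof.
apply: cvg0_le rvw0; near=> n.
have wn : 0 < w n by near: n; exact: w_gt0.
have sr : (1 * s n <= r n)%N by near: n; exact: near_s_leq.
rewrite divr_ge0 ?(ltW wn) ?mulr_ge0 ?v_ge0//= ler_wpM2r ?invr_ge0 ?(ltW wn)//.
by rewrite ler_wpM2r ?v_ge0// ler_nat -(mul1n (s n)).
Unshelve. all: by end_near. Qed.

Lemma w_inv0 : (w n)^-1 @[n --> \oo] --> 0.
Proof.
apply: cvg0_le rw0; near=> n.
have wn : 0 < w n by near: n; exact: w_gt0.
have r0 : (0 < r n)%N by near: n.
by rewrite invr_ge0 (ltW wn)/= ler_peMl ?invr_ge0 ?(ltW wn)// ler1n.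
Unshelve. all: by end_near. Qed.

Definition denominator n x : R := count_seq (n.+1 - s n) (shift_seq 1 x).

Definition blocks_geometry n := [/\ (1 <= s n)%N,
  (nb_blocks n * s n <= n.+1 - s n)%N,
  (n.+1 - s n <= nb_blocks n * s n + 2 * s n)%N,
  (4 * s n <= n)%N &
  (nb_blocks n + 1 = n %/ s n)%N].

Lemma near_blocks : \forall n \near \oo, blocks_geometry n.
Proof.
near=> n.
have [s1 _ _ Bn _] : geometry n by near: n; exact: near_geometry.
have rn : (1 * r n <= n)%N by near: n; exact: near_r_leq.
have sr : (4 * s n <= r n)%N by near: n; exact: near_s_leq.
have nE := divn_eq n (s n); have nlt := ltn_pmod n s1.
have ns : (1 <= n %/ s n)%N by rewrite divn_gt0//; lia.
have BE : (nb_blocks n + 1 = n %/ s n)%N by rewrite /nb_blocks subnK.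
rewrite -BE in nE.
rewrite mulnDl mul1n in nE Bn.
by split=> //; lia.
Unshelve. all: by end_near. Qed.

(* [n - s < (nb_blocks + 1) * s]: at most [2 s] summands are left out of the blocks. *)
Lemma trailing_sum_le (F : nat -> nat -> (nat -> bool) -> R) (C : R) :
  (forall n j x, 0 <= F n j x) ->
  (\forall n \near \oo, forall j, (j < n.+1 - s n)%N -> pexp n (F n j) <= C * v n) ->
  \forall n \near \oo, pexp n (fun x => `|\sum_(j < n.+1 - s n) F n j x -
    \sum_(j < nb_blocks n * s n) F n j x|) <= 2 * C * ((s n)%:R * v n).
Proof.
move=> F0 FC; near=> n.
have [s1 Bs nB s4 _] : blocks_geometry n by near: n; exact: near_blocks.
have FCn : forall j, (j < n.+1 - s n)%N -> pexp n (F n j) <= C * v n by near: n.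
set m := (nb_blocks n * s n)%N; set m' := (n.+1 - s n)%N.
have mm' : (m + (m' - m) = m')%N by rewrite subnKC.
have E x : \sum_(j < m') F n j x - \sum_(j < m) F n j x = \sum_(j < m' - m) F n (m + j)%N x.
  have : \sum_(j < m + (m' - m)) F n j x - \sum_(j < m) F n j x = \sum_(j < m' - m) F n (m + j)%N x.
    by apply/eqP; rewrite subr_eq big_split_ord/= addrC.
  by rewrite mm'.
have C0 : 0 <= C * v n.
  by apply: le_trans (FCn 0%N _); [exact: pexp_ge0|clear - s4 s1; lia].
apply: (@le_trans _ _ (pexp n (fun x => \sum_(j < m' - m) F n (m + j)%N x))).
  by apply: pexp_le => x; rewrite E ger0_norm// sumr_ge0.
rewrite pexp_sum; apply: (@le_trans _ _ (\sum_(j < m' - m) C * v n)).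
  apply: ler_sum => j _; apply: FCn; have := ltn_ord j; clear - mm'; lia.
rewrite sumr_const card_ord -[leLHS]mulr_natl.
rewrite (_ : 2 * C * _ = (2 * (s n)%:R) * (C * v n)); last by ring.
by rewrite ler_wpM2r// -natrM ler_nat; clear - nB; lia.
Unshelve. all: by end_near. Qed.

Lemma denominator_rest : \forall n \near \oo,
  pexp n (fun x => `|denominator n x - \sum_(b < nb_blocks n)
    count_seq (s n) (shift_seq (1 + b * s n) x)|) <= 2 * 1 * ((s n)%:R * v n).
Proof.
have := @trailing_sum_le (fun n j x => (x (1 + j)%N)%:R) 1 (fun _ _ _ => ler0n _ _).
move=> h; near=> n.
have -> : pexp n (fun x => `|denominator n x - \sum_(b < nb_blocks n)
    count_seq (s n) (shift_seq (1 + b * s n) x)|) =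
  pexp n (fun x => `|\sum_(j < n.+1 - s n) (x (1 + j)%N)%:R -
    \sum_(j < nb_blocks n * s n) (x (1 + j)%N)%:R|).
  apply: eq_fexp => om; congr `|_ - _|.
  rewrite (sum_ord_mul (fun j => (extend om (1 + j)%N)%:R)); apply: eq_bigr => b _.
  by apply: eq_bigr => i _; rewrite /shift_seq addnA.
near: n; apply: h; near=> n => j jn; rewrite mul1r pexp_coord//.
have [s1 _ _ _ _] : blocks_geometry n by near: n; exact: near_blocks.
by clear - jn s1; lia.
Unshelve. all: by end_near. Qed.

Lemma block_sumE n H m x : block_sum n H 1 (s n) m x =
  \sum_(b < m) H (shift_seq (1 + b * s n) x) - m%:R * pexp n H.
Proof. by rewrite /block_sum sumrB sumr_const card_ord mulr_natl. Qed.

(** A law of large numbers, by dividing the central limit theorem for counts by [w n] once more. *)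
Lemma denominator_negl : asymp_negl p (fun n om => denominator n (extend om) / (n%:R * v n) - 1).
Proof.
have cnt_clt : cvg_law p (fun n om => block_sum n (count_seq (s n)) 1
    (s n) (nb_blocks n) (extend om) / w n) (Num.sqrt c).
  apply: (@small_blocks_clt (fun n => count_seq (s n)) 1) => //.
  - by move=> n; apply: local_widen (@local_count_seq (s n)) _ _ => //; lia.
  - by move=> n x; rewrite ger0_norm ?count_seq_ge0// mul1r count_seq_le//; lia.
  - apply: cvg_near_eq count_big_var; near=> n; congr (_ / _); apply: eq_fexp => om.
    by rewrite sum_count_blocks.
have n1 := asymp_negl_scale cnt_clt w_inv0.
have n2 : asymp_negl p (fun n om => (n%:R * v n)^-1 * (denominator n (extend om) -
    \sum_(b < nb_blocks n) count_seq (s n) (shift_seq (1 + b * s n) (extend om)))).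
  apply: asymp_negl_L1 => //.
  have lim0 : 2 * ((s n)%:R * v n / w n) * (w n)^-1 @[n --> \oo] --> 0.
    rewrite (_ : 0 = 2 * 0 * 0); last by rewrite mulr0.
    by apply: cvgM; [apply: cvgMr; exact: s_over_w|exact: w_inv0].
  apply: cvg0_le lim0; near=> n.
  have wn : 0 < w n by near: n; exact: w_gt0.
  have w2 : w n ^+ 2 = n%:R * v n by rewrite sqr_sqrtr ?mulr_ge0 ?v_ge0.
  move: wn w2; set y := Num.sqrt _ => wn w2; rewrite -w2 fexp_ge0//=.
  under eq_fexp do rewrite normrM normfV (ger0_norm (sqr_ge0 _)).
  rewrite fexpZ (_ : 2 * _ * _ = (y ^+ 2)^-1 * (2 * 1 * ((s n)%:R * v n))); last first.
    by field; rewrite gt_eqF.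
  rewrite ler_wpM2l ?invr_ge0 ?sqr_ge0//; near: n; exact: denominator_rest.
have n3 : asymp_negl p (fun n (om : Om n) => (nb_blocks n)%:R * (s n)%:R / n%:R - 1).
  apply: asymp_negl_cst; apply: norm_cvg0.
  have lim0 : 2 * ((r n)%:R / n%:R) @[n --> \oo] --> (0 : R).
    by rewrite -(mulr0 2); apply: cvgMr; exact: rn0.
  apply: cvg0_le lim0; near=> n; rewrite normr_ge0/=.
  have [s1 Bs nB s4 _] : blocks_geometry n by near: n; exact: near_blocks.
  have sr : (4 * s n <= r n)%N by near: n; exact: near_s_leq.
  have n0 : 0 < n%:R :> R by rewrite ltr0n; clear - s4 s1; lia.
  rewrite -[X in _ - X](divff (lt0r_neq0 n0)) -mulrBl normrM normfV (gtr0_norm n0) mulrA.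
  rewrite ler_wpM2r ?invr_ge0 ?(ltW n0)// distrC ger0_norm.
    by rewrite lerBlDr -!natrM -natrD ler_nat; clear - s1 Bs nB s4 sr; lia.
  by rewrite subr_ge0 -natrM ler_nat; clear - s1 Bs nB s4 sr; lia.
apply: asymp_negl_le (asymp_neglD p_ge0 (asymp_neglD p_ge0 n1 n2) n3) => //.
near=> n => om; rewrite le_eqVlt; apply/orP; left; apply/eqP; congr `|_|.
have wn : 0 < w n by near: n; exact: w_gt0.
have w2 : w n ^+ 2 = n%:R * v n by rewrite sqr_sqrtr ?mulr_ge0 ?v_ge0.
have v0 : 0 < v n by near: n; exact: near_v_gt0.
have n0 : 0 < n%:R :> R by rewrite ltr0n; near: n; exists 1%N.
have [s1 Bs nB s4 _] : blocks_geometry n by near: n; exact: near_blocks.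
rewrite block_sumE pexp_count; last by clear - s4; lia.
move: wn w2; set y := Num.sqrt _ => wn w2.
set S := \sum_(b < _) _.
have -> : y^-1 * ((S - (nb_blocks n)%:R * ((s n)%:R * v n)) / y) =
   (S - (nb_blocks n)%:R * ((s n)%:R * v n)) / (n%:R * v n).
  by rewrite -w2; field; rewrite gt_eqF.
by field; rewrite !gt_eqF.
Unshelve. all: by end_near. Qed.

Section ratio_clt.
(** [Nm] is the numerator and [zeta] the share of one block. What distinguishes the estimators is
    put into conditions: closeness of a group to the indicator in L2 and L1, the bias, and the error
    of cutting the numerator into blocks. *)
Variables (zeta Nm : nat -> (nat -> bool) -> R) (theta C : R).
Hypothesis zeta_local : forall n, local 0 (2 * s n) (zeta n).
Hypothesis zeta_le : forall n x, 0 <= zeta n x <= count_seq (2 * s n) x.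
Local Notation group n := (fun x => \sum_(b < nb_small n - 2) zeta n (shift_seq (b * s n) x)).
Hypothesis dev2 : pexp n (fun x => (group n x - (hit (big_len n) x)%:R) ^+ 2) / ((r n)%:R * v n)
  @[n --> \oo] --> 0.
Hypothesis dev1 : pexp n (fun x => `|group n x - (hit (big_len n) x)%:R|) / ((r n)%:R * v n)
  @[n --> \oo] --> 0.
Hypothesis bias : w n * (pexp n (zeta n) / ((s n)%:R * v n) - theta) @[n --> \oo] --> 0.
Hypothesis rest_le : \forall n \near \oo, pexp n (fun x => `|Nm n x -
  \sum_(b < nb_blocks n) zeta n (shift_seq (1 + b * s n) x)|) <= C * ((s n)%:R * v n).

Lemma group_mean : pexp n (group n) / ((r n)%:R * v n) @[n --> \oo] --> theta.
Proof.
have h : pexp n (zeta n) / ((s n)%:R * v n) @[n --> \oo] --> theta.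
  have cst : (fun=> theta) n @[n --> \oo] --> theta by exact: cvg_cst.
  rewrite (_ : theta = 0 * 0 + theta); last by rewrite mul0r add0r.
  apply: cvg_near_eq (cvgD (cvgM w_inv0 bias) cst); near=> n.
  have wn : 0 < w n by near: n; exact: w_gt0.
  by rewrite /= mulKf ?gt_eqF// subrK.
rewrite -[X in _ --> X]mul1r; apply: cvg_near_eq (cvgM big_len_ratio h); near=> n.
have [s1 Lr rL Ls rn] : big_block_geometry n by near: n; exact: near_big_len.
have v0 : 0 < v n by near: n; exact: near_v_gt0.
have r0 : 0 < (r n)%:R :> R by rewrite ltr0n; near: n.
have s0 : 0 < (s n)%:R :> R by rewrite ltr0n.
rewrite pexp_sum (eq_bigr (fun=> pexp n (zeta n))); last first.
  move=> b _; apply: (pexp_shift (@zeta_local n)).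
  have : (b.+1 * s n <= big_len n)%N by rewrite leq_mul2r ltn_ord orbT.
  by rewrite mulSnr; clear - Ls rn; lia.
rewrite sumr_const card_ord -[X in _ = X / _]mulr_natl /big_len natrM.
by field; rewrite !gt_eqF.
Unshelve. all: by end_near. Qed.

Lemma centered_blocks_clt : cvg_law p (fun n om => block_sum n
  (fun x => zeta n x - theta * count_seq (s n) x) 1 (s n) (nb_blocks n) (extend om) / w n)
  (Num.sqrt (theta * (theta * c - 1))).
Proof.
apply: (@small_blocks_clt (fun n x => zeta n x - theta * count_seq (s n) x) (1 + `|theta|)).
- by rewrite addr_ge0.
- move=> n x y xy; rewrite (zeta_local xy); congr (_ - _ * _).
  by apply: local_count_seq => i; rewrite add0n => h; apply: xy; clear - h; lia.
- move=> n x; have /andP[z0 z1] := zeta_le n x.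
  rewrite (le_trans (ler_normB _ _))// mulrDl mul1r lerD//; first by rewrite ger0_norm.
  by rewrite normrM ler_wpM2l// ger0_norm ?count_seq_ge0// count_seq_le//; lia.
- apply: cvg_near_eq (block_variance dev2 dev1 group_mean); near=> n.
  congr (_ / _); apply: eq_fexp => om; congr (_ ^+ 2).
  by rewrite sumrB -mulr_sumr sum_count_blocks.
Unshelve. all: by end_near. Qed.

Lemma rest_negl_of (Z : nat -> (nat -> bool) -> R) (C' : R) :
  (\forall n \near \oo, pexp n (fun x => `|Z n x|) <= C' * ((s n)%:R * v n)) ->
  asymp_negl p (fun n om => Z n (extend om) / w n).
Proof.
move=> ZC; apply: asymp_negl_L1 => //.
have lim0 : C' * ((s n)%:R * v n / w n) @[n --> \oo] --> 0.
  by rewrite -(mulr0 C'); apply: cvgMr; exact: s_over_w.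
apply: cvg0_le lim0; near=> n.
have wn : 0 < w n by near: n; exact: w_gt0.
have h : pexp n (fun x => `|Z n x|) <= C' * ((s n)%:R * v n) by near: n.
rewrite fexp_ge0//=; under eq_fexp do rewrite normrM normfV (gtr0_norm wn) mulrC.
by rewrite fexpZ mulrC mulrA ler_wpM2r ?invr_ge0 ?(ltW wn).
Unshelve. all: by end_near. Qed.

Lemma numerator_clt : cvg_law p (fun n om =>
  (Nm n (extend om) - theta * denominator n (extend om)) / w n)
  (Num.sqrt (theta * (theta * c - 1))).
Proof.
apply: (cvg_law_transfer _ _ centered_blocks_clt) => //.
have n1 := rest_negl_of rest_le.
have n2 := @rest_negl_of (fun n x => theta * (\sum_(b < nb_blocks n)
    count_seq (s n) (shift_seq (1 + b * s n) x) - denominator n x)) (`|theta| * 2).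
have {}n2 : asymp_negl p (fun n om => theta * (\sum_(b < nb_blocks n)
    count_seq (s n) (shift_seq (1 + b * s n) (extend om)) - denominator n (extend om)) / w n).
  apply: n2; near=> n.
  have h : pexp n (fun x => `|denominator n x - \sum_(b < nb_blocks n)
    count_seq (s n) (shift_seq (1 + b * s n) x)|) <= 2 * 1 * ((s n)%:R * v n).
    by near: n; exact: denominator_rest.
  rewrite /pexp; under eq_fexp do rewrite normrM distrC.
  by rewrite fexpZ -mulrA ler_wpM2l//; rewrite mulr1 in h.
(* The bias summed over the blocks is the quantity in [bias] times [nb_blocks * s / n], which is at
   most 1. *)
have n3 : asymp_negl p (fun n (om : Om n) => (nb_blocks n)%:R *
    (pexp n (zeta n) - theta * ((s n)%:R * v n)) / w n).
  apply: asymp_negl_cst; apply: norm_cvg0.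
  have lim0 : `|w n * (pexp n (zeta n) / ((s n)%:R * v n) - theta)| @[n --> \oo] --> 0.
    by rewrite -(@normr0 _ R); exact: cvg_norm.
  apply: cvg0_le lim0; near=> n; rewrite normr_ge0/=.
  have wn : 0 < w n by near: n; exact: w_gt0.
  have w2 : w n ^+ 2 = n%:R * v n by rewrite sqr_sqrtr ?mulr_ge0 ?v_ge0.
  have v0 : 0 < v n by near: n; exact: near_v_gt0.
  have [s1 _ _ s4 BE] : blocks_geometry n by near: n; exact: near_blocks.
  have s0 : 0 < (s n)%:R :> R by rewrite ltr0n.
  have n0 : 0 < n%:R :> R by rewrite ltr0n; clear - s1 s4; lia.
  have Bsn : (nb_blocks n)%:R * (s n)%:R <= n%:R :> R.
    rewrite -natrM ler_nat (leq_trans _ (leq_divM n (s n)))// leq_mul2r -BE.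
    by rewrite leq_addr orbT.
  move: wn w2; set y := Num.sqrt _ => wn w2.
  set z := pexp n (zeta n).
  rewrite (_ : _ / y = ((nb_blocks n)%:R * (s n)%:R / n%:R) *
    (y * (z / ((s n)%:R * v n) - theta))); last first.
    have vE : v n = y ^+ 2 / n%:R by rewrite w2 mulrC mulKf// gt_eqF.
    by rewrite vE; field; rewrite !gt_eqF.
  rewrite normrM ler_piMl// ger0_norm ?divr_ge0 ?mulr_ge0//.
  by rewrite ler_pdivrMr// mul1r.
apply: asymp_negl_le (asymp_neglD p_ge0 (asymp_neglD p_ge0 n1 n2) n3) => //.
near=> n => om; rewrite le_eqVlt; apply/orP; left; apply/eqP; congr `|_|.
have [s1 _ _ s4 BE] : blocks_geometry n by near: n; exact: near_blocks.
rewrite block_sumE sumrB -mulr_sumr.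
have -> : pexp n (fun x => zeta n x - theta * count_seq (s n) x) =
    pexp n (zeta n) - theta * ((s n)%:R * v n).
  rewrite -(@pexp_count n (s n)); last by clear - s4; lia.
  by rewrite -pexpZ /pexp -fexpB.
by ring.
Unshelve. all: by end_near. Qed.

(** Inherited from the normalized second moments of which it is the limit. *)
Lemma limit_variance_ge0 : 0 <= theta * (theta * c - 1).
Proof.
apply: (cvgr_to_ge (block_variance dev2 dev1 group_mean)); near=> n.
by rewrite divr_ge0 ?mulr_ge0 ?v_ge0// pexp_ge0// => x; exact: sqr_ge0.
Unshelve. all: by end_near. Qed.

Theorem ratio_clt : 0 <= theta * (theta * c - 1) /\ cvg_law p (fun n om =>
  w n * (Nm n (extend om) / denominator n (extend om) - theta))
  (Num.sqrt (theta * (theta * c - 1))).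
Proof.
split; first exact: limit_variance_ge0.
have numD := asymp_negl_ratio p_ge0 numerator_clt denominator_negl.
(* The statistic is the numerator term over the normalized denominator, except where the denominator
   is 0: there the convention [x / 0 = 0] breaks the identity. On that event [|D / (n v) - 1| = 1],
   so its probability vanishes. *)
apply: (cvg_law_transfer _ _ (cvg_law_transfer _ _ numerator_clt numD)) => // d d0.
have h2 : 0 < 2^-1 :> R by rewrite invr_gt0.
apply: cvg0_le (denominator_negl h2); near=> n.
rewrite fprob_ge0//=; apply: fprob_le => // om; apply: contraTT; rewrite -!leNgt => Dn.
have wn : 0 < w n by near: n; exact: w_gt0.
have w2 : w n ^+ 2 = n%:R * v n by rewrite sqr_sqrtr ?mulr_ge0 ?v_ge0.
move: wn w2 Dn; set y := Num.sqrt _ => wn w2; rewrite -w2 => Dn.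
have [D0|D0] := eqVneq (denominator n (extend om)) 0.
  by move: Dn; rewrite D0 mul0r sub0r normrN1; lra.
rewrite (_ : _ - _ = 0) ?normr0 ?ltW//.
by field; rewrite D0 gt_eqF.
Unshelve. all: by end_near. Qed.

End ratio_clt.

(** * The three estimators *)

Lemma near_pexp_shift (H : nat -> (nat -> bool) -> R) : (forall n, local 0 (2 * s n) (H n)) ->
  \forall n \near \oo, forall i, (i <= 2 * s n)%N ->
  pexp n (fun x => H n (shift_seq i x)) = pexp n (H n).
Proof.
move=> Hl; near=> n => i i2; apply: (pexp_shift (@Hl n)).
have [_ _ _ s4 _] : blocks_geometry n by near: n; exact: near_blocks.
by clear - s4 i2; lia.
Unshelve. all: by end_near. Qed.

Lemma pexp_hit_le n a : (a + s n <= n.+1)%N ->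
  pexp n (fun x => (hit (s n) (shift_seq a x))%:R) <= (s n)%:R * v n.
Proof.
move=> an; rewrite (pexp_shift (@local_hit (s n)) an).
rewrite -(@pexp_count n (s n)); first by apply: pexp_le => x; exact: hit_le_count.
exact: leq_trans (leq_addl _ _) an.
Qed.

Lemma hit_local2 n : local 0 (2 * s n) (fun x => (hit (s n) x)%:R : R).
Proof. by apply: local_widen (@local_hit (s n)) _ _ => //; lia. Qed.

Section disjoint_sliding.
Variable theta : R.
Hypothesis bias : w n * (pexp n (fun x => (hit (s n) x)%:R) / ((s n)%:R * v n) - theta)
  @[n --> \oo] --> 0.

Theorem disjoint_clt : 0 <= theta * (theta * c - 1) /\ cvg_law p (fun n om => w n *
  (disjoint_sum (s n) (n %/ s n) (shift_seq 1 (extend om)) / denominator n (extend om) - theta))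
  (Num.sqrt (theta * (theta * c - 1))).
Proof.
apply: (@ratio_clt (fun n x => (hit (s n) x)%:R)
  (fun n x => disjoint_sum (s n) (n %/ s n) (shift_seq 1 x)) theta 1) => //.
- exact: hit_local2.
- move=> n x; rewrite ler0n (le_trans (hit_le_count _ _))// count_seq_le//; lia.
- exact: disjoint_dev_lim.
- apply: cvg0_le disjoint_dev_lim; near=> n.
  have rv : 0 < (r n)%:R * v n by near: n; exact: near_rv_gt0.
  rewrite mulr_ge0 ?invr_ge0 ?(ltW rv) ?pexp_ge0//= ler_wpM2r ?invr_ge0 ?(ltW rv)//.
  by apply: pexp_le => x; exact: disjoint_dist_le.
(* The estimator has [n %/ s = nb_blocks + 1] blocks, so the rest is a single block, of mean at most
   [s v]. *)
- near=> n; have [s1 Bs _ s4 BE] : blocks_geometry n by near: n; exact: near_blocks.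
  rewrite mul1r; apply: le_trans (@pexp_hit_le n (1 + nb_blocks n * s n) _); last first.
    by have := leq_divM n (s n); rewrite -BE mulnDl mul1n; clear; lia.
  apply: pexp_le => x; rewrite /disjoint_sum -BE addn1 big_ord_recr/=.
  under eq_bigr do rewrite shift_seqD.
  by rewrite shift_seqD addrAC subrr add0r ger0_norm.
Unshelve. all: by end_near. Qed.

Lemma sliding_avg_local n : local 0 (2 * s n) (sliding_avg (s n)).
Proof.
move=> x y xy; congr (_ * _); apply: eq_bigr => i _.
apply: local_hit => j; rewrite add0n => js; apply: xy; have := ltn_ord i; clear - js; lia.
Qed.

Theorem sliding_clt : 0 <= theta * (theta * c - 1) /\ cvg_law p (fun n om => w n *
  ((s n)%:R^-1 * (\sum_(j < n.+1 - s n) (hit (s n) (shift_seq (1 + j) (extend om)))%:R) /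
    denominator n (extend om) - theta))
  (Num.sqrt (theta * (theta * c - 1))).
Proof.
apply: (@ratio_clt (fun n => sliding_avg (s n))
  (fun n x => (s n)%:R^-1 * (\sum_(j < n.+1 - s n) (hit (s n) (shift_seq (1 + j) x))%:R)) theta 2).
- exact: sliding_avg_local.
- move=> n x; rewrite /sliding_avg mulr_ge0 ?invr_ge0 ?sumr_ge0//=.
  have [s0|s0] := posnP (s n); first by rewrite s0 big_ord0 mulr0 count_seq_ge0.
  rewrite mulrC ler_pdivrMr ?ltr0n// mulr_natr -[X in _ *+ X]card_ord -sumr_const.
  apply: ler_sum => i _; rewrite (le_trans (hit_le_count _ _))//.
  apply: (@le_trans _ _ (count_seq (i + s n) x)).
    by rewrite count_seqD lerDr count_seq_ge0.
  by apply: count_seq_le; have := ltn_ord i; clear; lia.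
- have lim0 : 2 * (pexp n (sliding_err (s n) (nb_small n - 2)) / ((r n)%:R * v n)) @[n --> \oo] --> 0.
    by rewrite -(mulr0 2); apply: cvgMr; exact: sliding_err_lim.
  apply: cvg0_le lim0; near=> n.
  have rv : 0 < (r n)%:R * v n by near: n; exact: near_rv_gt0.
  have s1 : (0 < s n)%N by near: n; exact: near_s_ge.
  apply/andP; split.
    by rewrite mulr_ge0 ?invr_ge0 ?(ltW rv)// pexp_ge0// => x; exact: sqr_ge0.
  rewrite mulrA ler_wpM2r ?invr_ge0 ?(ltW rv)// -pexpZ.
  by apply: pexp_le => x; have [] := sliding_dev (nb_small n - 2) x s1.
- apply: cvg0_le sliding_err_lim; near=> n.
  have rv : 0 < (r n)%:R * v n by near: n; exact: near_rv_gt0.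
  have s1 : (0 < s n)%N by near: n; exact: near_s_ge.
  rewrite mulr_ge0 ?invr_ge0 ?(ltW rv) ?pexp_ge0//= ler_wpM2r ?invr_ge0 ?(ltW rv)//.
  by apply: pexp_le => x; have [] := sliding_dev (nb_small n - 2) x s1.
(* By stationarity the average over offsets has the mean of a single block, so both estimators share
   one bias condition. *)
- apply: cvg_near_eq bias; near=> n.
  have s1 : (0 < s n)%N by near: n; exact: near_s_ge.
  have sh : forall i, (i <= 2 * s n)%N ->
      pexp n (fun x => (hit (s n) (shift_seq i x))%:R) = pexp n (fun x => (hit (s n) x)%:R).
    by near: n; exact: near_pexp_shift hit_local2.
  congr (_ * (_ / _ - _)); rewrite /sliding_avg pexpZ pexp_sum.
  rewrite (eq_bigr (fun=> pexp n (fun x => (hit (s n) x)%:R))); last first.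
    by move=> i _; apply: sh; have := ltn_ord i; clear; lia.
  by rewrite sumr_const card_ord -[X in _ * X]mulr_natl mulKf// pnatr_eq0 -lt0n.
- near=> n; have [s1 Bs nB s4 BE] : blocks_geometry n by near: n; exact: near_blocks.
  have trail : pexp n (fun x => `|\sum_(j < n.+1 - s n) (s n)%:R^-1 * (hit (s n) (shift_seq (1 + j) x))%:R -
      \sum_(j < nb_blocks n * s n) (s n)%:R^-1 * (hit (s n) (shift_seq (1 + j) x))%:R|) <=
      2 * 1 * ((s n)%:R * v n).
    near: n; apply: (@trailing_sum_le (fun n j x => (s n)%:R^-1 * (hit (s n) (shift_seq (1 + j) x))%:R)).
      by move=> n j x; rewrite mulr_ge0 ?invr_ge0.
    near=> n => j jn; rewrite pexpZ mul1r.
    have s0 : (0 < s n)%N by near: n; exact: near_s_ge.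
    rewrite mulrC ler_pdivrMr ?ltr0n// [leRHS]mulrC pexp_hit_le//.
    by clear - jn; lia.
  rewrite mulr1 in trail; apply: le_trans trail.
  rewrite le_eqVlt; apply/orP; left; apply/eqP; apply: eq_fexp => om; congr `|_ - _|.
    by rewrite mulr_sumr.
  rewrite (sum_ord_mul (fun j => (s n)%:R^-1 * (hit (s n) (shift_seq (1 + j) (extend om)))%:R)).
  apply: eq_bigr => b _; rewrite /sliding_avg mulr_sumr; apply: eq_bigr => i _.
  by rewrite shift_seqD addnA.
Unshelve. all: by end_near. Qed.
End disjoint_sliding.

Lemma isolated_local s0 i len : (i + s0 <= len)%N -> (i < len)%N ->
  local 0 len (fun x => (isolated s0 x i)%:R : R).
Proof.
move=> isl il x y xy; rewrite /isolated xy//; congr ((_ && ~~ _)%:R).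
apply: eq_existsb => j; rewrite /shift_seq xy// add0n; have := ltn_ord j; clear - isl; lia.
Qed.

Lemma isolated_le s0 x i : (isolated s0 x i)%:R <= (x i)%:R :> R.
Proof. by rewrite ler_nat /isolated; case: (x i); rewrite ?leq_b1. Qed.

Lemma isolated_shiftE s0 a x : isolated s0 (shift_seq a x) = shift_seq a (isolated s0 x).
Proof. by apply/funext => i; exact: isolated_shift. Qed.

Lemma pexp_isolated s0 n i : (i + s0 <= n.+1)%N -> (i <= n)%N ->
  pexp n (fun x => (isolated s0 x i)%:R) = pexp n (fun x => (isolated s0 x 0)%:R).
Proof.
move=> isn il.
(* [maxn 1]: bit 0 is read even if [s0 = 0]. *)
rewrite -(pexp_shift (@isolated_local s0 0 (maxn 1 s0) _ _) (_ : (i + _ <= n.+1)%N)).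
- by apply: eq_fexp => om; rewrite isolated_shift addn0.
- by rewrite add0n leq_maxr.
- by rewrite leq_maxl.
- by rewrite addn_maxr geq_max isn addn1 ltnS il.
Qed.

Theorem runs_clt (theta : R) :
  w n * (pexp n (fun x => (isolated (s n) x 0)%:R) / v n - theta) @[n --> \oo] --> 0 ->
  0 <= theta * (theta * c - 1) /\ cvg_law p (fun n om => w n *
    ((\sum_(j < n.+1 - s n) (isolated (s n) (extend om) (1 + j))%:R) /
      denominator n (extend om) - theta))
  (Num.sqrt (theta * (theta * c - 1))).
Proof.
move=> bias.
have group_runs n x : \sum_(b < nb_small n - 2)
    count_seq (s n) (isolated (s n) (shift_seq (b * s n) x)) =
    count_seq (big_len n) (isolated (s n) x).
  by rewrite -sum_count_blocks; apply: eq_bigr => b _; rewrite isolated_shiftE.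
have near_le : \forall n \near \oo, [/\ (1 <= s n)%N & (4 * s n <= n)%N].
  near=> n.
  by have [] : blocks_geometry n by near: n; exact: near_blocks.
apply: (@ratio_clt (fun n x => count_seq (s n) (isolated (s n) x))
  (fun n x => \sum_(j < n.+1 - s n) (isolated (s n) x (1 + j))%:R) theta 2).
- move=> n x y xy; apply: eq_bigr => i _.
  by have il := ltn_ord i; apply: (isolated_local _ _ xy); clear - il; lia.
- move=> n x; rewrite count_seq_ge0/=; apply: (@le_trans _ _ (count_seq (s n) x)).
    by apply: ler_sum => i _; exact: isolated_le.
  by apply: count_seq_le; lia.
- by apply: cvg_near_eq runs_dev_lim; near=> n; congr (_ / _); apply: eq_fexp => om; rewrite group_runs.
- apply: cvg0_le runs_dev_lim; near=> n.
  have rv : 0 < (r n)%:R * v n by near: n; exact: near_rv_gt0.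
  rewrite mulr_ge0 ?invr_ge0 ?(ltW rv) ?pexp_ge0//= ler_wpM2r ?invr_ge0 ?(ltW rv)//.
  by apply: pexp_le => x; rewrite group_runs; exact: runs_dist_le.
- apply: cvg_near_eq bias; near=> n.
  have [s1 s4] : [/\ (1 <= s n)%N & (4 * s n <= n)%N] by near: n.
  have v0 : 0 < v n by near: n; exact: near_v_gt0.
  have s0 : 0 < (s n)%:R :> R by rewrite ltr0n.
  rewrite /count_seq pexp_sum (eq_bigr (fun=> pexp n (fun x => (isolated (s n) x 0)%:R))).
    rewrite sumr_const card_ord -[X in _ = _ * (X / _ - _)]mulr_natl.
    by congr (_ * (_ - _)); field; rewrite !gt_eqF.
  by move=> i _; have il := ltn_ord i; rewrite pexp_isolated//; clear - s4 il; lia.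
- near=> n.
  have [s1 s4] : [/\ (1 <= s n)%N & (4 * s n <= n)%N] by near: n.
  have trail : pexp n (fun x => `|\sum_(j < n.+1 - s n) (isolated (s n) x (1 + j))%:R -
      \sum_(j < nb_blocks n * s n) (isolated (s n) x (1 + j))%:R|) <=
      2 * 1 * ((s n)%:R * v n).
    near: n; apply: (@trailing_sum_le (fun n j x => (isolated (s n) x (1 + j))%:R)).
      by move=> n j x; rewrite ler0n.
    near=> n => j jn; rewrite mul1r.
    have s0 : (0 < s n)%N by near: n; exact: near_s_ge.
    rewrite -(@pexp_coord n (1 + j)); last by clear - jn s0; lia.
    by apply: pexp_le => x; exact: isolated_le.
  rewrite mulr1 in trail; apply: le_trans trail.
  rewrite le_eqVlt; apply/orP; left; apply/eqP; apply: eq_fexp => om; congr `|_ - _|.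
  rewrite (sum_ord_mul (fun j => (isolated (s n) (extend om) (1 + j))%:R)).
  apply: eq_bigr => b _; apply: eq_bigr => i _.
  by rewrite isolated_shift addnA.
Unshelve. all: by end_near. Qed.

End block_clt.

(** * From patterns to the time series *)

Section sequences.
Context {R : realType}.
Implicit Types f g : nat -> R.

(* Where [g n = 0] the ratio is [0], by the convention [x / 0 = 0]. *)
Lemma littleo_ratio f g : f =o_\oo g -> f n / g n @[n --> \oo] --> 0.
Proof.
move=> /eqoP fg; apply/cvgrPdist_le => e e0; near=> n.
have : `|f n| <= e * `|g n| by near: n; exact: fg.
rewrite sub0r normrN normrM normfV.
have [->|g0] := eqVneq (g n) 0; first by move=> _; rewrite normr0 invr0 mulr0 ltW.
by rewrite ler_pdivrMr// normr_gt0.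
Unshelve. all: by end_near. Qed.

(** If the head of the limits is close to [total], so is the head of [e n] for large [n]; as the
    whole sum tends to [total] too, little is left for the tail. *)
Lemma partial_sums_tail (e : nat -> nat -> R) (einf : nat -> R) (total : R) (r : nat -> nat) :
  r n @[n --> \oo] --> \oo ->
  (forall k, (1 <= k)%N -> e n k @[n --> \oo] --> einf k) ->
  \sum_(1 <= k < m.+1) einf k @[m --> \oo] --> total ->
  \sum_(1 <= k < (r n).+1) e n k @[n --> \oo] --> total ->
  forall q : R, 0 < q -> exists K : nat,
    \forall n \near \oo, \sum_(K.+1 <= k < (r n).+1) e n k <= q.
Proof.
move=> r_oo e_lim sum_lim tot q q0.
have q3 : 0 < q / 3 by rewrite divr_gt0.
have [K] : exists K, `|total - \sum_(1 <= k < K.+1) einf k| <= q / 3.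
  have [K _ hK] : \forall m \near \oo, `|total - \sum_(1 <= k < m.+1) einf k| <= q / 3.
    exact: cvgr_dist_le sum_lim _ q3.
  by exists K; apply: (hK K) => /=.
move=> hK; exists K.
have head : \sum_(1 <= k < K.+1) e n k @[n --> \oo] --> \sum_(1 <= k < K.+1) einf k.
  elim: K {hK} => [|K IH].
    rewrite big_geq//; under eq_fun do rewrite big_geq//; exact: cvg_cst.
  rewrite big_nat_recr//=; under eq_fun do rewrite big_nat_recr//=.
  by apply: cvgD => //; exact: e_lim.
near=> n.
have rK : (K.+1 <= r n)%N.
  near: n; have h : \oo [set k | (K.+1 <= k)%N] by exists K.+1.
  exact: (r_oo _ h).
have h1 : `|total - \sum_(1 <= k < (r n).+1) e n k| <= q / 3.
  by near: n; exact: cvgr_dist_le tot _ q3.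
have h2 : `|\sum_(1 <= k < K.+1) einf k - \sum_(1 <= k < K.+1) e n k| <= q / 3.
  by near: n; exact: cvgr_dist_le head _ q3.
have split : \sum_(1 <= k < (r n).+1) e n k =
    \sum_(1 <= k < K.+1) e n k + \sum_(K.+1 <= k < (r n).+1) e n k.
  by apply: big_cat_nat => //; exact: leqW.
move: hK h1 h2; rewrite !ler_norml => /andP[_ a1] /andP[a2 _] /andP[a3 a4].
move: a2; rewrite split; lra.
Unshelve. all: by end_near. Qed.

(** Since [a] is positive, a finite product rules out infinite values of [b]. The absolute value
    makes the bound nonnegative for every [n], as the abstract setting demands of [bt]. *)
Lemma cvg_fine_scale (a : nat -> R) (b : nat -> \bar R) :
  (\forall n \near \oo, 0 < a n) ->
  ((a n)%:E * b n @[n --> \oo] --> 0)%E ->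
  (\forall n \near \oo, b n \is a fin_num) /\ a n * `|fine (b n)| @[n --> \oo] --> 0.
Proof.
move=> a0 /fine_cvgP[fin lim].
have bfin : \forall n \near \oo, b n \is a fin_num.
  near=> n; have an : 0 < a n by near: n.
  have : ((a n)%:E * b n)%E \is a fin_num by near: n.
  case: (b n) => //; first by rewrite gt0_muley// lte_fin.
  by rewrite gt0_muleNy// lte_fin.
split=> //; have : `|fine ((a n)%:E * b n)| @[n --> \oo] --> 0.
  by rewrite -(@normr0 _ R); exact: cvg_norm.
apply: cvg_near_eq; near=> n.
have an : 0 < a n by near: n.
have bn : b n \is a fin_num by near: n.
by rewrite fineM// normrM gtr0_norm.
Unshelve. all: by end_near. Qed.

End sequences.

(** * Events and estimators in terms of patterns *)

Section exceedance_patterns.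
Context {d : measure_display} {T : measurableType d} {R : realType}.
Variables (P : probability T R) (X : int -> {RV P >-> R}).
Hypothesis X_stationary : stationary X.

Lemma prob_exceeds_pattern n i u : (i <= n)%N ->
  prob P (exceeds X (Posz i) u) = fexp (pattern_weight X (n:=n) u) (fun om => (extend om i)%:R).
Proof.
move=> ni; rewrite -prob_pattern; congr (prob P _).
by apply/seteqP; split=> w; rewrite /exceeds /= extend_pattern.
Qed.

Lemma prob_exceeds_stationary i u : prob P (exceeds X (Posz i) u) = prob P (exceeds X 0 u).
Proof.
rewrite (@prob_exceeds_pattern i i)// (@prob_exceeds_pattern i 0)//.
have h : local 0 1 (fun x : nat -> bool => (x 0%N)%:R : R) by move=> x y xy; rewrite xy.
rewrite -(@fexp_pattern_shift _ _ _ _ _ i u _ i 1 X_stationary h) ?addn1//.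
by apply: eq_fexp => om; rewrite /shift_seq addn0.
Qed.

Lemma prob_pair_le n k u (e : R) : (1 <= k <= n)%N ->
  cond_prob P (exceeds X (Posz k) u) (exceeds X 0 u) <= e ->
  fexp (pattern_weight X (n:=n) u) (fun om => (extend om 0)%:R * (extend om k)%:R) <=
  prob P (exceeds X 1 u) * e.
Proof.
move=> /andP[k1 kn] ke; rewrite [prob P _](prob_exceeds_stationary 1).
have me i : measurable (exceeds X i u) by exact: measurable_exceeds.
have -> : fexp (pattern_weight X (n:=n) u) (fun om => (extend om 0)%:R * (extend om k)%:R) =
    prob P (exceeds X (Posz k) u `&` exceeds X 0 u).
  under eq_fexp do rewrite -natrM mulnb.
  rewrite -(prob_pattern X u (fun om : {ffun 'I_n.+1 -> bool} => extend om 0 && extend om k)).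
  congr (prob P _); apply/seteqP; split=> w; rewrite /exceeds /= !extend_pattern//.
    by move=> /andP[].
  by move=> [-> ->].
(* If exceeding has probability 0, the conditional probability is the default 0, but the joint
   probability vanishes as well. *)
have [B0|B0] := eqVneq (prob P (exceeds X 0 u)) 0.
  rewrite B0 mul0r -[leRHS]B0 fine_le ?fin_num_measure//.
  - exact: measurableI.
  - by apply: le_measure => //; rewrite inE//; exact: measurableI.
move: ke; rewrite /cond_prob ler_pdivrMr; first by rewrite mulrC.
by rewrite lt_neqAle eq_sym B0 fine_ge0.
Qed.

Lemma lt_bigmax_seq (l : seq nat) (F : nat -> R) (x0 u : R) :
  (u < \big[Num.max/x0]_(t <- l) F t) = (u < x0) || has (fun t => u < F t) l.
Proof.
elim: l => [|t l IH]; first by rewrite big_nil orbF.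
by rewrite big_cons lt_max IH /= orbCA.
Qed.

Lemma lt_block_max i j u w (y : nat -> bool) : (i <= j)%N ->
  (forall t, (t <= j)%N -> y t = (u < X (Posz t) w)) ->
  (u < block_max X i j w) = hit (j.+1 - i) (shift_seq i y).
Proof.
move=> ij yE; rewrite /block_max lt_bigmax_seq; apply/idP/existsP => [|[t]]; last first.
  have tj := ltn_ord t; rewrite /shift_seq yE; last by clear - tj; lia.
  move=> ut; apply/orP; right; apply/hasP; exists (i + t)%N => //.
  by rewrite mem_index_iota; clear - tj; lia.
have ex t : (i <= t)%N -> (t <= j)%N -> u < X (Posz t) w ->
    exists t' : 'I_(j.+1 - i), shift_seq i y t'.
  move=> it tj ut; have tlt : (t - i < j.+1 - i)%N by clear - it tj; lia.
  by exists (Ordinal tlt); rewrite /shift_seq/= subnKC// yE.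
move=> /orP[ui|/hasP[t]]; first exact: ex ij ui.
by rewrite mem_index_iota ltnS => /andP[it tj]; exact: ex.
Qed.

End exceedance_patterns.

Section estimators.
Context {d : measure_display} {T : measurableType d} {R : realType}.
Variables (P : probability T R) (X : int -> {RV P >-> R}).

Lemma indic_bool (b : T -> bool) w : \1_[set w | b w] w = (b w)%:R :> R.
Proof.
by rewrite indicE; case: (boolP (b w)) => h; [rewrite mem_set|rewrite memNset//; apply/negP].
Qed.

Lemma sum_nat_shift1 (F : nat -> R) m : \sum_(1 <= i < m.+1) F i = \sum_(j < m) F (1 + j)%N.
Proof. by rewrite big_add1 big_mkord. Qed.

Variables (n s0 : nat) (u : R) (w : T).
Local Notation y := (extend (pattern X n u w)).

Lemma count_exceeds m : (m <= n)%N ->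
  \sum_(1 <= i < m.+1) \1_(exceeds X (Posz i) u) w = count_seq m (shift_seq 1 y) :> R.
Proof.
move=> mn; rewrite sum_nat_shift1; apply: eq_bigr => j _.
have jm := ltn_ord j.
by rewrite /exceeds indic_bool /shift_seq extend_pattern//; clear - jm mn; lia.
Qed.

Lemma hit_block_exceeds i j : (i <= j)%N -> (j <= n)%N ->
  \1_(block_exceeds X i j u) w = (hit (j.+1 - i) (shift_seq i y))%:R :> R.
Proof.
move=> ij jn; rewrite /block_exceeds indic_bool (lt_block_max ij (y := y))// => t tj.
by rewrite extend_pattern// (leq_trans tj jn).
Qed.

(** For [s0 >= 2] the block after [i] is nonempty; at [s0 = 1] the maximum over an empty range would
    default to [X_{i+1}]. *)
Lemma isolated_event i : (2 <= s0)%N -> (i + s0 <= n.+1)%N ->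
  (w \in exceeds X (Posz i) u `&` block_below X (i + 1) (i + s0 - 1) u) = isolated s0 y i.
Proof.
move=> s2 isn; rewrite in_setI; congr (_ && _).
  rewrite extend_pattern; last by clear - s2 isn; lia.
  by apply/idP/idP => [/set_mem//|h]; exact: mem_set.
have b : (u < block_max X (i + 1) (i + s0 - 1) w) = hit s0.-1 (shift_seq i.+1 y).
  rewrite (lt_block_max (y := y)); [|by clear - s2; lia|].
    by rewrite addn1; congr (hit _ _); clear - s2; lia.
  by move=> t ti; rewrite extend_pattern//; clear - ti isn s2; lia.
rewrite -b -leNgt /block_below.
by apply/idP/idP => [/set_mem//|h]; exact: mem_set.
Qed.

Lemma nb_exceedE : (1 <= s0)%N -> nb_exceed X n s0 u w = count_seq (n.+1 - s0) (shift_seq 1 y).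
Proof. by move=> s1; rewrite /nb_exceed count_exceeds//; clear - s1; lia. Qed.

Lemma disjoint_estimatorE : (1 <= s0)%N -> disjoint_blocks_estimator X n s0 u w =
  disjoint_sum s0 (n %/ s0) (shift_seq 1 y) / count_seq (n.+1 - s0) (shift_seq 1 y).
Proof.
move=> s1; rewrite /disjoint_blocks_estimator nb_exceedE//; congr (_ / _).
rewrite sum_nat_shift1; apply: eq_bigr => b _.
have bs : (b.+1 * s0 <= n)%N.
  by rewrite (leq_trans _ (leq_divM n s0))// leq_mul2r ltn_ord orbT.
rewrite add1n /= hit_block_exceeds//; last by rewrite mulSn; clear - s1; lia.
rewrite shift_seqD (addnC (b * s0)%N); congr ((hit _ _)%:R).
by rewrite mulSn; clear - s1; lia.
Qed.

Lemma sliding_estimatorE : (1 <= s0)%N -> sliding_blocks_estimator X n s0 u w =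
  s0%:R^-1 * (\sum_(j < n.+1 - s0) (hit s0 (shift_seq (1 + j) y))%:R) /
  count_seq (n.+1 - s0) (shift_seq 1 y).
Proof.
move=> s1; rewrite /sliding_blocks_estimator nb_exceedE//; congr (_ * _ / _).
rewrite sum_nat_shift1; apply: eq_bigr => j _; have jn := ltn_ord j.
rewrite hit_block_exceeds; [|by clear - s1; lia|by clear - jn; lia].
by congr ((hit _ _)%:R); clear - s1; lia.
Qed.

Lemma runs_estimatorE : (2 <= s0)%N -> runs_estimator X n s0 u w =
  (\sum_(j < n.+1 - s0) (isolated s0 y (1 + j))%:R) / count_seq (n.+1 - s0) (shift_seq 1 y).
Proof.
move=> s2; rewrite /runs_estimator nb_exceedE; last exact: ltnW.
congr (_ / _); rewrite sum_nat_shift1; apply: eq_bigr => j _; have jn := ltn_ord j.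
by rewrite indicE isolated_event//; clear - jn; lia.
Qed.

End estimators.

Section weak_convergence_patterns.
Context {d : measure_display} {T : measurableType d} {R : realType}.
Variables (P : probability T R) (X : int -> {RV P >-> R}) (u : nat -> R).

Lemma cvg_law_weak_cvg (Y : nat -> T -> R) (W : forall n, {ffun 'I_n.+1 -> bool} -> R) (s2 : R) :
  0 <= s2 -> cvg_law (fun n => pattern_weight X (n := n) (u n)) W (Num.sqrt s2) ->
  (\forall n \near \oo, forall w, Y n w = W n (pattern X n (u n) w)) ->
  weak_cvg_normal P Y 0 s2.
Proof.
move=> s20 lawW YW; split=> // f cf [M [_ fM]].
(* Boundedness provides every bound strictly above [M], whence [M + 1]. *)
have fM1 x : `|f x| <= M + 1 by apply: fM => //; rewrite ltrDl.
rewrite (integral_normal_law s20 cf fM1).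
have lim := cvg_law_continuous (fun n => @pattern_weight_ge0 _ _ _ _ X n (u n)) lawW cf fM1.
have EY : \forall n \near \oo, 'E_P[f \o Y n]%E =
    (fexp (pattern_weight X (u n)) (fun om => f (W n om)))%:E.
  near=> n; have Yn : forall w, Y n w = W n (pattern X n (u n) w) by near: n.
  rewrite -(expectation_pattern X (u n) (fun om => f (W n om))).
  by congr ('E_P[_])%E; apply/funext => w /=; rewrite Yn.
apply: cvg_EFin.
  by near=> n; have -> : 'E_P[f \o Y n]%E = (fexp (pattern_weight X (u n)) (fun om => f (W n om)))%:E
    by near: n.
apply: cvg_near_eq lim; near=> n => /=.
by have -> : 'E_P[f \o Y n]%E = (fexp (pattern_weight X (u n)) (fun om => f (W n om)))%:E
    by near: n.
Unshelve. all: by end_near. Qed.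

End weak_convergence_patterns.

Theorem theorem3p1 (d : measure_display) (T : measurableType d) (R : realType)
  (P : probability T R) (X : int -> {RV P >-> R}) (theta : R)
  (u v : nat -> R) (s r : nat -> nat) (c : R) :
  stationary X -> has_extremal_index X theta -> 0 < theta ->
  (forall n, v n = prob P (exceeds X 1 (u n))) ->
  v n @[n --> \oo] --> 0 ->
  n%:R * v n @[n --> \oo] --> +oo ->
  s n @[n --> \oo] --> \oo ->
  (fun n => (s n)%:R : R) =o_\oo (fun n => (r n)%:R : R) ->
  (r n)%:R * v n @[n --> \oo] --> 0 ->
  (fun n => (r n)%:R : R) =o_\oo (fun n => Num.sqrt (n%:R * v n)) ->
  ((n%:R / (r n)%:R)%:E * beta_mixing X n (s n - 1) @[n --> \oo] --> 0)%E ->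
  0 <= c ->
  (((r n)%:R * v n)^-1%:E *
     'E_P[fun w => ((\sum_(1 <= j < (r n).+1) \1_(exceeds X j (u n)) w) ^+ 2)%R]
     @[n --> \oo] --> c%:E)%E ->
  (exists (e : nat -> nat -> R) (einf : nat -> R) (total : R),
     [/\ forall n k, (1 <= k)%N ->
           cond_prob P (exceeds X k (u n)) (exceeds X 0 (u n)) <= e n k,
         forall k, (1 <= k)%N -> e n k @[n --> \oo] --> einf k,
         \sum_(1 <= k < m.+1) einf k @[m --> \oo] --> total &
         \sum_(1 <= k < (r n).+1) e n k @[n --> \oo] --> total]) ->
  ((fun n => prob P (block_exceeds X 1 (s n) (u n)) / ((s n)%:R * v n) - theta)
     =o_\oo (fun n => (Num.sqrt (n%:R * v n))^-1) ->
   weak_cvg_normal P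
     (fun n w => Num.sqrt (n%:R * v n) *
        (disjoint_blocks_estimator X n (s n) (u n) w - theta))
     0 (theta * (theta * c - 1)) /\
   weak_cvg_normal P
     (fun n w => Num.sqrt (n%:R * v n) *
        (sliding_blocks_estimator X n (s n) (u n) w - theta))
     0 (theta * (theta * c - 1))) /\
  ((fun n => cond_prob P (block_below X 2 (s n) (u n)) (exceeds X 1 (u n))
             - theta)
     =o_\oo (fun n => (Num.sqrt (n%:R * v n))^-1) ->
   weak_cvg_normal P
     (fun n w => Num.sqrt (n%:R * v n) *
        (runs_estimator X n (s n) (u n) w - theta))
     0 (theta * (theta * c - 1))).
Proof.
move=> sX _ _ vE v0 nv_oo s_oo so rv0 ro beta0 _ cnt [e [einf [total [e_ge e_lim e_sum e_tot]]]].
pose p n := @pattern_weight _ _ _ P X n (u n).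
(* Condition (3) says nothing about [e n 0], while nonnegativity is wanted for all [k]. *)
pose e' n k := if k is 0%N then 0 else e n k.
pose bt n := `|fine (beta_mixing X n (s n - 1))|.
have p_ge0 n om : 0 <= p n om by exact: pattern_weight_ge0.
have p_sum1 n : \sum_om p n om = 1 by exact: pattern_weight_sum1.
have p_shift n (H : (nat -> bool) -> R) a len : local 0 len H -> (a + len <= n.+1)%N ->
    pexp p n (fun x => H (shift_seq a x)) = pexp p n H.
  by move=> Hl an; exact: (fexp_pattern_shift (u n) sX Hl an).
have bt_ge0 n : 0 <= bt n by exact: normr_ge0.
have pv n : pexp p n (fun x => (x 0%N)%:R) = v n.
  by rewrite vE (prob_exceeds_stationary sX 1) (@prob_exceeds_pattern _ _ _ P X n 0).
have e'_ge0 n k : 0 <= e' n k.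
  case: k => // k; apply: le_trans (e_ge n k.+1 isT).
  by rewrite /cond_prob divr_ge0// fine_ge0.
have pair n k : (1 <= k <= n)%N ->
    pexp p n (fun x => (x 0%N)%:R * (x k)%:R) <= v n * e' n k.
  move=> kn; have /andP[k1 _] := kn; rewrite vE.
  by apply: prob_pair_le => //; case: k k1 {kn} => // k _; exact: e_ge.
have sr0 : (s n)%:R / (r n)%:R @[n --> \oo] --> (0 : R) by exact: littleo_ratio so.
have rw0 : (r n)%:R / Num.sqrt (n%:R * v n) @[n --> \oo] --> 0 by exact: littleo_ratio ro.
have s_ge K : \forall n \near \oo, (K <= s n)%N by exact: near_s_ge.
have sr : \forall n \near \oo, (s n <= r n)%N.
  move/eqoP : so => /(_ 1 ltr01); apply: filterS => n.
  by rewrite mul1r !normr_nat ler_nat.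
have r_gt0 : \forall n \near \oo, (0 < r n)%N.
  near=> n; apply: (@leq_trans (s n)); first by near: n; exact: s_ge.
  by near: n.
have r_oo : r n @[n --> \oo] --> \oo.
  move=> A [N _ NA]; change (\forall n \near \oo, A (r n)); near=> n; apply: NA => /=.
  by apply: (@leq_trans (s n)); near: n => //; exact: s_ge.
have nr_gt0 : \forall n \near \oo, 0 < n%:R / (r n)%:R :> R.
  near=> n; rewrite divr_gt0 ?ltr0n//; last by near: n.
  by near: n; exists 1%N.
have [beta_fin nbt0] := cvg_fine_scale nr_gt0 beta0.
have dec : \forall n \near \oo,
    forall l (W Y : (nat -> bool) -> R) (g : R -> R) (M : R),
    (1 <= l <= n - (s n - 1) - 1)%N -> local 1 l W ->
    local (l + (s n - 1) + 1) (n - (l + (s n - 1))) Y -> (forall x, `|g x| <= M) ->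
    `|fexp (p n) (fun om => g (W (extend om) + Y (extend om))) -
      fexp (p n) (fun om => fexp (p n) (fun om' => g (W (extend om) + Y (extend om'))))|
    <= M * (2 * bt n).
  near=> n => l W Y g M ln Wl Yl gM; apply: (fexp_pattern_decouple (u n) Wl Yl gM).
  have bfin : beta_mixing X n (s n - 1) \is a fin_num by near: n.
  apply: (@le_trans _ _ (beta_mixing X n (s n - 1))).
    by apply: ereal_sup_ubound; exists l.
  by rewrite -(fineK bfin) lee_fin ler_norm.
have e'E n K : \sum_(K.+1 <= k < (r n).+1) e' n k = \sum_(K.+1 <= k < (r n).+1) e n k.
  by rewrite big_nat [RHS]big_nat; apply: eq_bigr => -[|k].
have sum_le : \forall n \near \oo, \sum_(1 <= k < (r n).+1) e' n k <= total + 1.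
  near=> n; rewrite e'E -lerBlDl.
  have : `|total - \sum_(1 <= k < (r n).+1) e n k| <= 1.
    by near: n; exact: cvgr_dist_le e_tot _ ltr01.
  by rewrite ler_norml => /andP[+ _]; lra.
have tail q : 0 < q -> exists K, \forall n \near \oo, \sum_(K.+1 <= k < (r n).+1) e' n k <= q.
  move=> q0; have [K hK] := partial_sums_tail r_oo e_lim e_sum e_tot q0.
  by exists K; apply: filterS hK => n; rewrite e'E.
have rn : \forall n \near \oo, (r n <= n)%N.
  have := near_r_leq p_ge0 p_sum1 pv nv_oo rw0 1; apply: filterS => n; rewrite mul1n.
  exact.
have var : pexp p n (fun x => count_seq (r n) x ^+ 2) / ((r n)%:R * v n) @[n --> \oo] --> c.
  have /fine_cvgP[_] := cnt; apply: cvg_near_eq; near=> n => /=.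
  have rnn : (r n <= n)%N by near: n.
  (* Condition (2) counts over [X_1, ..., X_{r_n}], while [count_seq] starts at bit 0. *)
  rewrite -[X in X / _](@p_shift n (fun x => count_seq (r n) x ^+ 2) 1 (r n)); last first.
  - by rewrite add1n ltnS.
  - exact: (local_comp (fun t : R => t ^+ 2) (@local_count_seq R (r n))).
  rewrite /pexp [RHS]mulrC.
  rewrite (_ : (fun w => _) = fun w => count_seq (r n) (shift_seq 1 (extend (pattern X n (u n) w))) ^+ 2).
    by rewrite (expectation_pattern X (u n) (fun om => count_seq (r n) (shift_seq 1 (extend om)) ^+ 2)).
  by apply/funext => w; rewrite (count_exceeds X (u n) w rnn).
have bias_of (a : nat -> R) (t : R) : (fun n => a n - t) =o_\oo (fun n => (Num.sqrt (n%:R * v n))^-1) ->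
    Num.sqrt (n%:R * v n) * (a n - t) @[n --> \oo] --> 0.
  move=> /littleo_ratio; apply: cvg_near_eq; near=> n.
  by rewrite invrK mulrC.
split=> [/bias_of bias|/bias_of bias].
- have {}bias : Num.sqrt (n%:R * v n) *
      (pexp p n (fun x => (hit (s n) x)%:R) / ((s n)%:R * v n) - theta) @[n --> \oo] --> 0.
    apply: cvg_near_eq bias; near=> n.
    have s1 : (1 <= s n)%N by near: n; exact: s_ge.
    have sn : (s n <= n)%N by apply: (@leq_trans (r n)); near: n.
    congr (_ * (_ / _ - _)).
    rewrite -(p_shift n (fun x => (hit (s n) x)%:R) 1 (s n)); [|exact: local_hit|by rewrite add1n].
    apply: etrans (prob_pattern X (u n) (fun om : {ffun 'I_n.+1 -> bool} => hit (s n) (shift_seq 1 (extend om)))).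
    congr (prob P _); apply/seteqP.
    by split=> w; rewrite /block_exceeds /= (lt_block_max s1 (y := extend (pattern X n (u n) w)))
      ?subn1// => t ts; rewrite extend_pattern// (leq_trans ts).
  split.
  + have [s20 law] := disjoint_clt p_ge0 p_sum1 p_shift bt_ge0 dec pv e'_ge0 pair nv_oo s_oo
      r_gt0 sr0 rv0 rw0 nbt0 sum_le tail var bias.
    apply: (cvg_law_weak_cvg s20 law); near=> n => w; rewrite disjoint_estimatorE//.
    by near: n; exact: s_ge.
  + have [s20 law] := sliding_clt p_ge0 p_sum1 p_shift bt_ge0 dec pv e'_ge0 pair nv_oo s_oo
      r_gt0 sr0 rv0 rw0 nbt0 sum_le tail var bias.
    apply: (cvg_law_weak_cvg s20 law); near=> n => w; rewrite sliding_estimatorE//.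
    by near: n; exact: s_ge.
- have {}bias : Num.sqrt (n%:R * v n) *
      (pexp p n (fun x => (isolated (s n) x 0)%:R) / v n - theta) @[n --> \oo] --> 0.
    apply: cvg_near_eq bias; near=> n.
    have s2 : (2 <= s n)%N by near: n; exact: s_ge.
    have sn : (s n <= n)%N by apply: (@leq_trans (r n)); near: n.
    congr (_ * (_ - _)); rewrite /cond_prob -vE; congr (_ / _).
    rewrite -(p_shift n (fun x => (isolated (s n) x 0)%:R) 1 (s n)); first last.
    + by rewrite add1n.
    + by apply: isolated_local; rewrite ?add0n// (leq_trans _ s2).
    apply: etrans (prob_pattern X (u n) (fun om : {ffun 'I_n.+1 -> bool} =>
      isolated (s n) (shift_seq 1 (extend om)) 0)).
    have ev w : (w \in exceeds X 1 (u n) `&` block_below X 2 (s n) (u n)) =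
        isolated (s n) (shift_seq 1 (extend (pattern X n (u n) w))) 0.
      rewrite isolated_shift addn0 -isolated_event ?add1n//.
      by rewrite subn1.
    by congr (prob P _); rewrite setIC; apply/seteqP; split=> w /=; rewrite -ev;
      [move/mem_set|move/set_mem].
  have [s20 law] := runs_clt p_ge0 p_sum1 p_shift bt_ge0 dec pv e'_ge0 pair nv_oo s_oo
    r_gt0 sr0 rv0 rw0 nbt0 sum_le tail var bias.
  apply: (cvg_law_weak_cvg s20 law); near=> n => w; rewrite runs_estimatorE//.
  by near: n; exact: s_ge.
Unshelve. all: by end_near. Qed.
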